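(* Let $f\in L^2(0,T;L^2)$, $u_0\in H^1_0$, and let $u$ be the unique unilateral gradient flow for $\mathcal F(t,u)=\mathcal E(u)-\langle f(t),u\rangle$ with $u(0)=u_0$. Then $u$ solves $$\begin{cases}\dot u(t)=[Au(t)+f(t)]_+ & \text{in }L^2\text{ for a.e. }t\in(0,T),\\ u(0)=u_0,\end{cases}\qquad(\ast)$$ where $Au(t)+f(t)$ is a (locally finite) Radon measure and $[Au(t)+f(t)]_+$ is its positive part. In particular $\|\dot u(t)\|_{L^2}=|\dot u(t)|_{L^2_+}=\|[Au(t)+f(t)]_+\|_{L^2}$ for a.e. $t\in(0,T)$. Moreover, if $u\in L^\infty(0,T;H^1_0)\cap H^1(0,T;L^2)$ solves $(\ast)$ (with $Au(t)+f(t)$ a locally finite Radon measure for a.e. $t$), then for a.e. $t\in(0,T)$ it solves the variational inequality $$(Au(t),\phi)+\langle f(t),\phi\rangle\le\langle\dot u(t),\phi\rangle\qquad\text{for every }\phi\in H^1_0\text{ with }\phi\ge0;$$ equivalently (writing $\phi=z-u(t)$), $$\int_\Omega\dot u(t)(u(t)-z)\,dx+\int_\Omega\nabla u(t)\cdot B\nabla(u(t)-z)+b\,u(t)(u(t)-z)\,dx\le\int_\Omega f(t)(u(t)-z)\,dx$$ for every $z$ in the convex cone $K(t)=\{z\in H^1_0: z\ge u(t)\}$.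
   Context: Let $\Omega\subset\mathbb R^d$ be open and bounded, $T>0$; $L^2=L^2(\Omega)$, $H^1_0=H^1_0(\Omega)$, $H^{-1}$ its dual; $\langle\cdot,\cdot\rangle$ is the $L^2$ scalar product and $(\cdot,\cdot)$ the duality between $H^{-1}$ and $H^1_0$. Let $a(u,v)=\int_\Omega \nabla u\cdot B(x)\nabla v+b(x)\,uv\,dx$ be a continuous, coercive and symmetric bilinear form on $H^1_0\times H^1_0$; $A:H^1_0\to H^{-1}$ is defined by $(Au,v)=-a(u,v)$, and $\mathcal E(u)=\tfrac12a(u,u)$. For $w\in L^2$ set $|w|_{L^2_+}=\|w\|_{L^2}$ if $w\ge0$ a.e. and $|w|_{L^2_+}=+\infty$ otherwise. For a (locally finite, signed) Radon measure $\mu$ on $\Omega$, $[\mu]_+$ is its positive part in the Hahn decomposition; $\|[\mu]_+\|_{L^2}=+\infty$ if $[\mu]_+$ is not in $L^2$. Definition. An evolution $u\in L^\infty(0,T;H^1_0)\cap H^1(0,T;L^2)$ is a unilateral gradient flow for the energy $\mathcal F$ if $Au(t)+f(t)$ is a (locally finite) Radon measure for a.e. $t\in(0,T)$ and if for every $0\le t^*\le T$ $$\mathcal E(u(t^* ))\le\mathcal E(u(0))-\tfrac12\int_0^{t^*}|\dot u(t)|_{L^2_+}^2+\|[Au(t)+f(t)]_+\|_{L^2}^2\,dt+\int_0^{t^*}\langle f(t),\dot u(t)\rangle\,dt .$$ For every $u_0\in H^1_0$ there is exactly one unilateral gradient flow with $u(0)=u_0$. *)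

(* Defs.v *)
From HB Require Import structures.
From mathcomp Require Import all_boot all_order all_algebra.
From mathcomp Require Import all_classical all_reals all_analysis.

Set Implicit Arguments.
Unset Strict Implicit.
Unset Printing Implicit Defensive.
Import Order.TTheory GRing.Theory Num.Theory.
Import numFieldNormedType.Exports.

Local Open Scope classical_set_scope.
Local Open Scope ring_scope.

Section borel_rV.
Context {R : realType} {d : nat}.

Let borel0 : <<s @open 'rV[R]_d >> set0.
Proof. exact: sigma_algebra0. Qed.

Let borelC A : <<s @open 'rV[R]_d >> A -> <<s @open 'rV[R]_d >> (~` A).
Proof. exact: sigma_algebraC. Qed.

Let borel_bigcup (F : (set 'rV[R]_d)^nat) :
  (forall i, <<s @open 'rV[R]_d >> (F i)) ->
  <<s @open 'rV[R]_d >> (\bigcup_i F i).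
Proof. exact: sigma_algebra_bigcup. Qed.

HB.instance Definition _ := @isMeasurable.Build (sigma_display (@open 'rV[R]_d))
  'rV[R]_d <<s @open 'rV[R]_d >> borel0 borelC borel_bigcup.

End borel_rV.

Section lebesgue_rV.
Context {R : realType}.

Definition row_cons (d : nat) (p : measurableTypeR R * 'rV[R]_d) : 'rV[R]_d.+1 :=
  row_mx (p.1 : R)%:M p.2.

Lemma row_cons_ball d (x y : R) (v w : 'rV[R]_d) (e : R) : 0 < e ->
  ball x e y -> ball v e w -> ball (row_cons (x, v)) e (row_cons (y, w)).
Proof.
move=> e0 xy [_ vw]; split => // i j; rewrite /row_cons !mxE/=.
case: split_ordP => k _; first by rewrite !ord1 !mxE eqxx !mulr1n.
by rewrite (ord1 i); exact: vw.
Qed.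

Lemma measurable_row_cons d : measurable_fun [set: _] (@row_cons d).
Proof.
apply: (@measurability _ _ _ _ _ _ (@open 'rV[R]_d.+1)) => // _ [U oU <-].
rewrite setTI.
pose W (q : rat * rat) := [set v : 'rV[R]_d | forall y : R,
  y \in `](ratr q.1), (ratr q.2)[ -> U (row_cons (y, v))]^°.
pose F (q : rat * rat) : set (measurableTypeR R * 'rV[R]_d) :=
  [set` `](ratr q.1), (ratr q.2)[] `*` W q.
rewrite (_ : _ @^-1` _ = \bigcup_q F q).
  apply: countable_bigcupT_measurable => [|q].
    exact: countableP.
  apply: measurableX => //.
  by apply: sub_sigma_algebra; exact: open_interior.
apply/seteqP; split => [[x v] /= Ux|[x v] [q _ [/= xq /interior_subset]]]; last exact.
have /nbhs_ballP[e /= e0 eU] : nbhs (row_cons (x, v)) U by exact: open_nbhs_nbhs.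
have [|q1] := @rat_in_itvoo _ (x - e) x; first by rewrite ltrBlDr ltrDl.
rewrite in_itv/= => /andP[q1l q1r].
have [|q2] := @rat_in_itvoo _ x (x + e); first by rewrite ltrDl.
rewrite in_itv/= => /andP[q2l q2r].
exists (q1, q2) => //; split => /=; first by rewrite in_itv/= q1r q2l.
apply/nbhs_ballP; exists e => //= w vw y; rewrite in_itv/= => /andP[y1 y2].
apply: eU; apply: row_cons_ball => //.
rewrite /ball/= ltr_distlC; apply/andP; split.
  exact: lt_trans y1.
exact: lt_trans q2r.
Qed.

HB.instance Definition _ d :=
  isMeasurableFun.Build _ _ _ _ (@row_cons d) (@measurable_row_cons d).

Section step.
Context (d : nat) (m : {sigma_finite_measure set 'rV[R]_d -> \bar R}).

Definition lebesgue_step : set 'rV[R]_d.+1 -> \bar R :=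
  pushforward (lebesgue_measure \x m)%E (@row_cons d).

Let lebesgue_step0 : lebesgue_step set0 = 0%E.
Proof. exact: measure0. Qed.

Let lebesgue_step_ge0 A : (0 <= lebesgue_step A)%E.
Proof. exact: measure_ge0. Qed.

Let lebesgue_step_sigma_additive : semi_sigma_additive lebesgue_step.
Proof. exact: measure_semi_sigma_additive. Qed.

HB.instance Definition _ := isMeasure.Build _ _ _ lebesgue_step
  lebesgue_step0 lebesgue_step_ge0 lebesgue_step_sigma_additive.

Let sigma_finite_step : sigma_finite setT lebesgue_step.
Proof.
have /sigma_finiteP[F [TF ndF mF]] := sigma_finiteT
  (lebesgue_measure : {sigma_finite_measure set (measurableTypeR R) -> \bar R}).
have /sigma_finiteP[G [TG ndG mG]] := sigma_finiteT m.
pose hd (v : 'rV[R]_d.+1) : measurableTypeR R := v 0 0.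
pose tl (v : 'rV[R]_d.+1) : 'rV[R]_d := \row_i v 0 (rshift 1 i).
have ctl : continuous tl.
  move=> v A /nbhs_ballP[e /= e0 eA]; apply/nbhs_ballP; exists e => //= w [_ vw].
  by apply: eA; split => // i j; rewrite !mxE; exact: vw.
have mtl : measurable_fun [set: _] tl.
  apply: (@measurability _ _ _ _ _ _ (@open 'rV[R]_d)) => // _ [U oU <-].
  by rewrite setTI; apply: sub_sigma_algebra; move/continuousP : ctl; exact.
have mhd : measurable_fun [set: _] hd.
  apply: (@measurability _ _ _ _ _ _ _ (measurable_realfun.RGenOInfty.measurableE R)) => // _ [_ [x ->] <-].
  rewrite setTI; apply: sub_sigma_algebra.
  have /continuousP : continuous (fun v : 'rV[R]_d.+1 => v 0 0 : R).
    exact: coord_continuous.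
  apply; rewrite set_itvE; exact: open_gt.
have Kr p : (hd (row_cons p), tl (row_cons p)) = p.
  case: p => x v; congr pair.
    rewrite /hd /row_cons !mxE/=; case: split_ordP => k; first by rewrite !ord1 !mxE eqxx mulr1n.
    by move=> /(congr1 val).
  apply/rowP => k; rewrite /row_cons !mxE/=.
  case: split_ordP => l; last by move=> /rshift_inj ->.
  by move=> /(congr1 val) /= kl; have := ltn_ord l; rewrite -kl.
exists (fun k => hd @^-1` F k `&` tl @^-1` G k).
  apply/esym; rewrite -subTset => v _.
  have [k _ Fk] : (\bigcup_i F i) (hd v) by rewrite -TF.
  have [l _ Gl] : (\bigcup_i G i) (tl v) by rewrite -TG.
  exists (maxn k l) => //; split => /=.
    by move: Fk; apply/subsetPset/ndF; exact: leq_maxl.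
  by move: Gl; apply/subsetPset/ndG; exact: leq_maxr.
move=> k; have [mFk Fk] := mF k; have [mGk Gk] := mG k; split.
  by apply: measurableI; rewrite -[X in measurable X]setTI; [exact: mhd|exact: mtl].
rewrite /lebesgue_step /pushforward (_ : _ @^-1` _ = F k `*` G k).
  by rewrite product_measure1E// lte_mul_pinfty// ge0_fin_numE.
apply/seteqP; split => [[x v]|[x v]] /=; have [-> ->] := Kr (x, v); by [].
Qed.

HB.instance Definition _ :=
  Measure_isSigmaFinite.Build _ _ _ lebesgue_step sigma_finite_step.

End step.

(* Lebesgue measure on R^d, as an iterated product *)
Fixpoint lebesgue_rV (d : nat) : {sigma_finite_measure set 'rV[R]_d -> \bar R} :=
  match d with
  | 0 => \d_(0 : 'rV[R]_0)
  | d'.+1 => lebesgue_step (lebesgue_rV d')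
  end.

End lebesgue_rV.
Arguments lebesgue_rV {R} d.

Definition dotp {R : realType} {d : nat} (Om : set 'rV[R]_d) (u v : 'rV[R]_d -> R) : R :=
  \int[lebesgue_rV d]_(x in Om) (u x * v x).

(* Functions on Om are functions on R^d whose values outside Om are irrelevant; *)
(* elements of L^2(Om) and H^1_0(Om) are represented by Borel functions.        *)
Definition L2 {R : realType} {d : nat} (Om : set 'rV[R]_d) : set ('rV[R]_d -> R) :=
  [set u | u \_ Om \in Lfun (lebesgue_rV d) 2%:E].

Definition L2norm {R : realType} {d : nat} (Om : set 'rV[R]_d) (u : 'rV[R]_d -> R) : R :=
  fine 'N[lebesgue_rV d]_2%:E[EFin \o u \_ Om].

Definition nonneg_on {R : realType} {d : nat} (Om : set 'rV[R]_d)
    (u : 'rV[R]_d -> R) : Prop :=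
  {ae lebesgue_rV d, forall x, Om x -> 0 <= u x}.

(* |u|_{L^2_+} *)
Definition L2plus_norm {R : realType} {d : nat} (Om : set 'rV[R]_d)
    (u : 'rV[R]_d -> R) : \bar R :=
  if `[< nonneg_on Om u >] then (L2norm Om u)%:E else +oo%E.

(* C^oo as the continuity of the iterated directional derivatives of all orders, *)
(* in finite dimension.                                                          *)
Definition iter_derive {R : realType} {V : normedModType R} (s : seq V) (f : V -> R) : V -> R :=
  foldr (fun v (g : V -> R) => fun x => 'D_v g x) f s.

Definition smooth {R : realType} {V : normedModType R} (f : V -> R) : Prop :=
  forall s : seq V, continuous (iter_derive s f) /\
    forall x v, derivable (iter_derive s f) x v.

Definition test_function {R : realType} {V : normedModType R} (Om : set V) : set (V -> R) :=
  [set phi | smooth phi /\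
    exists K : set V, [/\ compact K, K `<=` Om & forall x, ~ K x -> phi x = 0]].

Section sobolev.
Context {R : realType} {d : nat} (Om : set 'rV[R]_d).
Implicit Types u v g phi : 'rV[R]_d -> R.

Definition is_weak_partial (i : 'I_d) u g : Prop :=
  forall phi, test_function Om phi ->
    \int[lebesgue_rV d]_(x in Om) (u x * 'D_(delta_mx 0 i) phi x) =
    - \int[lebesgue_rV d]_(x in Om) (g x * phi x).

Definition H1 : set ('rV[R]_d -> R) :=
  [set u | L2 Om u /\ forall i, exists g, L2 Om g /\ is_weak_partial i u g].

(* Well defined up to null sets on H1; the value elsewhere is irrelevant. *)
Definition weak_partial (i : 'I_d) u : 'rV[R]_d -> R :=
  xget (fun=> 0) [set g | L2 Om g /\ is_weak_partial i u g].

Definition H1norm u : R :=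
  Num.sqrt (L2norm Om u ^+ 2 + \sum_(i < d) L2norm Om (weak_partial i u) ^+ 2).

(* The closure of C_c^oo(Om) in H^1(Om) *)
Definition H10 : set ('rV[R]_d -> R) :=
  [set u | H1 u /\ forall e : R, 0 < e ->
    exists phi, test_function Om phi /\ H1norm (u - phi) < e].

End sobolev.

Section bilinear_form.
Context {R : realType} {d : nat} (Om : set 'rV[R]_d).
Variables (B : 'rV[R]_d -> 'M[R]_d) (b : 'rV[R]_d -> R).
Implicit Types u v phi : 'rV[R]_d -> R.

Definition form_integrand u v (x : 'rV[R]_d) : R :=
  \sum_(i < d) \sum_(j < d)
    weak_partial Om i u x * (B x i j * weak_partial Om j v x) +
  b x * (u x * v x).

Definition form u v : R := \int[lebesgue_rV d]_(x in Om) form_integrand u v x.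

(* The first clause says that the form is well defined; bilinearity follows from *)
(* it. No regularity of B and b beyond this is required.                         *)
Definition continuous_coercive_symmetric : Prop :=
  [/\ forall u v, H10 Om u -> H10 Om v ->
        (lebesgue_rV d).-integrable Om (EFin \o form_integrand u v),
      exists C : R, forall u v, H10 Om u -> H10 Om v ->
        `|form u v| <= C * H1norm Om u * H1norm Om v,
      exists2 c : R, 0 < c & forall u, H10 Om u -> c * H1norm Om u ^+ 2 <= form u u &
      forall u v, H10 Om u -> H10 Om v -> form u v = form v u].

Definition operA u phi : R := - form u phi.

(* The energy is extended by +oo outside H^1_0(Om). *)
Definition energy u : \bar R :=
  if `[< H10 Om u >] then (2^-1 * form u u)%:E else +oo%E.

End bilinear_form.

(* A locally finite signed Radon measure on Om, given by its Hahn decomposition: *)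
(* two Borel measures, finite on the compact subsets of Om, the first one        *)
(* carried by [rhahn] and the second one by its complement. Only the values on   *)
(* Borel subsets of Om matter.                                                   *)
Record signed_radon (R : realType) (d : nat) (Om : set 'rV[R]_d) := SignedRadon {
  rpos : {measure set 'rV[R]_d -> \bar R} ;
  rneg : {measure set 'rV[R]_d -> \bar R} ;
  rhahn : set 'rV[R]_d ;
  rpos_locfin : forall K, compact K -> K `<=` Om -> (rpos K < +oo)%E ;
  rneg_locfin : forall K, compact K -> K `<=` Om -> (rneg K < +oo)%E ;
  rhahn_measurable : measurable rhahn ;
  rpos_hahn : rpos (Om `\` rhahn) = 0%E ;
  rneg_hahn : rneg (Om `&` rhahn) = 0%E }.

Section radon.
Context {R : realType} {d : nat} (Om : set 'rV[R]_d).
Implicit Types (l : ('rV[R]_d -> R) -> R) (mu : signed_radon Om) (w : 'rV[R]_d -> R).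

(* The functional l, seen as a distribution on Om, is the measure mu. *)
Definition represents mu l : Prop :=
  forall phi, test_function Om phi ->
    l phi = \int[rpos mu]_(x in Om) phi x - \int[rneg mu]_(x in Om) phi x.

Definition is_radon l : Prop := exists mu, represents mu l.

(* [l]_+ = w in L^2(Om) *)
Definition pos_part_eq l w : Prop :=
  L2 Om w /\ exists mu, represents mu l /\
    forall E, measurable E -> E `<=` Om ->
      rpos mu E = (\int[lebesgue_rV d]_(x in E) (w x)%:E)%E.

(* The set below has at most one element; its infimum is +oo when it is empty, *)
(* that is, when [l]_+ is not in L^2(Om).                                      *)
Definition pos_part_norm l : \bar R :=
  ereal_inf [set (L2norm Om w)%:E | w in pos_part_eq l].

End radon.

Section bochner.
Context {R : realType} {V : lmodType R}.
Variables (S : set V) (N : V -> R) (I : set R).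
Implicit Types (s : seq (set R * V)) (u v : R -> V).

(* The simple function \sum_k 1_{E_k} v_k is encoded by the list of the (E_k, v_k). *)
Definition simple s : Prop := forall p, p \in s -> measurable p.1 /\ S p.2.

Definition simple_fun s (t : R) : V := \sum_(p <- s) (\1_(p.1) t : R) *: p.2.

Definition simple_integral s : V :=
  \sum_(p <- s) fine (lebesgue_measure (p.1 `&` I)) *: p.2.

Definition strongly_measurable u : Prop :=
  {ae lebesgue_measure, forall t, I t -> S (u t)} /\
  exists s : nat -> seq (set R * V), (forall n, simple (s n)) /\
    {ae lebesgue_measure, forall t, I t ->
      N (simple_fun (s n) t - u t) @[n --> \oo] --> (0 : R)}.

Definition is_bochner_integral u (w : V) : Prop :=
  [/\ strongly_measurable u, S w &
    exists s : nat -> seq (set R * V), [/\ forall n, simple (s n),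
      (\int[lebesgue_measure]_(t in I) (N (simple_fun (s n) t - u t))%:E)%E
        @[n --> \oo] --> 0%E &
      N (simple_integral (s n) - w) @[n --> \oo] --> (0 : R)]].

Definition bochner_Lp (p : \bar R) u : Prop :=
  strongly_measurable u /\
  ('N[lebesgue_measure]_p[EFin \o (fun t => N (u t)) \_ I] < +oo)%E.

(* \int_I psi' u dt = - \int_I psi v dt in V for every psi in C_c^oo(I) *)
Definition is_weak_time_derivative u v : Prop :=
  forall psi : R -> R, test_function I psi ->
    exists w, is_bochner_integral (fun t => 'D_1 psi t *: u t) w /\
              is_bochner_integral (fun t => psi t *: v t) (- w).

End bochner.

Section evolution.
Context {R : realType} {d : nat} (Om : set 'rV[R]_d) (T : R).
Variables (B : 'rV[R]_d -> 'M[R]_d) (b : 'rV[R]_d -> R).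
Implicit Types (f u du : R -> 'rV[R]_d -> R) (phi z : 'rV[R]_d -> R).

Definition L2_0T_L2 u : Prop := bochner_Lp (L2 Om) (L2norm Om) `]0, T[ 2%:E u.

(* u is in L^oo(0,T;H^1_0) and H^1(0,T;L^2), with time derivative du. As usual, u *)
(* is the representative that is continuous from [0,T] to L^2, so that u(t) makes *)
(* sense for every t in [0,T].                                                   *)
Definition evolution u du : Prop :=
  [/\ bochner_Lp (H10 Om) (H1norm Om) `]0, T[ +oo%E u,
      L2_0T_L2 u, L2_0T_L2 du,
      is_weak_time_derivative (L2 Om) (L2norm Om) `]0, T[ u du &
      forall t, t \in `[0, T] -> L2 Om (u t) /\
        L2norm Om (u s - u t) @[s --> within `[0, T] (nbhs t)] --> (0 : R)].

(* A u(t) + f(t), as a functional on H^1_0(Om) *)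
Definition Auf f u (t : R) : ('rV[R]_d -> R) -> R :=
  fun phi => operA Om B b (u t) phi + dotp Om (f t) phi.

Definition unilateral_gradient_flow f u du : Prop :=
  [/\ evolution u du,
      {ae lebesgue_measure, forall t, t \in `]0, T[ -> is_radon Om (Auf f u t)} &
      forall s, 0 <= s <= T ->
        (energy Om B b (u s) <=
         energy Om B b (u 0%R)
         - (2^-1)%:E * \int[lebesgue_measure]_(t in `]0%R, s[)
             (L2plus_norm Om (du t) ^+ 2 + pos_part_norm Om (Auf f u t) ^+ 2)
         + (\int[lebesgue_measure]_(t in `]0%R, s[) dotp Om (f t) (du t))%R%:E)%E].

Definition solves_parabolic f (u0 : 'rV[R]_d -> R) u du : Prop :=
  {ae lebesgue_measure, forall t, t \in `]0, T[ ->
     is_radon Om (Auf f u t) /\ pos_part_eq Om (Auf f u t) (du t)} /\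
  ae_eq (lebesgue_rV d) Om (u 0) u0.

Definition var_ineq f u du (t : R) : Prop :=
  forall phi, H10 Om phi -> nonneg_on Om phi ->
    operA Om B b (u t) phi + dotp Om (f t) phi <= dotp Om (du t) phi.

Definition cone_above (v : 'rV[R]_d -> R) : set ('rV[R]_d -> R) :=
  [set z | H10 Om z /\ nonneg_on Om (z - v)].

Definition var_ineq_obstacle f u du (t : R) : Prop :=
  forall z, cone_above (u t) z ->
    dotp Om (du t) (u t - z) + form Om B b (u t) (u t - z)
    <= dotp Om (f t) (u t - z).

End evolution.

(* Main.v *)
(** Let P(t) be the dissipation |u'(t)|^2_{L^2_+} + ||[Au(t)+f(t)]_+||^2. Duality gives, for
    0 <= g in H^1_0,
      2 (Au + f, g) - ||g||^2 <= ||[Au + f]_+||^2.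
    Take g = lam (u(t+h) - u(t)) / h + eps 1_E(t) psi with lam, eps >= 0 and a test function
    psi >= 0; it is nonnegative because u' >= 0. By convexity of the energy,
    (Au(t), u(t+h) - u(t)) >= E(u(t)) - E(u(t+h)), whose integral over (0, T-h) telescopes: it is
    controlled near t = 0 by the lower semicontinuity of E and near t = T by the energy
    inequality, so no chain rule for E(u(t)) is needed. With G = \int P and D = \int ||u'||^2,
    letting h tend to 0 yields
      D + lam G - lam^2 D
        + 2 eps \int_E ((Au + f, psi) - lam <u', psi>) dt - eps^2 |E| ||psi||^2 <= G.
    For lam = 1 and eps -> 0 this is (Au + f, psi) <= <u', psi>, so that [Au + f]_+ has by
    Radon-Nikodym a density w with 0 <= w <= u'. For eps = 0 and lam -> 1 it is 2 D <= G, whereas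
    P = ||u'||^2 + ||w||^2 <= 2 ||u'||^2; hence ||w|| = ||u'|| and w = u' a.e. *)
From HB Require Import structures.
Require Import Defs.
From mathcomp Require Import all_boot all_order all_algebra.
From mathcomp Require Import all_classical all_reals all_analysis.
From mathcomp Require Import measurable_realfun ring lra.
Import Order.TTheory GRing.Theory Num.Theory.
Import numFieldNormedType.Exports.
Local Open Scope classical_set_scope.
Local Open Scope ring_scope.
Set Implicit Arguments.
Unset Strict Implicit.
Unset Printing Implicit Defensive.

(** * Smooth functions *)

(** The competitor g is built from difference quotients because u'(t) is only in L^2, while duality
    needs g in H^1_0. Passing to the limit is delicate only in \int <f, q_h>, where q_h = (u(t+h) -
    u(t)) / h: since \int ||q_h||^2 <= D, Fatou's lemma for ||q_h + f||^2 bounds this integral from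
    below, and no stronger convergence is used. At lam = 1, eps = 0 the final inequality reads D + G
    - D <= G and says nothing. Hence the first-order condition comes from perturbing in eps at this
    point, and 2 D <= G from dividing (1 - lam^2) D <= (1 - lam) G by 1 - lam. Two quantifiers need
    care. The exceptional set of times depends on psi; a countable family of almost worst test
    functions removes this dependence. And psi has to range over all nonnegative elements of H^1_0,
    not only over test functions; a projection argument turns L^2-approximation with bounded H^1
    norm into H^1-approximation, and the same argument gives the lower semicontinuity of E. *)

Section smooth_calculus.
Context {R : realType} {V : normedModType R}.
Implicit Types f g : V -> R.

(** A coinduction principle: smoothness follows from membership in some class of continuous,
    derivable functions that is stable under directional derivatives. The basic smoothness proofs
    below consist in choosing such a class. *)
Lemma smooth_coind (C : set (V -> R)) :
  (forall f, C f -> [/\ continuous f, forall x v, derivable f x v &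
    forall v, C (fun x => 'D_v f x)]) ->
  forall f, C f -> smooth f.
Proof.
move=> HC f Cf s.
suff /HC[cf df _] : C (iter_derive s f) by split.
by elim: s => //= v s /HC[_ _]; exact.
Qed.

Lemma smooth_continuous f : smooth f -> continuous f.
Proof. by move=> /(_ [::])[]. Qed.

Lemma smooth_derivable f x v : smooth f -> derivable f x v.
Proof. by move=> /(_ [::])[_]; exact. Qed.

Lemma smooth_derive f v : smooth f -> smooth (fun x => 'D_v f x).
Proof. by move=> sf s; have := sf (rcons s v); rewrite /iter_derive foldr_rcons. Qed.

Lemma smooth_cst (c : R) : smooth (fun _ : V => c).
Proof.
apply: (@smooth_coind [set f | exists c, f = fun=> c]); last by exists c.
move=> _ [{}c ->]; split; [exact: cst_continuous|by move=> x v; exact: derivable_cst|].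
by move=> v; exists 0; apply/funext => x; exact: derive_cst.
Qed.

(** On the line through x in the direction v, the derivative along v is an ordinary derivative in h,
    so the one-variable chain rule applies. *)
Lemma is_derive_comp_dir (G : R -> R) f x v a b :
  is_derive (f x) 1 G a -> is_derive x v f b -> is_derive x v (G \o f) (a * b).
Proof.
move=> dG df.
pose k := fun h : R => f (h *: v + x).
have k0 : k 0 = f x by rewrite /k scale0r add0r.
have dk : is_derive (0 : R) 1 k b.
  have [dfx <-] := df; apply: DeriveDef; first exact: (iffLR (derivable1P _ _ _) dfx).
  rewrite /derive; apply: (congr1 (fun F : R -> R => lim (F @ 0^'))); apply/funext => h /=.
  by rewrite /k scale0r add0r addr0 [_ *: 1]mulr1.
have := @is_derive1_comp _ G k 0 a b; rewrite k0 => /(_ dG dk) dGk.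
have [d1 d2] := dGk; apply: DeriveDef; first exact: (iffRL (derivable1P _ _ _) d1).
rewrite -d2 /derive; apply: (congr1 (fun F : R -> R => lim (F @ 0^'))); apply/funext => h /=.
by rewrite /k scale0r add0r addr0 [_ *: 1]mulr1.
Qed.

(** Differentiating a product, a composite or an inverse produces expressions that mix all the
    operations, so an invariant class for [smooth_coind] has to be closed under all of them at
    once. *)
Inductive smooth_alg : set (V -> R) :=
| SmoothBase f : smooth f -> smooth_alg f
| SmoothAdd f g : smooth_alg f -> smooth_alg g -> smooth_alg (fun x => f x + g x)
| SmoothMul f g : smooth_alg f -> smooth_alg g -> smooth_alg (fun x => f x * g x)
| SmoothComp (G : R -> R) f : smooth G -> smooth_alg f -> smooth_alg (fun x => G (f x))
| SmoothInv f : smooth_alg f -> (forall x, f x != 0) -> smooth_alg (fun x => (f x)^-1).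
End smooth_calculus.

Lemma smooth_algP {R : realType} {V : normedModType R} (f : V -> R) :
  smooth_alg f -> smooth f.
Proof.
move: f; apply: smooth_coind => f; elim => {f}.
- move=> f sf; split; [exact: smooth_continuous|by move=> *; exact: smooth_derivable|].
  by move=> v; apply: SmoothBase; exact: smooth_derive.
- move=> f g _ [cf df Df] _ [cg dg Dg]; split.
  + by move=> x; apply: continuousD; [exact: cf|exact: cg].
  + by move=> x v; apply: derivableD.
  + move=> v; rewrite [X in smooth_alg X](_ : _ = fun x => 'D_v f x + 'D_v g x).
      exact: SmoothAdd.
    by apply/funext => x; rewrite -deriveD.
- move=> f g af [cf df Df] ag [cg dg Dg]; split.
  + by move=> x; apply: continuousM; [exact: cf|exact: cg].
  + by move=> x v; apply: derivableM.
  + move=> v; rewrite [X in smooth_alg X](_ : _ = fun x => f x * 'D_v g x + g x * 'D_v f x).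
      by apply: SmoothAdd; apply: SmoothMul.
    by apply/funext => x; rewrite -deriveM.
- move=> G f sG af [cf df Df].
  have dGf x v : is_derive x v (G \o f) ('D_1 G (f x) * 'D_v f x).
    apply: is_derive_comp_dir; apply: derivableP; last exact: df.
    exact: smooth_derivable.
  split.
  + by move=> x; apply: continuous_comp; [exact: cf|exact: smooth_continuous].
  + by move=> x v; have [] := dGf x v.
  + move=> v; rewrite [X in smooth_alg X](_ : _ = fun x => 'D_1 G (f x) * 'D_v f x).
      apply: SmoothMul; last exact: Df.
      by apply: (SmoothComp (G := fun x => 'D_1 G x)) af; exact: smooth_derive.
    by apply/funext => x; have [_ <-] := dGf x v.
- move=> f af [cf df Df] f0.
  have dVf x v : is_derive x v (fun y => (f y)^-1) (- (f x)^-1 * (f x)^-1 * 'D_v f x).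
    apply: (@is_derive_comp_dir _ _ (fun y => y^-1) f).
      have := @is_deriveV R (fun y => y) (f x) 1 1 (f0 x) (is_derive_id _ _).
      by rewrite [_ *: 1]mulr1 mulNr -expr2 exprVn.
    exact: derivableP.
  split.
  + by move=> x; apply: cvgV; [exact: f0|exact: cf].
  + by move=> x v; have [] := dVf x v.
  + move=> v; rewrite [X in smooth_alg X](_ : _ =
      fun x => -1 * (f x)^-1 * (f x)^-1 * 'D_v f x).
      apply: SmoothMul => //; apply: SmoothMul; last exact: SmoothInv.
      by apply: SmoothMul; [apply: SmoothBase; exact: smooth_cst|exact: SmoothInv].
    by apply/funext => x; have [_ ->] := dVf x v; rewrite mulN1r.
Qed.

Section smooth_ops.
Context {R : realType} {V : normedModType R}.
Implicit Types f g : V -> R.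

Lemma smoothD f g : smooth f -> smooth g -> smooth (f + g).
Proof. by move=> sf sg; apply: smooth_algP; apply: SmoothAdd; exact: SmoothBase. Qed.

Lemma smoothM f g : smooth f -> smooth g -> smooth (f * g).
Proof. by move=> sf sg; apply: smooth_algP; apply: SmoothMul; exact: SmoothBase. Qed.

Lemma smooth_comp (G : R -> R) f : smooth G -> smooth f -> smooth (G \o f).
Proof. by move=> sG sf; apply: smooth_algP; apply: SmoothComp => //; exact: SmoothBase. Qed.

Lemma smoothZ (c : R) f : smooth f -> smooth (c *: f).
Proof. by move=> sf; apply: (@smoothM (fun=> c) f _ sf); exact: smooth_cst. Qed.

Lemma smoothN f : smooth f -> smooth (- f).
Proof. by rewrite -scaleN1r; exact: smoothZ. Qed.

Lemma smoothB f g : smooth f -> smooth g -> smooth (f - g).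
Proof. by move=> sf sg; apply: (smoothD sf); exact: smoothN. Qed.

Lemma smooth_prod (I : Type) (r : seq I) (F : I -> V -> R) :
  (forall i, smooth (F i)) -> smooth (fun x => \prod_(i <- r) F i x).
Proof.
move=> sF; elim: r => [|i r IH].
  under eq_fun do rewrite big_nil; exact: smooth_cst.
under eq_fun do rewrite big_cons; exact: (smoothM (sF i) IH).
Qed.

Lemma derive_comp_smooth (G : R -> R) f x v : smooth G -> smooth f ->
  'D_v (G \o f) x = 'D_1 G (f x) * 'D_v f x.
Proof.
move=> sG sf; have [] := @is_derive_comp_dir _ _ G f x v ('D_1 G (f x)) ('D_v f x) => //;
  apply: derivableP; exact: smooth_derivable.
Qed.

End smooth_ops.

Lemma smooth_affine {R : realType} (a c : R) : smooth (fun x : R => a * x + c).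
Proof.
apply: smooth_algP; apply: SmoothAdd; last by apply: SmoothBase; exact: smooth_cst.
apply: SmoothMul; apply: SmoothBase; first exact: smooth_cst.
apply: (@smooth_coind _ _ [set f : R -> R | f = id \/ exists c, f = fun=> c]); last by left.
move=> _ [->|[{}c ->]]; split.
- by move=> x; exact: cvg_id.
- by move=> x v; exact: derivable_id.
- by move=> v; right; exists v; apply/funext => x; exact: derive_id.
- exact: cst_continuous.
- by move=> x v; exact: derivable_cst.
- by move=> v; right; exists 0; apply/funext => x; exact: derive_cst.
Qed.

Lemma is_derive_coord {R : realType} d (i : 'I_d) (x v : 'rV[R]_d) :
  is_derive x v (fun y : 'rV[R]_d => y 0 i) (v 0 i).
Proof.
have H : h^-1 *: (((fun y : 'rV[R]_d => y 0 i) \o shift x) (h *: v) - x 0 i)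
    @[h --> 0^'] --> v 0 i.
  apply: cvg_near_cst; near=> h; rewrite /= !mxE addrK [_ *: _]mulrA mulVf ?mul1r//.
  by near: h; exact: nbhs_dnbhs_neq.
by apply: DeriveDef; [exact: cvgP H|exact: cvg_lim H].
Unshelve. all: by end_near. Qed.

Lemma smooth_coord {R : realType} d (i : 'I_d) : smooth (fun y : 'rV[R]_d => y 0 i).
Proof.
apply: (@smooth_coind _ _ [set f | f = (fun y : 'rV[R]_d => y 0 i) \/ exists c, f = fun=> c]);
  last by left.
move=> _ [->|[c ->]]; split.
- exact: coord_continuous.
- by move=> x v; have [] := is_derive_coord i x v.
- by move=> v; right; exists (v 0 i); apply/funext => x; have [_ ->] := is_derive_coord i x v.
- exact: cst_continuous.
- by move=> x v; exact: derivable_cst.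
- by move=> v; right; exists 0; apply/funext => x; exact: derive_cst.
Qed.


Lemma monomial_expR_bound {R : realType} (n : nat) (y : R) :
  0 <= y -> y ^+ n <= n`!%:R * expR y.
Proof.
case: n => [|n] y0; first by rewrite expr0 fact0 mul1r -expR0 ler_expR.
have := expR_ge1Dxn n y0 => H.
have f0 : 0 < (n.+1)`!%:R :> R by rewrite ltr0n fact_gt0.
rewrite mulrC -ler_pdivrMr//; apply: le_trans H; rewrite lerDr //.
Qed.

(** With y = 1/x this bounds p(1/x) exp(-1/x) by C x^2, which gives the derivative 0 at the
    origin. *)
Lemma poly_expR_bound {R : realType} (p : {poly R}) :
  exists2 C : R, 0 <= C & forall y : R, 0 <= y -> `|p.[y]| * y ^+ 2 <= C * expR y.
Proof.
exists (\sum_(i < size p) `|p`_i| * (i + 2)`!%:R).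
  by apply: sumr_ge0 => i _; rewrite mulr_ge0.
move=> y y0; rewrite horner_coef; apply: (@le_trans _ _ (\sum_(i < size p) `|p`_i| * y ^+ (i + 2))).
  rewrite (le_trans (ler_wpM2r _ (ler_norm_sum _ _ _)))// ?exprn_ge0// mulr_suml.
  by apply: ler_sum => i _; rewrite normrM exprD -mulrA (ger0_norm (exprn_ge0 i y0)).
rewrite mulr_suml; apply: ler_sum => i _; rewrite -mulrA ler_wpM2l//.
exact: monomial_expR_bound.
Qed.

(** * Flat exponentials, a smooth positive part and a smooth step *)

Section flat_exp.
Context {R : realType}.

(** For x > 0 the derivative of p(1/x) exp(-1/x) is q(1/x) exp(-1/x) with q = X^2 (p - p'), so these
    functions form an invariant class for [smooth_coind]; p = 1 is the classical flat function. *)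
Definition flat_poly (p : {poly R}) (x : R) : R :=
  if 0 < x then p.[x^-1] * expR (- x^-1) else 0.

Definition flat_exp : R -> R := flat_poly 1.

Lemma flat_poly_le (p : {poly R}) : exists2 C : R, 0 <= C &
  forall x, `|flat_poly p x| <= C * x ^+ 2.
Proof.
have [C C0 HC] := poly_expR_bound p; exists C => // x; rewrite /flat_poly.
case: ifPn => x0; last by rewrite normr0 mulr_ge0// sqr_ge0.
have xi : 0 <= x^-1 by rewrite invr_ge0 ltW.
have := HC _ xi; rewrite normrM (ger0_norm (expR_ge0 _)) expRN.
rewrite exprVn -ler_pdivlMr ?invr_gt0 ?exprn_gt0// invrK => H.
by rewrite ler_pdivrMr ?expR_gt0// mulrAC.
Qed.

Let dpoly (p : {poly R}) : {poly R} := 'X^2 * (p - p^`()).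

Lemma is_derive_flat_poly (p : {poly R}) (x : R) :
  is_derive x 1 (flat_poly p) (flat_poly (dpoly p) x).
Proof.
have [x0|x0|->] := ltgtP x 0.
- have near0 : \near x, cst 0 x = flat_poly p x.
    near=> y; rewrite /flat_poly ifN// -leNgt ltW//; near: y; exact: lt_nbhsl.
  rewrite [X in is_derive _ _ _ X]/flat_poly (ltNge 0) (ltW x0) /=.
  exact: near_eq_is_derive near0 (is_derive_cst _ _ _).
- have near0 : \near x, (fun y => p.[y^-1] * expR (- y^-1)) x = flat_poly p x.
    near=> y; rewrite /flat_poly ifT//; near: y; exact: lt_nbhsr.
  have dV : is_derive x 1 (fun y : R => y^-1) (- x ^- 2).
    have := @is_deriveV R (fun y => y) x 1 1 (lt0r_neq0 x0) (is_derive_id _ _).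
    by rewrite [_ *: 1]mulr1.
  apply: near_eq_is_derive near0 _.
  have d1 := @is_derive1_comp _ (horner p) _ x _ _ (is_derive_poly p (x^-1)) dV.
  have d2 : is_derive x 1 (fun y : R => expR (- y^-1)) (expR (- x^-1) * (x ^- 2)).
    apply: (@is_derive1_comp _ expR (fun y => - y^-1)).
    rewrite -[X in is_derive _ _ _ X]opprK; exact: is_deriveN.
  apply: (@is_derive_eq _ _ _ _ _ _ _ _ (is_deriveM d1 d2)).
  rewrite /flat_poly x0 /dpoly /= /GRing.scale /= !hornerE /= -exprVn; ring.
- rewrite [X in is_derive _ _ _ X](_ : _ = 0); last by rewrite /flat_poly ltxx.
  have [C C0 HC] := flat_poly_le p.
  have H : h^-1 *: ((flat_poly p \o shift 0) (h *: 1) - flat_poly p 0) @[h --> (0 : R)^'] --> (0 : R).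
    rewrite {2}/flat_poly ltxx; apply/cvgr0Pnorm_le => e e0; near=> h.
    rewrite /= addr0 subr0 [h *: 1]mulr1 normrM normfV.
    have h0 : h != 0 by near: h; exact: nbhs_dnbhs_neq.
    rewrite ler_pdivrMl ?normr_gt0//; apply: le_trans (HC h) _.
    rewrite -real_normK ?num_real// expr2 mulrA [leRHS]mulrC ler_wpM2r//.
    have : `|h| <= e / (C + 1).
      near: h; apply: dnbhs0_le; rewrite divr_gt0// ltr_wpDl//.
    rewrite ler_pdivlMr ?ltr_wpDl// mulrDr mulr1 mulrC => /(le_trans _); apply.
    by rewrite lerDl.
  by apply: DeriveDef; [exact: cvgP H|exact: cvg_lim H].
Unshelve. all: by end_near. Qed.

Lemma smooth_flat_exp : smooth flat_exp.
Proof.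
apply: (@smooth_coind _ _ [set f | exists p, f = flat_poly p]); last by exists 1.
move=> _ [p ->]; split.
- move=> x; apply: differentiable_continuous; apply/derivable1_diffP.
  by have [] := is_derive_flat_poly p x.
- move=> x v.
  have := @is_derive_comp_dir _ _ (flat_poly p) id x v _ _ (is_derive_flat_poly p x) (is_derive_id _ _).
  by case.
- move=> v; exists (v *: dpoly p); apply/funext => x.
  have := @is_derive_comp_dir _ _ (flat_poly p) id x v _ _ (is_derive_flat_poly p x) (is_derive_id _ _).
  move=> [_ ->]; rewrite /flat_poly hornerZ; case: ifP; [lra|by rewrite mul0r].
Qed.

Lemma flat_expE x : flat_exp x = if 0 < x then expR (- x^-1) else 0.
Proof. by rewrite /flat_exp /flat_poly hornerE mul1r. Qed.

Lemma flat_exp_ge0 x : 0 <= flat_exp x.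
Proof. by rewrite flat_expE; case: ifP => // _; exact: expR_ge0. Qed.

Lemma flat_exp_le1 x : flat_exp x <= 1.
Proof.
rewrite flat_expE; case: ifP => // x0.
by rewrite -expR0 ler_expR oppr_le0 invr_ge0 ltW.
Qed.

Lemma flat_exp_eq0 x : x <= 0 -> flat_exp x = 0.
Proof. by rewrite flat_expE ltNge => ->. Qed.

Lemma flat_exp_gt0 x : 0 < x -> 0 < flat_exp x.
Proof. by rewrite flat_expE => ->; exact: expR_gt0. Qed.

Lemma derive_flat_exp x : 'D_1 flat_exp x = if 0 < x then x ^- 2 * expR (- x^-1) else 0.
Proof.
have [_ ->] := is_derive_flat_poly 1 x; rewrite /flat_poly /dpoly.
by case: ifP => // x0; rewrite -polyC1 derivC subr0 mulr1 hornerXn exprVn.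
Qed.



Lemma flat_exp_cvg x : flat_exp (n%:R * x) @[n --> \oo] --> ((0 < x)%R%:R : R).
Proof.
have [x0|x0] := ltP 0 x; last first.
  apply: cvg_near_cst; near=> n; rewrite flat_exp_eq0//.
  by rewrite mulr_ge0_le0.
apply/cvgrPdist_le => e e0; near=> n.
have n0 : (0 < n)%N by near: n; exact: nbhs_infty_gt.
rewrite flat_expE mulr_gt0 ?ltr0n//=.
have E1 : expR (- (n%:R * x)^-1) <= 1 by rewrite -expR0 ler_expR oppr_le0 invr_ge0 mulr_ge0// ltW.
rewrite ger0_norm ?subr_ge0// lerBlDr.
apply: le_trans (_ : e + (1 + - (n%:R * x)^-1) <= _); last by rewrite lerD2l expR_ge1Dx.
rewrite addrCA lerDl subr_ge0 -div1r ler_pdivrMr ?mulr_gt0 ?ltr0n// mulrCA.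
rewrite -ler_pdivrMr ?mulr_gt0// div1r.
by near: n; exact: nbhs_infty_ger.
Unshelve. all: by end_near. Qed.

(* Composition with this substitute for the positive part turns test functions into nonnegative
   ones without increasing the H^1 norm. *)
Definition smooth_pos (k : R) (s : R) : R := s * flat_exp (k * s).

Lemma smooth_smooth_pos k : smooth (smooth_pos k).
Proof.
apply: smooth_algP; apply: SmoothMul.
  by have := smooth_affine (1 : R) 0; rewrite (_ : (fun _ => _) = id);
    [exact: SmoothBase|apply/funext => x; rewrite mul1r addr0].
apply: SmoothComp; first exact: smooth_flat_exp.
by apply: SmoothBase; have := smooth_affine k 0; under eq_fun do rewrite addr0.
Qed.

Lemma smooth_pos_ge0 k s : 0 < k -> 0 <= smooth_pos k s.
Proof.
move=> k0; rewrite /smooth_pos; have [s0|s0] := leP s 0.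
  by rewrite flat_exp_eq0 ?mulr0// pmulr_rle0.
by rewrite mulr_ge0 ?flat_exp_ge0// ltW.
Qed.

Lemma smooth_pos0 k : smooth_pos k 0 = 0.
Proof. by rewrite /smooth_pos mul0r. Qed.

Lemma smooth_pos_norm k s : `|smooth_pos k s| <= `|s|.
Proof. by rewrite normrM ler_piMr// ger0_norm ?flat_exp_ge0// flat_exp_le1. Qed.

(** For s <= 0 the value 0 is closer to r than s is. For s > 0 the loss s (1 - exp(-1/(k s))) is at
    most s / (k s) = 1/k. *)
Lemma smooth_pos_approx k s r : 0 < k -> 0 <= r -> `|smooth_pos k s - r| <= `|s - r| + k^-1.
Proof.
move=> k0 r0; rewrite /smooth_pos; have [s0|s0] := leP s 0.
  rewrite flat_exp_eq0 ?pmulr_rle0// mulr0 sub0r normrN (ger0_norm r0).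
  rewrite ler0_norm ?subr_le0 ?(le_trans s0)// opprB -addrA lerDl.
  by rewrite addr_ge0 ?oppr_ge0// invr_ge0 ltW.
rewrite (_ : _ - r = (s - r) + - (s - s * flat_exp (k * s))); last by ring.
rewrite (le_trans (ler_normD _ _))// lerD2l normrN ger0_norm; last first.
  by rewrite subr_ge0 ler_piMr ?flat_exp_le1// ltW.
rewrite flat_expE mulr_gt0//= -[X in X - _]mulr1 -mulrBr.
apply: le_trans (_ : s * (k * s)^-1 <= _); last by rewrite invfM mulrCA mulfV ?mulr1// gt_eqF.
apply: ler_wpM2l; first exact: ltW.
by rewrite lerBlDr -lerBlDl expR_ge1Dx.
Qed.

(** With y = 1/(k s), the derivative at s > 0 is (1 + y) exp(-y), and 1 + y <= exp y. *)
Lemma derive_smooth_pos_norm k s : 0 < k -> `|'D_1 (smooth_pos k) s| <= 1.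
Proof.
move=> k0.
have d2 : is_derive s 1 (flat_exp \o (fun x => k * x)) ('D_1 flat_exp (k * s) * k).
  apply: is_derive_comp_dir; first exact/derivableP/smooth_derivable/smooth_flat_exp.
  have := @is_deriveZ _ _ _ (fun x : R => x) k s 1 1 (is_derive_id _ _).
  by rewrite [_ *: 1]mulr1.
have := @is_deriveM _ _ _ _ s 1 _ _ (is_derive_id s 1) d2 => -[_ E].
rewrite [X in `|X|]E /= derive_flat_exp flat_expE; have [s0|s0] := leP s 0.
  by rewrite ltNge pmulr_rle0// s0 /= mul0r scaler0 scale0r addr0 normr0.
rewrite mulr_gt0//=.
have ks0 : 0 < k * s by rewrite mulr_gt0.
rewrite (_ : _ + _ = (1 + (k * s)^-1) * expR (- (k * s)^-1)); last first.
  rewrite /GRing.scale /=; field; rewrite !gt_eqF//.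
rewrite ger0_norm; last by rewrite mulr_ge0 ?expR_ge0// addr_ge0// invr_ge0 ltW.
by rewrite expRN ler_pdivrMr ?expR_gt0// mul1r expR_ge1Dx.
Qed.

Definition smooth_step (x : R) : R := flat_exp x / (flat_exp x + flat_exp (1 - x)).

Lemma smooth_step_den (x : R) : 0 < flat_exp x + flat_exp (1 - x).
Proof.
have [x0|x0] := ltP 0 x; first by rewrite ltr_pwDl ?flat_exp_gt0 ?flat_exp_ge0.
by rewrite ltr_wpDl ?flat_exp_ge0// flat_exp_gt0// subr_gt0 (le_lt_trans x0).
Qed.

Lemma smooth_step0 x : x <= 0 -> smooth_step x = 0.
Proof. by move=> x0; rewrite /smooth_step flat_exp_eq0// mul0r. Qed.

Lemma smooth_step1 x : 1 <= x -> smooth_step x = 1.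
Proof.
move=> x1; have := smooth_step_den x; rewrite /smooth_step (@flat_exp_eq0 (1 - x)) ?subr_le0// addr0.
by move=> h; rewrite divff// gt_eqF.
Qed.

Lemma smooth_step_ge0 x : 0 <= smooth_step x.
Proof. by rewrite divr_ge0 ?flat_exp_ge0// ltW// smooth_step_den. Qed.

Lemma smooth_step_le1 x : smooth_step x <= 1.
Proof. by rewrite ler_pdivrMr ?smooth_step_den// mul1r lerDl flat_exp_ge0. Qed.

End flat_exp.

Lemma smooth_smooth_step {R : realType} : smooth (@smooth_step R).
Proof.
have sf : smooth_alg (@flat_exp R) by apply: SmoothBase; exact: smooth_flat_exp.
apply: smooth_algP; apply: SmoothMul => //; apply: SmoothInv; last first.
  by move=> x; rewrite gt_eqF// smooth_step_den.
apply: SmoothAdd => //; apply: SmoothComp; first exact: smooth_flat_exp.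
by apply: SmoothBase; have := smooth_affine (-1 : R) 1; under eq_fun do rewrite mulN1r addrC.
Qed.

(** * Cubes, bump functions and countable covers by balls *)

Section cubes.
Context {R : realType} {d : nat}.
Implicit Types (x y : 'rV[R]_d) (r : R) (Om : set 'rV[R]_d).

Definition cube x r : set 'rV[R]_d := [set v | forall i, v 0 i \in `[x 0 i - r, x 0 i + r]].

Lemma cube_compact x r : compact (cube x r).
Proof.
rewrite (_ : cube x r = [set v | forall i, `[x 0 i - r, x 0 i + r]%classic (v ord0 i)]).
  by apply: (@rV_compact R d (fun i => `[x 0 i - r, x 0 i + r]%classic)) => i; exact: segment_compact.
by apply/seteqP; split => v /= vx i; have := vx i.
Qed.

Lemma ball_rV x r y : 0 < r ->
  ball x r y <-> forall i, x 0 i - r < y 0 i < x 0 i + r.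
Proof.
move=> r0; split => [[_ xy] i|xy]; first by have := xy 0 i; rewrite /ball/= ltr_distlC.
by split => // i j; rewrite (ord1 i) /ball/= ltr_distlC.
Qed.

Lemma ball_cube x r : 0 < r -> ball x r `<=` cube x r.
Proof.
move=> r0 y /(ball_rV _ _ r0) xy i; have /andP[h1 h2] := xy i.
by rewrite in_itv/= !ltW.
Qed.

Lemma test_function_cube Om x r (phi : 'rV[R]_d -> R) : cube x r `<=` Om ->
  smooth phi -> (forall y, ~ cube x r y -> phi y = 0) -> test_function Om phi.
Proof. by move=> xOm sphi phi0; split => //; exists (cube x r); split => //; exact: cube_compact. Qed.

(** Balls for the sup norm are open cubes. For r > 0 this product vanishes off [ball x r] and tends
    pointwise to its indicator as n grows. *)
Definition bump x r (n : nat) (y : 'rV[R]_d) : R := \prod_(i < d)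
  (flat_exp (n%:R * (y 0 i - (x 0 i - r))) * flat_exp (n%:R * (x 0 i + r - y 0 i))).

Lemma smooth_bump x r n : smooth (bump x r n).
Proof.
apply: smooth_prod => i; apply: smoothM.
  have := smooth_comp (smooth_comp smooth_flat_exp (smooth_affine n%:R (- (n%:R * (x 0 i - r))))) (smooth_coord i).
  by congr smooth; apply/funext => y /=; congr flat_exp; ring.
have := smooth_comp (smooth_comp smooth_flat_exp (smooth_affine (- n%:R) (n%:R * (x 0 i + r)))) (smooth_coord i).
by congr smooth; apply/funext => y /=; congr flat_exp; ring.
Qed.

Lemma bump_ge0 x r n y : 0 <= bump x r n y.
Proof. by apply: prodr_ge0 => i _; rewrite mulr_ge0// flat_exp_ge0. Qed.

Lemma bump_le1 x r n y : bump x r n y <= 1.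
Proof.
rewrite /bump -[leRHS](@big1 R 1 *%R 'I_d (index_enum _) xpredT (fun=> 1))//.
by apply: ler_prod => i _; rewrite mulr_ge0 ?flat_exp_ge0//= mulr_ile1 ?flat_exp_ge0 ?flat_exp_le1.
Qed.

Lemma bump_eq0 x r n y : 0 < r -> ~ ball x r y -> bump x r n y = 0.
Proof.
move=> r0; rewrite ball_rV// => /existsNP[i /negP]; rewrite negb_and -!leNgt => H.
rewrite /bump (bigD1 i)//=; apply/eqP; rewrite !mulf_eq0; apply/orP; left.
case/orP: H => h; apply/orP; [left|right]; rewrite flat_exp_eq0//;
  by rewrite mulr_ge0_le0// subr_le0.
Qed.

Lemma bump_cvg x r y : 0 < r -> bump x r n y @[n --> \oo] --> (\1_(ball x r) y : R).
Proof.
move=> r0; rewrite indicE; have [xy|xy] := pselect (ball x r y); rewrite ?(mem_set xy) ?(memNset xy) /=.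
  rewrite [X in _ --> X](_ : _ = \prod_(i < d) (1 * 1)); last first.
    by rewrite big1// => i _; rewrite mulr1.
  apply: cvg_big => [|i _]; first exact: mul_continuous.
  move/(ball_rV _ _ r0) : xy => /(_ i) /andP[h1 h2].
  apply: cvgM.
    by have := @flat_exp_cvg R (y 0 i - (x 0 i - r)); rewrite subr_gt0 h1.
  by have := @flat_exp_cvg R (x 0 i + r - y 0 i); rewrite subr_gt0 h2.
by apply: cvg_near_cst; near=> n; rewrite bump_eq0.
Unshelve. all: by end_near. Qed.

Definition rcenter (p : 'rV[rat]_d * rat) : 'rV[R]_d := map_mx ratr p.1.
Definition rradius (p : 'rV[rat]_d * rat) : R := ratr p.2.

Lemma open_rat_ball Om y : open Om -> Om y -> exists p,
  [/\ 0 < rradius p, cube (rcenter p) (rradius p) `<=` Om & ball (rcenter p) (rradius p) y].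
Proof.
move=> oOm Omy.
have /nbhs_ballP[e /= e0 eOm] : nbhs y Om by exact: open_nbhs_nbhs.
have [q /andP[q0 qe]] : exists q : rat, ratr q \in `]0, (e / 2)[ by apply: rat_in_itvoo; rewrite divr_gt0.
rewrite !lteBSide /= in q0 qe.
have [c Hc] : exists c : 'I_d -> rat, forall i, ratr (c i) \in `](y 0 i - ratr q), (y 0 i + ratr q)[.
  suff H i : exists c : rat, ratr c \in `](y 0 i - ratr q), (y 0 i + ratr q)[.
    by exists (fun i => sval (cid (H i))) => i; case: cid.
  by apply: rat_in_itvoo; rewrite ltrBlDr -addrA ltrDl addr_gt0.
have Hc' i : y 0 i - ratr q < rcenter (\row_i c i, q) 0 i < y 0 i + ratr q.
  by rewrite !mxE; have := Hc i; rewrite in_itv.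
exists (\row_i c i, q); split => //=.
  move=> z zc; apply: eOm; rewrite ball_rV// => i.
  have := zc i; rewrite in_itv/= /rradius/=; have := Hc' i.
  move: (rcenter _ 0 i) => w; move/andP=> [h1 h2] /andP[h3 h4]; apply/andP; split; lra.
rewrite ball_rV// => i; have := Hc' i.
move: (rcenter _ 0 i) => w; move/andP=> [h1 h2]; apply/andP; rewrite /rradius/=; split; lra.
Qed.

(** An enumeration of the balls with rational data whose closed cube lies in Om; a code of anything
    else yields the empty set. The closed cube is compact in Om, so locally finite measures are
    finite on each of these balls. *)
Definition inner_balls Om (n : nat) : set 'rV[R]_d :=
  if unpickle n is Some p then
    if `[< 0 < rradius p /\ cube (rcenter p) (rradius p) `<=` Om >]
    then ball (rcenter p) (rradius p) else set0
  else set0.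

Lemma inner_ballsP Om n : inner_balls Om n = set0 \/
  exists x r, [/\ 0 < r, cube x r `<=` Om & inner_balls Om n = ball x r].
Proof.
rewrite /inner_balls; case: unpickle => [p|]; last by left.
case: asboolP => [[p0 pOm]|_]; last by left.
by right; exists (rcenter p), (rradius p).
Qed.

Lemma open_bigcup_balls Om : open Om -> Om = \bigcup_p inner_balls Om p.
Proof.
move=> oOm; apply/seteqP; split => [y Omy|y [n _]].
  have [p [p0 pOm py]] := open_rat_ball oOm Omy; exists (pickle p) => //.
  rewrite /inner_balls pickleK.
  by case: asboolP => // -[]; split.
have [->//|[x [r [r0 xOm ->]]] /(ball_cube r0)] := inner_ballsP Om n; exact: xOm.
Qed.

Lemma open_measurable_rV Om : open Om -> measurable Om.
Proof. exact: sub_sigma_algebra. Qed.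

Lemma measurable_ball_rV x r : measurable (ball x r : set 'rV[R]_d).
Proof. by apply: open_measurable_rV; exact: (@ball_open R 'rV[R]_d). Qed.

(** Balls generate the Borel sets because an open set is the countable union of its
    [inner_balls]. *)
Lemma sigma_algebra_of_balls (M : set (set 'rV[R]_d)) : sigma_algebra setT M ->
  (forall x r, 0 < r -> M (ball x r)) -> measurable `<=` M.
Proof.
move=> [M0 MC MU] Mb; apply: smallest_sub; first by split.
move=> U oU; rewrite (open_bigcup_balls oU); apply: MU => n.
by have [->//|[x [r [r0 _ ->]]]] := inner_ballsP U n; exact: Mb.
Qed.

Lemma continuous_measurable_rV (f : 'rV[R]_d -> R) : continuous f -> measurable_fun setT f.
Proof.
move=> cf; apply: (@measurability _ _ _ _ _ _ _ (measurable_realfun.RGenOInfty.measurableE R)) => // _ [_ [x ->] <-].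
rewrite setTI; apply: open_measurable_rV; move/continuousP : cf; apply.
by rewrite set_itvE; exact: open_gt.
Qed.

End cubes.

(** * Measures compared on test functions *)

Section lower_integral.
Import HBNNSimple.
Context d (X : measurableType d) (R : realType) (mu : {measure set X -> \bar R}).
Implicit Types (D : set X) (f g : X -> \bar R).
Local Open Scope ereal_scope.

(* The integral of a nonnegative function is a lower integral, hence monotone
   without any measurability. *)
Lemma ge0_le_lower_integral D f g : (forall x, D x -> 0 <= f x) ->
  (forall x, D x -> f x <= g x) -> \int[mu]_(x in D) f x <= \int[mu]_(x in D) g x.
Proof.
move=> f0 fg.
have fD0 x : 0 <= (f \_ D) x by rewrite patchE; case: ifPn => // /set_mem; exact: f0.
have fgD x : (f \_ D) x <= (g \_ D) x.
  by rewrite !patchE; case: ifPn => // /set_mem; exact: fg.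
rewrite integral_mkcond [leRHS]integral_mkcond !ge0_integralTE//.
  apply: le_ereal_sup => _ [h hf <-]; exists h => // x; exact: le_trans (fgD x).
by move=> x; exact: le_trans (fgD x).
Qed.

(** A simple function below f, set to 0 on the exceptional null set, lies below g and keeps its
    integral. Neither f nor g has to be measurable. *)
Lemma ae_ge0_le_lower_integral D f g : (forall x, D x -> 0 <= f x) ->
  (forall x, D x -> 0 <= g x) -> {ae mu, forall x, D x -> f x <= g x} ->
  \int[mu]_(x in D) f x <= \int[mu]_(x in D) g x.
Proof.
move=> f0 g0 [Z [mZ Z0 fgZ]].
have fD0 x : 0 <= (f \_ D) x by rewrite patchE; case: ifPn => // /set_mem; exact: f0.
rewrite integral_mkcond ge0_integralTE//; apply: ge_ereal_sup => _ [h hf <-].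
have h0 (x : X) : 0 <= (h x)%:E by rewrite lee_fin.
have mh : measurable_fun setT (EFin \o h) by exact/measurable_EFinP.
have -> : sintegral mu h = \int[mu]_x (h x)%:E.
  by rewrite integral_nnsfun// patch_setT.
pose k x := (h x * \1_(~` Z) x)%:E.
have mk : measurable_fun setT k.
  apply/measurable_EFinP/measurable_funM => //.
  by apply: measurable_indic; exact: measurableC.
rewrite [leLHS](@ge0_ae_eq_integral _ _ _ _ _ _ k)//; last 2 first.
- by move=> x _; rewrite lee_fin mulr_ge0.
- exists Z; split => //= x /=; apply: contra_notP => Zx _; rewrite /k indicE mem_set ?mulr1//.
- rewrite [leRHS]integral_mkcond; apply: ge0_le_lower_integral => x _.
    by rewrite lee_fin mulr_ge0.
  rewrite /k indicE; have [Zx|Zx] := pselect (Z x).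
    rewrite memNset ?mulr0//=.
    by rewrite patchE; case: ifPn => // /set_mem; exact: g0.
  rewrite mem_set// mulr1 (le_trans (hf x))// !patchE; case: ifPn => // /set_mem Dx.
  by apply: contrapT => H; apply: Zx; apply: fgZ => /= /(_ Dx).
Qed.

Lemma ae_ge0_eq_lower_integral D f g : (forall x, D x -> 0 <= f x) ->
  (forall x, D x -> 0 <= g x) -> ae_eq mu D f g ->
  \int[mu]_(x in D) f x = \int[mu]_(x in D) g x.
Proof.
move=> f0 g0 fg; apply/eqP; rewrite eq_le; apply/andP; split.
  by apply: ae_ge0_le_lower_integral => //; apply: filterS fg => x H Dx; rewrite (H Dx).
by apply: ae_ge0_le_lower_integral => //; apply: filterS fg => x H Dx; rewrite (H Dx).
Qed.

Lemma ae_eq_lower_integral D f g : ae_eq mu D f g ->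
  \int[mu]_(x in D) f x = \int[mu]_(x in D) g x.
Proof.
move=> fg; rewrite [LHS]integralE [RHS]integralE.
by congr (_ - _); apply: ae_ge0_eq_lower_integral => //; apply: filterS fg => x H Dx;
  rewrite ?funeposE ?funenegE (H Dx).
Qed.

End lower_integral.

Lemma cvge0_lt {R : realType} (u : nat -> \bar R) (e : R) :
  u @ \oo --> 0%E -> 0 < e -> \forall n \near \oo, (u n < e%:E)%E.
Proof.
move=> cu e0; have : nbhs 0%E [set y : \bar R | (y < e%:E)%E].
  by apply: open_nbhs_nbhs; split; [exact: open_ereal_lt_ereal|rewrite /= lte_fin].
by move=> /cu.
Qed.

Lemma bounded_cvg_L1 d (X : measurableType d) (R : realType) (mu : {measure set X -> \bar R})
    (D : set X) (g : X -> R) (h : nat -> X -> R) (M e : R) :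
  measurable D -> (mu D < +oo)%E ->
  (forall n, measurable_fun D (h n)) -> measurable_fun D g ->
  (forall x, D x -> h n x @[n --> \oo] --> g x) ->
  (forall n x, D x -> `|h n x| <= M) -> 0 < e ->
  exists N, (\int[mu]_(x in D) `|h N x - g x|%:E < e%:E)%E.
Proof.
move=> mD Doo mh mg hg hM e0.
have [] := @dominated_convergence _ _ R mu _ mD (fun n x => (h n x)%:E)
  (EFin \o g) (EFin \o cst M).
- by move=> n; apply/measurable_EFinP.
- exact/measurable_EFinP.
- by apply: aeW => x Dx; apply: cvg_EFin; [exact: nearW|exact: hg].
- apply/integrableP; split; first exact/measurable_EFinP/measurable_cst.
  by under eq_integral do rewrite /=; rewrite integral_cst// lte_mul_pinfty.
- by apply: aeW => x n Dx; rewrite lee_fin; exact: hM.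
move=> _ H _; have [N _ /(_ N (leqnn N))] := cvge0_lt H e0.
by exists N.
Qed.

Section approximation.
Context {R : realType} {d : nat} (nu : {measure set 'rV[R]_d -> \bar R}).
Context (Om : set 'rV[R]_d) (x : 'rV[R]_d) (r : R).
Hypotheses (r0 : 0 < r) (xOm : cube x r `<=` Om) (nux : (nu (ball x r) < +oo)%E).

Definition cutoff (psi : 'rV[R]_d -> R) : Prop :=
  [/\ smooth psi, forall y, 0 <= psi y <= 1 & forall y, ~ ball x r y -> psi y = 0].

Lemma cutoff_test psi : cutoff psi -> test_function Om psi.
Proof.
move=> [sp _ p0]; apply: (test_function_cube xOm sp) => y xy.
by apply: p0; apply: contra_not xy; exact: ball_cube.
Qed.

Lemma measurable_cutoff psi : cutoff psi -> measurable_fun setT psi.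
Proof. by move=> [sp _ _]; apply: continuous_measurable_rV; exact: smooth_continuous. Qed.

Let dist (E : set 'rV[R]_d) psi : \bar R :=
  (\int[nu]_(y in ball x r) `|(\1_E y : R) - psi y|%:E)%E.

Let approximable : set (set 'rV[R]_d) := [set E | measurable E /\
  forall e : R, 0 < e -> exists2 psi, cutoff psi & (dist E psi < e%:E)%E].

Let mQ : measurable (ball x r : set 'rV[R]_d). Proof. exact: measurable_ball_rV. Qed.

Let mdist E psi (D : set 'rV[R]_d) : measurable E -> cutoff psi ->
  measurable_fun D (fun y : 'rV[R]_d => `|(\1_E y : R) - psi y|).
Proof.
move=> mE cpsi; apply: measurable_funTS; apply: measurableT_comp => //.
apply: measurable_funB; first exact: measurable_indic.
exact: measurable_cutoff.
Qed.

Let approx_cvg E (psi : nat -> 'rV[R]_d -> R) : measurable E -> (forall n, cutoff (psi n)) ->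
  (forall y, ball x r y -> psi n y @[n --> \oo] --> (\1_E y : R)) -> approximable E.
Proof.
move=> mE cpsi cvpsi; split => // e e0.

have [N HN] : exists N, (\int[nu]_(y in ball x r) `|psi N y - \1_E y|%:E < e%:E)%E.
  apply: (bounded_cvg_L1 (M := 1)) => //.
  - move=> n; apply/measurable_funTS; exact: measurable_cutoff.
  - by move=> n y _; have [_ p1 _] := cpsi n; have /andP[h0 h1] := p1 y; rewrite ger0_norm.
exists (psi N) => //; apply: le_lt_trans HN.
by apply: ge0_le_lower_integral => y _; rewrite lee_fin// distrC.
Qed.

Let approx_ball z s : 0 < s -> approximable (ball z s).
Proof.
move=> s0; apply: (@approx_cvg _ (fun n => bump z s n * bump x r n)).
- exact: measurable_ball_rV.
- move=> n; split; first by apply: smoothM; exact: smooth_bump.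
  + by move=> y; rewrite /GRing.mul /= mulr_ge0 ?bump_ge0//= mulr_ile1 ?bump_ge0 ?bump_le1.
  + by move=> y xy; rewrite /GRing.mul /= [X in _ * X]bump_eq0 ?mulr0.
- move=> y xy; rewrite -[X in _ --> X]mulr1 -[X in _ * X](_ : \1_(ball x r) y = 1); last first.
    by rewrite indicE mem_set.
  by apply: cvgM; exact: bump_cvg.
Qed.

Let le_dist E E1 E2 psi psi1 psi2 : measurable E1 -> measurable E2 ->
  cutoff psi1 -> cutoff psi2 ->
  (forall y, ball x r y -> `|(\1_E y : R) - psi y| <=
     `|(\1_E1 y : R) - psi1 y| + `|(\1_E2 y : R) - psi2 y|) ->
  (dist E psi <= dist E1 psi1 + dist E2 psi2)%E.
Proof.
move=> mE1 mE2 c1 c2 H; rewrite -ge0_integralD//; last 2 first.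
- by apply/measurable_EFinP; exact: mdist.
- by apply/measurable_EFinP; exact: mdist.
apply: ge0_le_lower_integral => y Qy; first by rewrite lee_fin.
by rewrite -EFinD lee_fin; exact: H.
Qed.

(** If psi approximates the indicator of E, then 1 - psi is no cutoff, as it is 1 off the ball. It
    is multiplied by a cutoff chi that approximates the constant 1 inside the ball. *)
Let approxC E : approximable E -> approximable (~` E).
Proof.
move=> [mE aE]; split; first exact: measurableC.
move=> e e0; have e20 : 0 < e / 2 by rewrite divr_gt0.
have [psi cpsi H] := aE _ e20.
have [_ /(_ _ e20)[chi cchi Hc]] := approx_ball x r0.
have [sp p1 p0] := cpsi; have [sc c1 c0] := cchi.
exists (chi * (cst 1 - psi)).
  split; first by apply: (smoothM sc); apply: smoothB sp; exact: smooth_cst.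
  - move=> y; have /andP[? ?] := p1 y; have /andP[? ?] := c1 y.
    change ((chi * (cst 1 - psi)) y) with (chi y * (1 - psi y)).
    rewrite mulr_ge0 ?subr_ge0//= mulr_ile1 ?subr_ge0//.
    by rewrite lerBlDr lerDl.
  - by move=> y xy; rewrite /GRing.mul /= c0// mul0r.
rewrite (splitr e) EFinD; apply: le_lt_trans (lteD Hc H).
apply: le_dist => // y Qy; have /andP[? ?] := p1 y; have /andP[? ?] := c1 y.
change ((chi * (cst 1 - psi)) y) with (chi y * (1 - psi y)).
have -> : \1_(~` E) y = 1 - \1_E y :> R by rewrite indicC !indicE; case: (y \in E) => /=; lra.
have -> : \1_(ball x r) y = 1 :> R by rewrite indicE mem_set.
rewrite (_ : _ - _ = (1 - chi y) * (1 - psi y) - (\1_E y - psi y)); last by ring.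
rewrite (le_trans (ler_normB _ _))// lerD2r normrM ler_piMr//.
by rewrite ger0_norm ?subr_ge0// lerBlDr lerDl.
Qed.

(** The approximant psi + chi - psi chi = 1 - (1 - psi)(1 - chi) mimics the indicator of a union and
    keeps its values in [0, 1]. *)
Let approxU E F : approximable E -> approximable F -> approximable (E `|` F).
Proof.
move=> [mE aE] [mF aF]; split; first exact: measurableU.
move=> e e0; have e20 : 0 < e / 2 by rewrite divr_gt0.
have [psi cpsi H] := aE _ e20; have [chi cchi Hc] := aF _ e20.
have [sp p1 p0] := cpsi; have [sc c1 c0] := cchi.
exists (psi + chi - psi * chi).
  split; first by apply: smoothB; [exact: smoothD|exact: smoothM].
  - move=> y; have /andP[? ?] := p1 y; have /andP[? ?] := c1 y.
    change ((psi + chi - psi * chi) y) with (psi y + chi y - psi y * chi y).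
    by apply/andP; split; nra.
  - move=> y xy; change ((psi + chi - psi * chi) y) with (psi y + chi y - psi y * chi y).
    by rewrite p0// c0// mul0r subr0 addr0.
rewrite (splitr e) EFinD; apply: le_lt_trans (lteD H Hc).
apply: le_dist => // y Qy; have /andP[? ?] := p1 y; have /andP[? ?] := c1 y.
change ((psi + chi - psi * chi) y) with (psi y + chi y - psi y * chi y).
have -> : \1_(E `|` F) y = \1_E y + \1_F y - \1_E y * \1_F y :> R.
  by rewrite !indicE in_setU; case: (y \in E); case: (y \in F) => /=; lra.
rewrite (_ : _ - _ = (1 - \1_F y) * (\1_E y - psi y) + (1 - psi y) * (\1_F y - chi y)); last by ring.
rewrite (le_trans (ler_normD _ _))// !normrM lerD// ler_piMl//.
  by rewrite indicE; case: (_ \in _); rewrite ?subrr ?subr0 ?normr0 ?normr1.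
by rewrite ger0_norm ?subr_ge0// lerBlDr lerDl.
Qed.

(** Finite partial unions are approximable, and their indicators converge to that of the whole union
    in L^1 on the ball by dominated convergence. *)
Let approx_bigcup (E : nat -> set 'rV[R]_d) : (forall n, approximable (E n)) ->
  approximable (\bigcup_n E n).
Proof.
move=> aE; have mE n : measurable (E n) by have [] := aE n.
have mU : measurable (\bigcup_n E n) by exact: bigcup_measurable.
split => // e e0; have e20 : 0 < e / 2 by rewrite divr_gt0.
pose F n := \big[setU/set0]_(k < n) E k.
have aF n : approximable (F n).
  rewrite /F; elim: n => [|n IH]; last by rewrite big_ord_recr /=; exact: approxU.
  rewrite big_ord0; split => // c c0; exists (cst 0); last first.
    rewrite /dist; under eq_integral do rewrite indic0 subr0 normr0.
    by rewrite integral0 lte_fin.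
  by split => //; [exact: smooth_cst|move=> y; rewrite lexx ler01].
have mF n : measurable (F n) by have [] := aF n.
have [N HN] : exists N, (\int[nu]_(y in ball x r) `|\1_(F N) y - \1_(\bigcup_n E n) y|%:E < (e / 2)%:E)%E.
  apply: (bounded_cvg_L1 (M := 1)) => //; last first.
  - by move=> n y _; rewrite indicE; case: (_ \in _); rewrite ?normr1 ?normr0.
  - move=> y Qy; apply: cvg_near_cst; have [[N _ EN]|NE] := pselect ((\bigcup_n E n) y); last first.
    apply: nearW => n; rewrite !indicE !memNset// /F => H; apply: NE.
    by move: H; rewrite -bigcup_mkord => -[k _ Ek]; exists k.
  have Uy : (\bigcup_n E n) y by exists N.
  near=> n; rewrite !indicE (mem_set Uy) mem_set//.
  rewrite /F -bigcup_mkord; exists N => //=.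
  by near: n; exact: nbhs_infty_gt.
  - by move=> n; exact: measurable_indic.
have [_ /(_ _ e20)[psi cpsi Hp]] := aF N.
exists psi => //; rewrite (splitr e) EFinD; apply: le_lt_trans (lteD HN Hp).
rewrite -ge0_integralD//; last 2 first.
- by apply/measurable_EFinP; apply: measurableT_comp => //; apply: measurable_funB; exact: measurable_indic.
- by apply/measurable_EFinP; exact: mdist.
apply: ge0_le_lower_integral => y Qy; first by rewrite lee_fin.
rewrite -EFinD lee_fin [leRHS]addrC.
rewrite (_ : \1_(\bigcup_n E n) y - psi y = (\1_(F N) y - psi y) - (\1_(F N) y - \1_(\bigcup_n E n) y)); last by ring.
exact: ler_normB.
Unshelve. all: by end_near. Qed.

(** The approximable sets form a sigma-algebra that contains all balls. *)
Lemma approx_cutoff (E : set 'rV[R]_d) (e : R) : measurable E -> 0 < e ->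
  exists2 psi, cutoff psi &
    (\int[nu]_(y in ball x r) `|(\1_E y : R) - psi y|%:E < e%:E)%E.
Proof.
move=> mE; suff [_] : approximable E by exact.
move: E mE; apply: sigma_algebra_of_balls => //; split.
- have := approxC (approxU (approx_ball x r0) (approxC (approx_ball x r0))).
  by rewrite setUv setCT.
- by move=> A; rewrite setTD; exact: approxC.
- exact: approx_bigcup.
Qed.

End approximation.

(** * The space L^2 *)

Section semi_inner_product.
Context {R : realType} {V : lmodType R}.

(** A common interface for [dotp] on L^2, [H1dot] on H^1 and H^1_0, and the energy form on H^1_0.
    Functions are not identified almost everywhere, so the form is only semidefinite, and its axioms
    hold on the subspace S only. *)
Record semi_inner (S : set V) (beta : V -> V -> R) : Prop := SemiInner {
  sip0 : S 0 ;
  sipD : forall u v, S u -> S v -> S (u + v) ;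
  sipZ : forall a u, S u -> S (a *: u) ;
  sipC : forall u v, S u -> S v -> beta u v = beta v u ;
  sipDl : forall u v w, S u -> S v -> S w -> beta (u + v) w = beta u w + beta v w ;
  sipZl : forall a u w, S u -> S w -> beta (a *: u) w = a * beta u w ;
  sip_ge0 : forall u, S u -> 0 <= beta u u }.

Context (S : set V) (beta : V -> V -> R) (H : semi_inner S beta).
Implicit Types u v w : V.

Let N u : R := Num.sqrt (beta u u).

Lemma sipN u : S u -> S (- u).
Proof. by rewrite -scaleN1r; exact: (sipZ H). Qed.

Lemma sipB u v : S u -> S v -> S (u - v).
Proof. by move=> Su Sv; apply: (sipD H) => //; exact: sipN. Qed.

Lemma sipNl u w : S u -> S w -> beta (- u) w = - beta u w.
Proof. by move=> Su Sw; rewrite -scaleN1r (sipZl H)// mulN1r. Qed.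

Lemma sipBl u v w : S u -> S v -> S w -> beta (u - v) w = beta u w - beta v w.
Proof. by move=> Su Sv Sw; rewrite (sipDl H) ?sipNl//; exact: sipN. Qed.

Lemma sipDr u v w : S u -> S v -> S w -> beta w (u + v) = beta w u + beta w v.
Proof. by move=> Su Sv Sw; rewrite (sipC H) ?(sipDl H) ?(sipC H Sw)//; exact: (sipD H). Qed.

Lemma sipZr a u w : S u -> S w -> beta w (a *: u) = a * beta w u.
Proof. by move=> Su Sw; rewrite (sipC H) ?(sipZl H) ?(sipC H Sw)//; exact: (sipZ H). Qed.

Lemma sipNr u w : S u -> S w -> beta w (- u) = - beta w u.
Proof. by move=> Su Sw; rewrite -scaleN1r sipZr// mulN1r. Qed.

Lemma sipBr u v w : S u -> S v -> S w -> beta w (u - v) = beta w u - beta w v.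
Proof. by move=> Su Sv Sw; rewrite sipDr ?sipNr//; exact: sipN. Qed.

Lemma sip_sqrD u v : S u -> S v ->
  beta (u + v) (u + v) = beta u u + 2 * beta u v + beta v v.
Proof.
move=> Su Sv; have Suv := sipD H Su Sv.
by rewrite (sipDl H) ?sipDr// (sipC H Sv Su); ring.
Qed.

Lemma sip_sqrB u v : S u -> S v ->
  beta (u - v) (u - v) = beta u u - 2 * beta u v + beta v v.
Proof.
move=> Su Sv; rewrite sip_sqrD ?sipNr ?sipNl ?sipNr//; [|exact: sipN|exact: sipN].
by rewrite opprK mulrN.
Qed.

Lemma sip_norm_ge0 u : 0 <= N u. Proof. exact: sqrtr_ge0. Qed.

Lemma sip_norm_sqr u : S u -> N u ^+ 2 = beta u u.
Proof. by move=> Su; rewrite sqr_sqrtr// (sip_ge0 H). Qed.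

Lemma sip_CS u v : S u -> S v -> `|beta u v| <= N u * N v.
Proof.
move=> Su Sv.
have key t : 0 <= beta u u + 2 * t * beta u v + t ^+ 2 * beta v v.
  have Stv := sipZ H t Sv.
  have := sip_ge0 H (sipD H Su Stv); rewrite sip_sqrD// !sipZr// (sipZl H)//.
  by congr (0 <= _); ring.
rewrite -sqrtrM ?(sip_ge0 H)// -sqrtr_sqr ler_wsqrtr//.
have [v0|v0] := eqVneq (beta v v) 0.
  rewrite v0 mulr0; have [->|b0] := eqVneq (beta u v) 0; first by rewrite expr0n.
  (* When [beta v v] is 0 the polynomial in [key] is affine in t, and at this t it takes the value
     -1. *)
  have := key (- (beta u u + 1) / (2 * beta u v)); rewrite v0 mulr0 addr0.
  rewrite (_ : 2 * _ * _ = - (beta u u + 1)); last by field.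
  by rewrite opprD addrA subrr sub0r oppr_ge0 ler10.
have v1 : 0 < beta v v by rewrite lt0r v0 (sip_ge0 H).
have := key (- beta u v / beta v v).
rewrite (_ : _ + _ = (beta u u * beta v v - beta u v ^+ 2) / beta v v); last by field.
by rewrite pmulr_lge0 ?invr_gt0// subr_ge0.
Qed.

Lemma sip_triangle u v : S u -> S v -> N (u + v) <= N u + N v.
Proof.
move=> Su Sv; rewrite -ler_sqr ?nnegrE ?addr_ge0 ?sip_norm_ge0//.
rewrite sip_norm_sqr; last exact: (sipD H).
rewrite sip_sqrD// sqrrD !sip_norm_sqr// lerD2r lerD2l -[leRHS]mulr_natl.
by apply: ler_wpM2l => //; exact: le_trans (ler_norm _) (sip_CS Su Sv).
Qed.

Lemma sip_normZ a u : S u -> N (a *: u) = `|a| * N u.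
Proof.
move=> Su; rewrite /N (sipZl H) ?sipZr//; last exact: (sipZ H).
by rewrite mulrA -expr2 sqrtrM ?sqr_ge0// sqrtr_sqr.
Qed.

Lemma sip_normN u : S u -> N (- u) = N u.
Proof. by move=> Su; rewrite -scaleN1r sip_normZ// normrN1 mul1r. Qed.

Lemma sip_norm0 : N 0 = 0.
Proof. by have := sip_normZ 0 (sip0 H); rewrite scale0r normr0 mul0r. Qed.

Lemma sip_norm_distC u v : S u -> S v -> N (u - v) = N (v - u).
Proof. by move=> Su Sv; rewrite -sip_normN ?opprB//; exact: sipB. Qed.

Lemma sip_triangleB u v w : S u -> S v -> S w -> N (u - w) <= N (u - v) + N (v - w).
Proof.
move=> Su Sv Sw; have := sip_triangle (sipB Su Sv) (sipB Sv Sw).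
by rewrite addrA subrK.
Qed.

Lemma sip_norm_dist u v : S u -> S v -> `|N u - N v| <= N (u - v).
Proof.
move=> Su Sv; rewrite ler_norml; apply/andP; split.
  rewrite lerNl opprB lerBlDr (sip_norm_distC Su Sv).
  by have := sip_triangle (sipB Sv Su) Su; rewrite subrK.
by rewrite lerBlDr; have := sip_triangle (sipB Su Sv) Sv; rewrite subrK.
Qed.

End semi_inner_product.

Section L2_theory.
Context {R : realType} {d : nat} (Om : set 'rV[R]_d) (mOm : measurable Om).
Implicit Types u v w : 'rV[R]_d -> R.
Local Notation mu := (lebesgue_rV d).

Lemma Lnorm2E u : ('N[mu]_2%:E[EFin \o u \_ Om] = (\int[mu]_(x in Om) (u x * u x)%:E) `^ 2^-1)%E.
Proof.
rewrite unlock [in RHS]integral_mkcond; congr (_ `^ _)%E; apply: eq_integral => x _.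
rewrite /= !patchE; case: ifP => _; last by rewrite normr0 powR0// pnatr_eq0.
by rewrite powR_mulrn// real_normK ?num_real// expr2.
Qed.

Lemma L2P u : L2 Om u <->
  measurable_fun Om u /\ mu.-integrable Om (EFin \o (fun x => u x * u x)).
Proof.
have sq0 x : Om x -> (0 <= (u x * u x)%:E)%E by move=> _; rewrite lee_fin -expr2 sqr_ge0.
have E : (\int[mu]_(x in Om) `|(u x * u x)%:E| = \int[mu]_(x in Om) (u x * u x)%:E)%E.
  by apply: eq_integral => x /set_mem Omx; rewrite gee0_abs ?sq0.
rewrite /L2 /mkset inE /=; split.
  move=> /andP[/set_mem /= /(measurable_restrictT u mOm) mu_ /set_mem /=].
  rewrite /finite_norm Lnorm2E => H; split => //.
  apply/integrableP; split; first exact/measurable_EFinP/measurable_funM.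
  rewrite E; move: H; rewrite ltey => H; rewrite ltey; apply: contra H => /eqP ->.
  by rewrite poweRyr.
move=> [mu_ /integrableP[_]]; rewrite E => H; apply/andP; split.
  by apply/mem_set; apply/(measurable_restrictT u mOm).
by apply/mem_set; rewrite /= /finite_norm Lnorm2E; exact: poweR_lty.
Qed.

Lemma integrableM_L2 u v : 
  measurable_fun Om u -> mu.-integrable Om (EFin \o (fun x => u x * u x)) ->
  measurable_fun Om v -> mu.-integrable Om (EFin \o (fun x => v x * v x)) ->
  mu.-integrable Om (EFin \o (fun x => u x * v x)).
Proof.
move=> mu_ iu mv iv.
apply: (le_integrable mOm _ _ (integrableD mOm iu iv)).
  exact/measurable_EFinP/measurable_funM.
move=> x Omx.
rewrite /= lee_fin [leRHS]ger0_norm; last by rewrite addr_ge0// -expr2 sqr_ge0.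
by rewrite ler_norml; apply/andP; split; nra.
Qed.

Lemma L2_measurable u : L2 Om u -> measurable_fun Om u. Proof. by case/L2P. Qed.

Lemma L2_integrableM u v : L2 Om u -> L2 Om v ->
  mu.-integrable Om (EFin \o (fun x => u x * v x)).
Proof. by move=> /L2P[mu_ iu] /L2P[mv iv]; exact: integrableM_L2. Qed.

Lemma L2normE u : L2norm Om u = Num.sqrt (dotp Om u u).
Proof.
rewrite /L2norm Lnorm2E /dotp /Rintegral.
have I0 : (0 <= \int[mu]_(x in Om) (u x * u x)%:E)%E.
  by apply: integral_ge0 => x _; rewrite lee_fin -expr2 sqr_ge0.
move: I0; case: (\int[mu]_(x in Om) _)%E => [r r0| _|//].
  by rewrite poweR_EFin /= powR12_sqrt.
by rewrite poweRyr// sqrtr0.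
Qed.

Lemma L2norm_ge0 u : 0 <= L2norm Om u. Proof. by rewrite L2normE sqrtr_ge0. Qed.

Lemma L2norm_sqr u : L2norm Om u ^+ 2 = dotp Om u u.
Proof. by rewrite L2normE sqr_sqrtr//; apply: Rintegral_ge0 => x _; rewrite -expr2 sqr_ge0. Qed.

Lemma L2_sip : semi_inner (L2 Om) (dotp Om).
Proof.
split.
- apply/L2P; split; first exact: measurable_cst.
  by under eq_fun do rewrite /= mul0r; exact: integrable0.
- move=> u v Lu Lv; have [mu_ iu] := (iffLR (L2P u)) Lu; have [mv iv] := (iffLR (L2P v)) Lv.
  apply/L2P; split; first exact: measurable_funD.
  have i2 := integrableZl mOm 2 (L2_integrableM Lu Lv).
  apply: (@eq_integrable _ _ _ _ _ mOm _ _ _ (integrableD mOm (integrableD mOm iu iv) i2)) => x _.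
  rewrite /= -!EFinM -!EFinD; congr EFin.
  change ((u + v) x) with (u x + v x); ring.
- move=> a u /L2P[mu_ iu]; apply/L2P; split; first exact: measurable_funM.
  apply: (@eq_integrable _ _ _ _ _ mOm _ _ _ (integrableZl mOm (a * a) iu)) => x _.
  by rewrite /= -EFinM; congr EFin; rewrite mulrACA.
- by move=> u v _ _; rewrite /dotp; under eq_Rintegral do rewrite mulrC.
- move=> u v w Lu Lv Lw; rewrite /dotp -RintegralD//; try exact: L2_integrableM.
  by apply: eq_Rintegral => x _; rewrite -mulrDl.
- move=> a u w Lu Lw; rewrite /dotp -RintegralZl//; last exact: L2_integrableM.
  by apply: eq_Rintegral => x _; rewrite mulrA.
- by move=> u Lu; apply: Rintegral_ge0 => x _; rewrite -expr2 sqr_ge0.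
Qed.

Lemma dotp_ae_eq u u' v v' : ae_eq mu Om u u' -> ae_eq mu Om v v' ->
  dotp Om u v = dotp Om u' v'.
Proof.
move=> uu' vv'; rewrite /dotp /Rintegral; congr fine.
by apply: ae_eq_lower_integral; apply: filterS2 uu' vv' => x H K Omx; rewrite H ?K.
Qed.

Lemma L2norm_ae_eq u u' : ae_eq mu Om u u' -> L2norm Om u = L2norm Om u'.
Proof. by move=> uu'; rewrite !L2normE (dotp_ae_eq uu' uu'). Qed.

Lemma dotp_ge0 u v : nonneg_on Om u -> nonneg_on Om v -> 0 <= dotp Om u v.
Proof.
move=> u0 v0; rewrite /dotp /Rintegral fine_ge0//.
have -> : (\int[mu]_(x in Om) (u x * v x)%:E = \int[mu]_(x in Om) `|u x * v x|%:E)%E.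
  apply: ae_eq_lower_integral; near=> x => Omx.
  by rewrite ger0_norm// mulr_ge0//; move: Omx; near: x.
by apply: integral_ge0 => x _; rewrite lee_fin.
Unshelve. all: by end_near. Qed.

Lemma dotp_eq0_ae u v : L2 Om u -> L2 Om v -> nonneg_on Om (u * v) ->
  dotp Om u v = 0 -> {ae mu, forall x, Om x -> u x * v x = 0}.
Proof.
move=> Lu Lv uv0; have iuv := L2_integrableM Lu Lv.
rewrite /dotp /Rintegral => u0.
have I0 : (\int[mu]_(x in Om) `|(u x * v x)%:E| = 0)%E.
  rewrite -[RHS](congr1 EFin u0) fineK; last exact: integrable_fin_num.
  apply: ae_eq_lower_integral; apply: filterS uv0 => x H Omx.
  by rewrite gee0_abs// lee_fin; exact: H.
have := (iffLR (ae_eq_integral_abs mu mOm (measurable_int mu iuv))) I0.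
by apply: filterS => x H Omx; have := H Omx => -[].
Qed.

Lemma L2norm_eq0_ae u : L2 Om u -> dotp Om u u = 0 -> {ae mu, forall x, Om x -> u x = 0}.
Proof.
move=> Lu u0; have uu0 : nonneg_on Om (u * u).
  by apply: aeW => x _; rewrite /GRing.mul /= -expr2 sqr_ge0.
apply: filterS (dotp_eq0_ae Lu Lu uu0 u0) => x H Omx.
by have /eqP := H Omx; rewrite mulf_eq0 orbb => /eqP.
Qed.

Lemma L2_ae_eq u v : L2 Om u -> measurable_fun Om v -> ae_eq mu Om u v -> L2 Om v.
Proof.
move=> /L2P[mu_ iu] mv uv; apply/L2P; split => //.
apply/integrableP; split; first exact/measurable_EFinP/measurable_funM.
have /integrableP[_] := iu; congr (_ < _)%E; apply: ae_eq_lower_integral.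
by apply: filterS uv => x H Omx /=; rewrite H.
Qed.

Lemma L2_le u v : L2 Om u -> measurable_fun Om v -> (forall x, Om x -> `|v x| <= `|u x|) -> L2 Om v.
Proof.
move=> /L2P[mu_ iu] mv uv; apply/L2P; split => //.
apply: (le_integrable mOm _ _ iu); first exact/measurable_EFinP/measurable_funM.
move=> x Omx /=; rewrite lee_fin !normrM ler_pM//; exact: uv.
Qed.

Lemma L2_bounded u (M : R) : (mu Om < +oo)%E -> measurable_fun Om u ->
  (forall x, Om x -> `|u x| <= M) -> L2 Om u.
Proof.
move=> Omoo mu_ uM; apply/L2P; split => //.
apply: measurable_bounded_integrable => //; first exact: measurable_funM.
exists (M * M); split; first exact: num_real.
move=> c Mc x Omx; rewrite /= normrM; apply: le_trans (ltW Mc).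
by apply: ler_pM => //; exact: uM.
Qed.

End L2_theory.

(** * Slices of R^d and integrals of derivatives *)

Section smooth_affine_map.
Context {R : realType} {V W : normedModType R}.

(** L is affine with linear part l, so the difference quotients of h \o L along v and of h along
    [l v] are equal, not only their limits. It serves to restrict functions of d + 1 variables to
    lines and hyperplanes. *)
Lemma smooth_comp_affine (L : V -> W) (l : V -> W) (h : W -> R) :
  continuous L -> (forall (t : R) v x, L (t *: v + x) = t *: l v + L x) ->
  smooth h -> smooth (h \o L) /\ forall x v, 'D_v (h \o L) x = 'D_(l v) h (L x).
Proof.
move=> cL HL sh.
have dh (k : W -> R) x v : smooth k -> is_derive x v (k \o L) ('D_(l v) k (L x)).
  move=> sk; have d1 : derivable k (L x) (l v) by exact: smooth_derivable.
  have E : (fun t : R => t^-1 *: (((k \o L) \o shift x) (t *: v) - (k \o L) x)) =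
           (fun t : R => t^-1 *: ((k \o shift (L x)) (t *: l v) - k (L x))).
    by apply/funext => t /=; rewrite HL.
  by apply: DeriveDef; rewrite /derivable /derive E.
split; last by move=> x v; have [_ ->] := dh h x v sh.
apply: (@smooth_coind _ _ [set f | exists k, smooth k /\ f = k \o L]); last by exists h.
move=> _ [k [sk ->]]; split.
- move=> x; apply: continuous_comp; [exact: cL|exact: smooth_continuous].
- by move=> x v; have [] := dh k x v sk.
- move=> v; exists (fun y => 'D_(l v) k y); split; first exact: smooth_derive.
  by apply/funext => x; have [_ ->] := dh k x v sk.
Qed.

End smooth_affine_map.

Lemma rV_addE {R : realType} d (x y : 'rV[R]_d) i : (x + y) 0 i = x 0 i + y 0 i.
Proof. by rewrite mxE. Qed.

Lemma rV_scaleE {R : realType} d (t : R) (x : 'rV[R]_d) i : (t *: x) 0 i = t * x 0 i.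
Proof. by rewrite mxE. Qed.

Lemma rV_0E {R : realType} d i : (0 : 'rV[R]_d) 0 i = 0. Proof. by rewrite mxE. Qed.

Section row_cons_theory.
Context {R : realType} {d : nat}.
Implicit Types (a : R) (v : 'rV[R]_d).

Lemma row_cons0 a v : row_cons (a, v) 0 0 = a.
Proof.
rewrite /row_cons !mxE/=; case: split_ordP => k; first by rewrite !ord1 !mxE eqxx mulr1n.
by move=> /(congr1 val).
Qed.

Lemma row_consS a v (i : 'I_d) : row_cons (a, v) 0 (rshift 1 i) = v 0 i.
Proof.
rewrite /row_cons !mxE/=; case: split_ordP => l; last by move=> /rshift_inj ->.
by move=> /(congr1 val) /= kl; have := ltn_ord l; rewrite -kl.
Qed.

Lemma ord_caseS (i : 'I_d.+1) : i = 0 \/ exists j : 'I_d, i = rshift 1 j.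
Proof.
case: (split_ordP (i : 'I_(1 + d))) => j ->; first by left; apply/val_inj; rewrite /= (ord1 j).
by right; exists j.
Qed.

Lemma row_consP (x y : 'rV[R]_d.+1) : x 0 0 = y 0 0 ->
  (forall i : 'I_d, x 0 (rshift 1 i) = y 0 (rshift 1 i)) -> x = y.
Proof. by move=> h0 hS; apply/rowP => i; case: (ord_caseS i) => [->|[j ->]]. Qed.

Lemma row_cons_affine1 v (t a b : R) :
  row_cons (t *: a + b, v) = t *: row_cons (a, 0) + row_cons (b, v).
Proof.
by apply: row_consP => [|i]; rewrite rV_addE rV_scaleE !(row_cons0, row_consS)// rV_0E mulr0 add0r.
Qed.

Lemma row_cons_affine2 a (t : R) v w :
  row_cons (a, t *: v + w) = t *: row_cons (0, v) + row_cons (a, w).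
Proof.
apply: row_consP => [|i]; rewrite rV_addE rV_scaleE !(row_cons0, row_consS)//.
  by rewrite mulr0 add0r.
by rewrite rV_addE rV_scaleE.
Qed.

Lemma row_cons_delta0 : row_cons (1 : R, 0) = delta_mx 0 0 :> 'rV[R]_d.+1.
Proof.
apply: row_consP => [|i]; first by rewrite row_cons0 mxE !eqxx.
by rewrite row_consS !mxE.
Qed.

Lemma row_cons_deltaS (i : 'I_d) :
  row_cons (0 : R, delta_mx 0 i) = delta_mx 0 (rshift 1 i) :> 'rV[R]_d.+1.
Proof.
apply: row_consP => [|j]; first by rewrite row_cons0 mxE !eqxx.
by rewrite row_consS !mxE (inj_eq (@rshift_inj 1 d)).
Qed.

Lemma continuous_row_cons1 v : continuous (fun a : R => row_cons (a, v) : 'rV[R]_d.+1).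
Proof.
move=> a A /nbhs_ballP[e /= e0 eA]; apply/nbhs_ballP; exists e => //= b ab.
by apply: eA; apply: row_cons_ball => //; exact: ballxx.
Qed.

Lemma continuous_row_cons2 a : continuous (fun v : 'rV[R]_d => row_cons (a, v) : 'rV[R]_d.+1).
Proof.
move=> v A /nbhs_ballP[e /= e0 eA]; apply/nbhs_ballP; exists e => //= w vw.
by apply: eA; apply: row_cons_ball => //; exact: ballxx.
Qed.

Lemma cube0P e (x : 'rV[R]_e) M : cube 0 M x <-> forall i, x 0 i \in `[- M, M].
Proof.
split=> H i; have := H i; first by rewrite !rV_0E sub0r add0r.
by rewrite rV_0E sub0r add0r.
Qed.

Lemma cube_row_cons (M : R) a v : cube 0 M (row_cons (a, v)) <->
  a \in `[- M, M] /\ cube 0 M v.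
Proof.
rewrite !cube0P; split=> [H|[Ha Hv] i].
  split; first by have := H 0; rewrite row_cons0.
  by move=> i; have := H (rshift 1 i); rewrite row_consS.
by case: (ord_caseS i) => [->|[j ->]]; rewrite ?row_cons0 ?row_consS.
Qed.

End row_cons_theory.

Section lebesgue_bounded.
Context {R : realType}.

Lemma closed_measurable_rV d (C : set 'rV[R]_d) : closed C -> measurable C.
Proof.
move=> cC; have oC : open (~` C) by rewrite openC.
by rewrite -(setCK C); apply: measurableC; exact: open_measurable_rV.
Qed.

Lemma measurable_cube d (x : 'rV[R]_d) (r : R) : measurable (cube x r).
Proof.
apply: closed_measurable_rV.
by apply: compact_closed; [exact: norm_hausdorff|exact: cube_compact].
Qed.

Lemma lebesgue_cube_fin d (M : R) : (lebesgue_rV d (cube 0 M) < +oo)%E.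
Proof.
elim: d => [|d IH] /=.
  by rewrite diracE; case: (_ \in _); rewrite ltry.
rewrite /lebesgue_step /pushforward (_ : _ @^-1` _ = `[- M, M]%classic `*` cube 0 M); last first.
  by apply/seteqP; split => [[a v] /cube_row_cons|[a v] /= H]; [|exact/cube_row_cons].
rewrite product_measure1E//; last exact: measurable_cube.
have fM : (lebesgue_measure (`[(- M)%R, M%R]%classic : set R) < +oo)%E.
  by rewrite lebesgue_measure_itv /=; case: ifP => _; rewrite ?ltry// -EFinB ltry.
by apply: lte_mul_pinfty => //; rewrite ge0_fin_numE.
Qed.

Lemma bounded_set_cube d (A : set 'rV[R]_d) : bounded_set A -> exists2 M, 0 < M & A `<=` cube 0 M.
Proof.
move=> [M [_ HM]]; have M2 : 0 < `|M| + 2 by rewrite ltr_wpDl.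
exists (`|M| + 2) => // x Ax; apply: ball_cube => //.
have := HM (`|M| + 1); rewrite (le_lt_trans (ler_norm M)) ?ltrDl// => /(_ isT x Ax) /= H.
rewrite mx_norm_ball /ball_ /= sub0r normrN; apply: le_lt_trans H _.
by rewrite ltrD2l ltr1n.
Qed.

(** Fubini's theorem, as [lebesgue_rV d.+1] is the image of a product measure. Both orders occur:
    the variable of differentiation has to be integrated first. *)
Lemma integral_row_cons d (f : 'rV[R]_d.+1 -> R) :
  (lebesgue_rV d.+1).-integrable setT (EFin \o f) ->
  (\int[lebesgue_rV d.+1]_y (f y)%:E =
     \int[lebesgue_measure]_a \int[lebesgue_rV d]_v (f (row_cons (a, v)))%:E)%E /\
  (\int[lebesgue_rV d.+1]_y (f y)%:E =
     \int[lebesgue_rV d]_v \int[lebesgue_measure]_a (f (row_cons (a, v)))%:E)%E.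
Proof.
move=> fi; have mf := measurable_int _ fi.
have fi' : (lebesgue_measure \x lebesgue_rV d)%E.-integrable setT ((EFin \o f) \o (@row_cons R d)).
  have /integrableP[_ H] := fi.
  apply/integrableP; split; first by apply: measurableT_comp => //; exact: measurable_row_cons.
  rewrite -(@ge0_integral_pushforward _ _ _ _ _ (@row_cons R d) (@measurable_row_cons R d) _ setT
    (fun y => `|(f y)%:E|%E))//.
  exact: measurableT_comp.
have E : (\int[lebesgue_rV d.+1]_y (f y)%:E =
    \int[lebesgue_measure \x lebesgue_rV d]_p (f (row_cons p))%:E)%E.
  by rewrite [LHS](@integral_pushforward _ _ _ _ _ (@row_cons R d) (@measurable_row_cons R d) _ setT).
by rewrite E; split; [rewrite -(integral12_prod_meas1 fi')|rewrite -(integral21_prod_meas1 fi')].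
Qed.

Definition supported_in d (M : R) (f : 'rV[R]_d -> R) := forall x, ~ cube 0 M x -> f x = 0.

Lemma integrable_supported d (M : R) (f : 'rV[R]_d -> R) (nu : {measure set 'rV[R]_d -> \bar R}) :
  (nu (cube 0 M) < +oo)%E ->
  continuous f -> supported_in M f -> nu.-integrable setT (EFin \o f).
Proof.
move=> nuM cf fM.
have -> : EFin \o f = (EFin \o f) \_ (cube 0 M).
  apply/funext => x; rewrite patchE; case: ifPn => // /negP xM.
  by rewrite /= fM// => /mem_set.
apply/(integrable_mkcond _ (measurable_cube 0 M)).
apply: measurable_bounded_integrable => //; first exact: measurable_cube.
  by apply: measurable_funTS; exact: continuous_measurable_rV.
have : compact [set f x | x in cube 0 M].
  by apply: continuous_compact; [exact: continuous_subspaceT|exact: cube_compact].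
move=> /compact_bounded [B [rB HB]]; exists B; split => // c Bc x Mx.
by apply: HB Bc _ _; exists x.
Qed.

Lemma derive_supported (V : normedModType R) (K : set V) (f : V -> R) : closed K ->
  (forall x, ~ K x -> f x = 0) -> forall v x, ~ K x -> 'D_v f x = 0.
Proof.
move=> cK fK v x Kx.
have near0 : \forall y \near x, cst 0 y = f y.
  have : nbhs x (~` K) by apply: open_nbhs_nbhs; split => //; rewrite openC.
  by apply: filterS => y /fK ->.
by have [_ ->] := near_eq_is_derive near0 (is_derive_cst (0 : R) x v).
Qed.

Lemma closed_cube d (M : R) : closed (cube (0 : 'rV[R]_d) M).
Proof. by apply: compact_closed; [exact: norm_hausdorff|exact: cube_compact]. Qed.

Lemma smooth_within_continuous (F : R -> R) (A : set R) : smooth F -> {within A, continuous F}.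
Proof. by move=> sF; apply: continuous_subspaceT; exact: smooth_continuous. Qed.

Lemma integral_derive_line (F : R -> R) (M : R) : smooth F ->
  (forall x, x \notin `[- M, M] -> F x = 0) ->
  (\int[lebesgue_measure]_x ('D_1 F x)%:E = 0)%E.
Proof.
(* N exceeds M, so F vanishes at both ends of [-N, N], and it is positive whatever the sign of M. *)
move=> sF F0; pose N := `|M| + 1.
have MN : M < N by rewrite /N (le_lt_trans (ler_norm M))// ltrDl.
have NM : - N < - M by rewrite ltrN2.
have dF0 x : x \notin `[- M, M] -> 'D_1 F x = 0.
  move=> /negP Mx; apply: (@derive_supported _ `[- M, M]%classic); first exact: itv_closed.
    by move=> y /negP; exact: F0.
  by [].
have N0 : - N < N by rewrite -subr_gt0 opprK addr_gt0// ltr_wpDl.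
have E : (\int[lebesgue_measure]_x ('D_1 F x)%:E =
    \int[lebesgue_measure]_(x in `[(- N)%R, N%R]) ('D_1 F x)%:E)%E.
  rewrite [RHS]integral_mkcond; apply: eq_integral => x _; rewrite patchE; case: ifPn => // /negP xN.
  rewrite dF0//; apply/negP => xM; apply: xN; rewrite inE /=.
  move: xM; rewrite !in_itv /= => /andP[h1 h2].
  by rewrite (le_trans (ltW NM) h1) (le_trans h2 (ltW MN)).
have FN x : x \notin `[- M, M] -> F x = 0 by exact: F0.
rewrite E (@continuous_FTC2 _ _ F)//.
- by rewrite F0 ?F0 ?subee// in_itv/= negb_and -!ltNge ?MN ?NM ?orbT.
- by apply: smooth_within_continuous; exact: smooth_derive.
- split; first by move=> x _; exact: smooth_derivable.
  + by apply: cvg_at_right_filter; exact: smooth_continuous.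
  + by apply: cvg_at_left_filter; exact: smooth_continuous.
- by move=> x _; rewrite derive1E.
Qed.

(** Induction on the dimension: a derivative in the first coordinate integrates to 0 along each
    line, a derivative in another coordinate over each slice by the induction hypothesis. *)
Lemma integral_derive_eq0 d (i : 'I_d) (f : 'rV[R]_d -> R) (M : R) : smooth f ->
  supported_in M f -> (\int[lebesgue_rV d]_x ('D_(delta_mx 0 i) f x)%:E = 0)%E.
Proof.
elim: d => [|d IH] in i f *; first by case: i.
move=> sf fM.
have dfM v : supported_in M (fun x => 'D_v f x).
  by move=> x; apply: derive_supported => //; exact: closed_cube.
have sdf v : smooth (fun x => 'D_v f x) by exact: smooth_derive.
have ig v : (lebesgue_rV d.+1).-integrable setT (EFin \o (fun x => 'D_v f x)).
  apply: (integrable_supported (lebesgue_cube_fin d.+1 M)) => //; exact: smooth_continuous.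
have [E1 E2] := integral_row_cons (ig (delta_mx 0 i)).
have [i0|[j ij]] := ord_caseS i.
  rewrite E2 i0; under eq_integral => v _.
    have [sF dF] := smooth_comp_affine (@continuous_row_cons1 _ _ v)
      (fun t a b => row_cons_affine1 v t a b) sf.
    rewrite (_ : (fun a => _) = (fun a => ('D_1 (f \o (fun a : R => row_cons (a, v))) a)%:E)); last first.
      by apply/funext => a; rewrite dF row_cons_delta0.
    rewrite (integral_derive_line (M := M))//; last first.
      by move=> a aM; rewrite /= fM// => /cube_row_cons[]; rewrite (negbTE aM).
    over.
  by rewrite integral0.
rewrite E1 ij; under eq_integral => a _.
  have [sF dF] := smooth_comp_affine (@continuous_row_cons2 _ _ a)
    (fun t v w => row_cons_affine2 a t v w) sf.
  rewrite (_ : (fun v => _) = (fun v => ('D_(delta_mx 0 j) (f \o (fun v : 'rV[R]_d => row_cons (a, v))) v)%:E)); last first.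
    by apply/funext => v; rewrite dF row_cons_deltaS.
  rewrite IH//; last by move=> v vM; rewrite /= fM// => /cube_row_cons[].
  over.
by rewrite integral0.
Qed.

End lebesgue_bounded.

(** * Test functions and integration by parts *)

Section test_functions.
Context {R : realType} {d : nat} (Om : set 'rV[R]_d).
Implicit Types (phi psi : 'rV[R]_d -> R).
Local Notation test := (test_function Om).

Lemma test_smooth phi : test phi -> smooth phi. Proof. by case. Qed.

Lemma test_off phi x : test phi -> ~ Om x -> phi x = 0.
Proof. by move=> [_ [K [_ KOm K0]]] Omx; apply: K0; apply: contra_not Omx; exact: KOm. Qed.

Lemma test0 : test (cst 0).
Proof. by split; [exact: smooth_cst|exists set0; split => //; exact: compact0]. Qed.

Lemma testD phi psi : test phi -> test psi -> test (phi + psi).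
Proof.
move=> [sp [K [cK KOm K0]]] [sq [L [cL LOm L0]]]; split; first exact: smoothD.
exists (K `|` L); split; [exact: compactU|by rewrite subUset|].
move=> x /not_orP[Kx Lx].
by rewrite (_ : (phi + psi) x = phi x + psi x)// K0// L0// addr0.
Qed.

Lemma test_smoothM phi (g : 'rV[R]_d -> R) : test phi -> smooth g -> test (g * phi).
Proof.
move=> [sp [K [cK KOm K0]]] sg; split; first exact: smoothM.
exists K; split => // x Kx.
by rewrite (_ : (g * phi) x = g x * phi x)// K0// mulr0.
Qed.

Lemma testZ (c : R) phi : test phi -> test (c *: phi).
Proof. by move=> tp; apply: (@test_smoothM phi (cst c) tp); exact: smooth_cst. Qed.

Lemma test_comp (G : R -> R) phi : smooth G -> G 0 = 0 -> test phi -> test (G \o phi).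
Proof.
move=> sG G0 [sp [K [cK KOm K0]]]; split; first exact: smooth_comp.
by exists K; split => // x Kx; rewrite /= K0.
Qed.

Lemma test_derive v phi : test phi -> test (fun x => 'D_v phi x).
Proof.
move=> [sp [K [cK KOm K0]]]; split; first exact: smooth_derive.
exists K; split => // x Kx; apply: (derive_supported _ K0) => //.
by apply: compact_closed => //; exact: norm_hausdorff.
Qed.

Lemma test_supported phi : test phi -> exists2 M, 0 < M & supported_in M phi.
Proof.
move=> [sp [K [cK KOm K0]]].
have [M M0 KM] := bounded_set_cube (compact_bounded cK).
by exists M => // x xM; apply: K0; apply: contra_not xM; exact: KM.
Qed.

Lemma test_continuous phi : test phi -> continuous phi.
Proof. by move=> [sp _]; exact: smooth_continuous. Qed.

Lemma test_bounded phi : test phi -> exists2 C, 0 <= C & forall x, `|phi x| <= C.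
Proof.
move=> tp; have [M M0 pM] := test_supported tp.
have : compact [set phi x | x in cube 0 M].
  apply: continuous_compact; last exact: cube_compact.
  by apply: continuous_subspaceT; exact: test_continuous.
move=> /compact_bounded [B [rB HB]]; exists (`|B| + 1); first by rewrite addr_ge0.
have BB : B < `|B| + 1 by rewrite (le_lt_trans (ler_norm B))// ltrDl.
move=> x; have [xM|xM] := pselect (cube 0 M x); last by rewrite pM// normr0 addr_ge0.
by apply: HB BB _ _; exists x.
Qed.

Lemma measurable_test phi : test phi -> measurable_fun setT phi.
Proof. by move=> tp; apply: continuous_measurable_rV; exact: test_continuous. Qed.

End test_functions.

Section integration_by_parts.
Context {R : realType} {d : nat} (Om : set 'rV[R]_d).
Hypotheses (oOm : open Om) (bOm : bounded_set Om).
Implicit Types (phi psi : 'rV[R]_d -> R).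
Local Notation test := (test_function Om).
Local Notation mu := (lebesgue_rV d).

Let mOm : measurable Om. Proof. exact: open_measurable_rV. Qed.

Lemma lebesgue_Om_fin : (mu Om < +oo)%E.
Proof.
have [M M0 OmM] := bounded_set_cube bOm.
by apply: le_lt_trans (lebesgue_cube_fin d M); rewrite le_measure// inE//; exact: measurable_cube.
Qed.

Lemma test_L2 phi : test phi -> L2 Om phi.
Proof.
move=> tp; have [C C0 pC] := test_bounded tp.
apply: (L2_bounded mOm lebesgue_Om_fin (M := C)) => //.
by apply: measurable_funTS; exact: measurable_test tp.
Qed.

Lemma test_integration_by_parts i phi psi : test phi -> test psi ->
  \int[mu]_(x in Om) (psi x * 'D_(delta_mx 0 i) phi x) =
  - \int[mu]_(x in Om) ('D_(delta_mx 0 i) psi x * phi x).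
Proof.
move=> tp tq; set v := delta_mx 0 i.
have tpq := test_smoothM tp (test_smooth tq).
have [M M0 pqM] := test_supported tpq.
have E0 := integral_derive_eq0 i (test_smooth tpq) pqM.
have tdp := test_derive v tp; have tdq := test_derive v tq.
have E x : 'D_v (psi * phi) x = psi x * 'D_v phi x + 'D_v psi x * phi x.
  rewrite deriveM; [|exact: smooth_derivable (test_smooth tq)|exact: smooth_derivable (test_smooth tp)].
  by congr (_ + _); rewrite mulrC.
apply/eqP; rewrite -subr_eq0 opprK; apply/eqP.
rewrite -RintegralD//; last 2 first.
- exact: (L2_integrableM mOm (test_L2 tq) (test_L2 tdp)).
- exact: (L2_integrableM mOm (test_L2 tdq) (test_L2 tp)).
rewrite /Rintegral integral_mkcond -[RHS](congr1 fine E0); congr fine; apply: eq_integral => x _.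
rewrite patchE -/v E; case: ifPn => // /negP Omx; rewrite !(test_off tp) ?(test_off tq) ?mulr0 ?mul0r ?addr0//.
- by move=> /mem_set.
- by move=> /mem_set.
Qed.

Lemma test_weak_partial i psi : test psi -> is_weak_partial Om i psi (fun x => 'D_(delta_mx 0 i) psi x).
Proof. by move=> tq phi tp; exact: test_integration_by_parts. Qed.

End integration_by_parts.

(** * From inequalities on test functions to inequalities on Borel sets *)

Section local_comparison.
Context {R : realType} {d : nat} (Om : set 'rV[R]_d).
Hypotheses (oOm : open Om) (bOm : bounded_set Om).
Variables (m1 m2 : {measure set 'rV[R]_d -> \bar R}) (v : 'rV[R]_d -> R).
Hypotheses (m1fin : forall K, compact K -> K `<=` Om -> (m1 K < +oo)%E)
  (m2fin : forall K, compact K -> K `<=` Om -> (m2 K < +oo)%E) (Lv : L2 Om v).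
Hypothesis m1m2 : forall phi, test_function Om phi -> (forall x, 0 <= phi x) ->
  \int[m1]_(x in Om) phi x <= \int[m2]_(x in Om) phi x + dotp Om v phi.
Local Notation mu := (lebesgue_rV d).

Let mOm : measurable Om. Proof. exact: open_measurable_rV. Qed.

Section on_ball.
Variables (x : 'rV[R]_d) (r : R).
Hypotheses (r0 : 0 < r) (xOm : cube x r `<=` Om).
Let Q : set 'rV[R]_d := ball x r.

Let mQ : measurable Q. Proof. exact: measurable_ball_rV. Qed.
Let QOm : Q `<=` Om. Proof. by move=> y /(ball_cube r0); exact: xOm. Qed.

Lemma measure_ball_fin (m : {measure set 'rV[R]_d -> \bar R}) :
  (forall K, compact K -> K `<=` Om -> (m K < +oo)%E) -> (m Q < +oo)%E.
Proof.
move=> mfin; apply: le_lt_trans (mfin _ (@cube_compact _ _ x r) xOm).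
by rewrite le_measure ?inE//; [exact: measurable_cube|exact: ball_cube].
Qed.

Lemma cutoff_integral (m : {measure set 'rV[R]_d -> \bar R}) (E : set 'rV[R]_d) psi (e : R) :
  (m Q < +oo)%E -> measurable E -> cutoff x r psi ->
  (\int[m]_(y in Q) `|(\1_E y : R) - psi y|%:E < e%:E)%E ->
  `|\int[m]_(y in Om) psi y - fine (m (Q `&` E))| <= e.
Proof.
move=> mQoo mE cpsi Hpsi; have [sp p1 p0] := cpsi.
have mpsi : measurable_fun Q psi by apply: measurable_funTS; exact: measurable_cutoff cpsi.
have m1E : measurable_fun Q (\1_E : _ -> R) by exact: measurable_indic.
have i1 : m.-integrable Q (EFin \o psi).
  apply: measurable_bounded_integrable => //; exists 1; split => // c c1 y _ /=.
  by have /andP[? ?] := p1 y; rewrite ger0_norm// (le_trans _ (ltW c1)).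
have i2 : m.-integrable Q (EFin \o \1_E).
  apply: measurable_bounded_integrable => //; exists 1; split => // c c1 y _ /=.
  by rewrite indicE; case: (_ \in _); rewrite ?normr1 ?normr0 ltW// (lt_trans _ c1).
have -> : \int[m]_(y in Om) psi y = \int[m]_(y in Q) psi y.
  rewrite /Rintegral [in LHS]integral_mkcond [in RHS]integral_mkcond; congr fine.
  apply: eq_integral => y _; rewrite !patchE.
  have [Qy|Qy] := pselect (Q y); first by rewrite !mem_set//; exact: QOm.
  by rewrite [in RHS]memNset//; case: ifP => // _; rewrite p0.
have -> : fine (m (Q `&` E)) = \int[m]_(y in Q) (\1_E y : R).
  by rewrite /Rintegral integral_indic// setIC.
rewrite -RintegralB//; apply: le_trans (le_normr_Rintegral mQ _) _.
  have := integrableB mQ i1 i2; congr integrable.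
have H : (\int[m]_(t in Q) `|psi t - \1_E t|%:E < e%:E)%E.
  apply: le_lt_trans Hpsi.
  by apply: ge0_le_lower_integral => y _; rewrite lee_fin// distrC.
rewrite /Rintegral; rewrite -lee_fin fineK ?ltW// ge0_fin_numE.
  exact: lt_trans H (ltry _).
by apply: integral_ge0 => y _; rewrite lee_fin.
Qed.

(** One cutoff has to approximate the indicator of E for m1, m2 and Lebesgue measure simultaneously;
    approximation with respect to their sum achieves this. *)
Lemma local_measure_le (E : set 'rV[R]_d) : measurable E ->
  fine (m1 (Q `&` E)) <= fine (m2 (Q `&` E)) + dotp Om v \1_(Q `&` E).
Proof.
move=> mE; apply/ler_addgt0Pr => e e0.
set c := L2norm Om v + 1.
have c0 : 0 < c by rewrite ltr_wpDl// L2normE// sqrtr_ge0.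
(* One third of e for each of m1, m2 and the density term. The square appears because |1_E - psi| <=
   1 makes the squared L^2 distance at most the L^1 distance. *)
pose del := Num.min (e / 3) ((e / 3 / c) ^+ 2).
have e3 : 0 < e / 3 by rewrite divr_gt0.
have del0 : 0 < del by rewrite lt_min e3 exprn_gt0// divr_gt0.
pose nu := measure_add (measure_add m1 m2) mu.
have mQ1 := measure_ball_fin m1fin; have mQ2 := measure_ball_fin m2fin.
have mQ3 : (mu Q < +oo)%E.
  by apply: le_lt_trans (lebesgue_Om_fin oOm bOm); rewrite le_measure ?inE.
have nuQ : (nu Q < +oo)%E.
  have -> : nu Q = (measure_add m1 m2 Q + mu Q)%E := measure_addE _ _ _.
  have -> : measure_add m1 m2 Q = (m1 Q + m2 Q)%E := measure_addE _ _ _.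
  by rewrite !lte_add_pinfty.
have [psi cpsi Hpsi] := approx_cutoff r0 nuQ mE del0.
have [sp p1 p0] := cpsi.
have mdist : measurable_fun Q (fun y => `|(\1_E y : R) - psi y|%:E).
  apply/measurable_EFinP; apply: measurableT_comp => //.
  apply: measurable_funB; first exact: measurable_indic.
  by apply: measurable_funTS; exact: measurable_cutoff cpsi.
have d0 (y : 'rV[R]_d) : Q y -> (0 <= `|(\1_E y : R) - psi y|%:E)%E by rewrite lee_fin.
move: Hpsi; rewrite /nu ge0_integral_measure_add// ge0_integral_measure_add// => Hpsi.
set I1 := (\int[m1]_(y in Q) _)%E in Hpsi; set I2 := (\int[m2]_(y in Q) _)%E in Hpsi.
set I3 := (\int[mu]_(y in Q) _)%E in Hpsi.
have I10 : (0 <= I1)%E by exact: integral_ge0.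
have I20 : (0 <= I2)%E by exact: integral_ge0.
have I30 : (0 <= I3)%E by exact: integral_ge0.
have H1 : (I1 < del%:E)%E.
  by apply: le_lt_trans Hpsi; rewrite -addeA leeDl// adde_ge0.
have H2 : (I2 < del%:E)%E.
  by apply: le_lt_trans Hpsi; rewrite (addeC I1) -addeA leeDl// adde_ge0.
have H3 : (I3 < del%:E)%E.
  by apply: le_lt_trans Hpsi; rewrite leeDr// adde_ge0.
have := cutoff_integral mQ1 mE cpsi H1; rewrite ler_norml => /andP[h1 _].
have := cutoff_integral mQ2 mE cpsi H2; rewrite ler_norml => /andP[_ h2].
have tpsi := cutoff_test r0 xOm cpsi.
have psi0 y : 0 <= psi y by have /andP[] := p1 y.
have h0 := m1m2 tpsi psi0.
have Lpsi := test_L2 oOm bOm tpsi.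
have L1 : L2 Om (\1_(Q `&` E)).
  apply: (L2_bounded mOm (lebesgue_Om_fin oOm bOm) (M := 1)).
    by apply: measurable_indic; exact: measurableI.
  by move=> y _; rewrite indicE; case: (_ \in _); rewrite ?normr1 ?normr0.
have sip := L2_sip mOm.
have h3 : `|dotp Om v psi - dotp Om v \1_(Q `&` E)| <= e / 3.
  rewrite -(sipBr sip)//; apply: le_trans (sip_CS sip Lv (sipB sip Lpsi L1)) _.
  rewrite -!L2normE//.
  have Ldel : L2norm Om (psi - \1_(Q `&` E)) <= e / 3 / c.
    rewrite -ler_sqr ?nnegrE; [|exact: L2norm_ge0|by rewrite divr_ge0// ltW].
    rewrite L2norm_sqr//.
    apply: (@le_trans _ _ del); last by rewrite ge_min lexx orbT.
    rewrite -lee_fin; apply: le_trans (ltW H3).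
    rewrite /dotp /Rintegral fineK; last first.
      exact/integrable_fin_num/(L2_integrableM mOm (sipB sip Lpsi L1) (sipB sip Lpsi L1)).
    rewrite /I3 [leLHS]integral_mkcond [leRHS]integral_mkcond.
    apply: ge0_le_lower_integral => y _.
      by rewrite patchE; case: ifP => // _; rewrite lee_fin -expr2 sqr_ge0.
    rewrite !patchE; have [Qy|Qy] := pselect (Q y); last first.
      rewrite [in leRHS]memNset//; case: ifP => // _.
      change ((psi - \1_(Q `&` E)) y) with (psi y - \1_(Q `&` E) y).
      by rewrite p0// indicE memNset ?subrr ?mulr0// => -[].
    rewrite !mem_set//; last exact: QOm.
    change ((psi - \1_(Q `&` E)) y) with (psi y - \1_(Q `&` E) y).
    rewrite lee_fin.
    have -> : \1_(Q `&` E) y = \1_E y :> R by rewrite !indicE in_setI (mem_set Qy).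
    rewrite distrC -expr2 -(real_normK (num_real _)) expr2 distrC ler_piMl//.
    have /andP[q0 q1] := p1 y.
    by rewrite indicE; case: (_ \in _); rewrite ler_norml /=; apply/andP; split; lra.
  apply: (@le_trans _ _ (L2norm Om v * (e / 3 / c))).
    by rewrite ler_wpM2l// L2normE// sqrtr_ge0.
  rewrite mulrCA ler_piMr ?(ltW e3)// ler_pdivrMr// mul1r /c lerDl//.
move: h3; rewrite ler_norml => /andP[_ h3].
have del3 : del <= e / 3 by rewrite ge_min lexx.
lra.
Qed.

End on_ball.

(** Mutual singularity removes m2: m1 only sees the part of E inside H, where m2 vanishes. That part
    is cut into disjoint pieces contained in inner balls, where the local inequality applies.
    Replacing v by max(v, 0) makes the integrals monotone in the set. *)
Lemma measure_le_density (H E : set 'rV[R]_d) : measurable H -> m1 (Om `\` H) = 0%E ->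
  m2 (Om `&` H) = 0%E -> nonneg_on Om v -> measurable E -> E `<=` Om ->
  (m1 E <= \int[mu]_(x in E) (v x)%:E)%E.
Proof.
move=> mH m1H m2H v0 mE EOm.
have m1le A : measurable A -> A `<=` Om `\` H -> m1 A = 0%E.
  move=> mA AOm; apply/eqP; rewrite eq_le measure_ge0 andbT -m1H.
  by rewrite le_measure ?inE//; exact: measurableD.
have m2le A : measurable A -> A `<=` Om `&` H -> m2 A = 0%E.
  move=> mA AOm; apply/eqP; rewrite eq_le measure_ge0 andbT -m2H.
  by rewrite le_measure ?inE//; exact: measurableI.
pose EH := E `&` H.
have mEH : measurable EH by exact: measurableI.
have m1E : m1 E = m1 EH.
  rewrite (measureDI m1 mE mH).
  by rewrite [X in (X + _)%E]m1le ?add0e//; [exact: measurableD|by move=> y [/EOm]].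
pose w y := Num.max (v y) 0.
have w0 y : 0 <= w y by rewrite le_max lexx orbT.
have mv : measurable_fun Om v := L2_measurable mOm Lv.
have mw : measurable_fun Om w by apply: measurable_maxr => //; exact: measurable_cst.
have vw : ae_eq mu E (EFin \o v) (EFin \o w).
  apply: filterS v0 => y Hy Ey /=; rewrite /w max_l//; exact/Hy/EOm.
have -> : (\int[mu]_(x in E) (v x)%:E = \int[mu]_(x in E) (w x)%:E)%E.
  exact: ae_eq_lower_integral.
apply: (@le_trans _ _ (\int[mu]_(x in EH) (w x)%:E)%E); last first.
  rewrite [leLHS]integral_mkcond [leRHS]integral_mkcond.
  apply: ge0_le_lower_integral => y _; rewrite !patchE; first by case: ifP; rewrite ?lee_fin.
  case: ifPn => [/set_mem[Ey _]|_]; first by rewrite mem_set.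
  by case: ifP; rewrite ?lee_fin.
have piece A n : measurable A -> A `<=` EH -> A `<=` inner_balls Om n ->
    (m1 A <= \int[mu]_(x in A) (w x)%:E)%E.
  move=> mA AEH AQ; have [Q0|[x [r [r0 xOm Qxr]]]] := inner_ballsP Om n.
    rewrite Q0 subset0 in AQ; rewrite AQ measure0; apply: integral_ge0 => y _; exact: w0.
  have AQ' : ball x r `&` A = A by apply/setIidPr; rewrite -Qxr.
  have := local_measure_le r0 xOm mA; rewrite AQ'.
  rewrite (m2le A)//=; last by move=> y /AEH[Ey Hy]; split => //; exact: EOm.
  rewrite add0r -lee_fin fineK; last first.
    rewrite ge0_fin_numE//; apply: le_lt_trans (measure_ball_fin r0 xOm m1fin).
    by apply: le_measure; rewrite ?inE//; [exact: measurable_ball_rV|rewrite -Qxr].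
  move=> /le_trans; apply; rewrite /dotp /Rintegral.
  have L1 : L2 Om (\1_A).
    apply: (L2_bounded mOm (lebesgue_Om_fin oOm bOm) (M := 1)); first exact: measurable_indic.
    by move=> y _; rewrite indicE; case: (_ \in _); rewrite ?normr1 ?normr0.
  rewrite fineK; last exact/integrable_fin_num/(L2_integrableM mOm Lv L1).
  have -> : (\int[mu]_(y in Om) (v y * \1_A y)%:E = \int[mu]_(y in Om) (w y * \1_A y)%:E)%E.
    by apply: ae_eq_lower_integral; apply: filterS v0 => y Hy Omy; rewrite /w max_l ?Hy.
  rewrite [leLHS]integral_mkcond [leRHS]integral_mkcond.
  apply: ge0_le_lower_integral => y _; rewrite !patchE indicE.
    by case: ifP => // _; rewrite lee_fin mulr_ge0.
  case: (y \in A) => /=; last by rewrite mulr0; case: ifP.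
  by rewrite mulr1; case: ifP => // _; rewrite lee_fin.
pose D := seqDU (fun n => inner_balls Om n).
have mB n : measurable (inner_balls Om n).
  by have [->//|[x [r [_ _ ->]]]] := inner_ballsP Om n; exact: measurable_ball_rV.
have mD n : measurable (D n).
  by apply: measurableD => //; exact: bigsetU_measurable.
have EHD : EH = \bigcup_n (EH `&` D n).
  rewrite -setI_bigcupr -seqDU_bigcup_eq -open_bigcup_balls//.
  by apply/esym/setIidPl => y [/EOm].
have tD : trivIset setT (fun n => EH `&` D n).
  by apply: trivIset_setIl; exact: trivIset_seqDU.
have mED n : measurable (EH `&` D n) by exact: measurableI.
rewrite m1E EHD measure_semi_bigcup//; last by rewrite -EHD.
rewrite (@ge0_integral_bigcup _ _ _ mu (fun n => EH `&` D n))//.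
- apply: lee_nneseries => [n _ _|n _]; first exact: measure_ge0.
  by apply: (piece _ n) => // y [_ [Qy _]].
- apply/measurable_EFinP; rewrite -EHD; apply: measurable_funS mw => //.
  by move=> y [/EOm].
- by move=> y _; rewrite lee_fin.
Qed.

End local_comparison.

Section fundamental_lemma.
Context {R : realType} {d : nat} (Om : set 'rV[R]_d).
Hypotheses (oOm : open Om) (bOm : bounded_set Om).
Local Notation mu := (lebesgue_rV d).
Let mOm : measurable Om. Proof. exact: open_measurable_rV. Qed.

(** The local comparison with m1 = m2 = 0 says that the integral of v over Borel subsets of inner
    balls is nonnegative; on the set where v < 0 this forces nullity. *)
Lemma nonneg_of_test (v : 'rV[R]_d -> R) : L2 Om v ->
  (forall phi, test_function Om phi -> (forall x, 0 <= phi x) -> 0 <= dotp Om v phi) ->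
  nonneg_on Om v.
Proof.
move=> Lv Hv; have mv := L2_measurable mOm Lv.
pose E : set 'rV[R]_d := Om `&` [set x | v x < 0].
have mE : measurable E.
  have := mv mOm `]-oo, 0[%classic (measurable_itv _).
  by congr measurable; apply/seteqP; split => x /=; rewrite in_itv.
have LN : L2 Om (- v) by exact: (sipN (L2_sip mOm)).
have ball0 n : {ae mu, forall x, Om x -> inner_balls Om n x -> 0 <= v x}.
  have [->|[x [r [r0 xOm ->]]]] := inner_ballsP Om n; first by apply: aeW.
  have z0 (phi : 'rV[R]_d -> R) : \int[mzero]_(y in Om) phi y = 0.
    by rewrite /Rintegral integral_measure_zero.
  have fz (K : set 'rV[R]_d) : compact K -> K `<=` Om -> ((mzero K : \bar R) < +oo)%E.
    by move=> _ _; exact: ltry.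
  have hz (phi : 'rV[R]_d -> R) : test_function Om phi -> (forall x, 0 <= phi x) ->
      \int[mzero]_(y in Om) phi y <= \int[mzero]_(y in Om) phi y + dotp Om v phi.
    by move=> tp p0; rewrite !z0 add0r; exact: Hv.
  have := @local_measure_le R d Om oOm bOm mzero mzero v fz fz Lv hz x r r0 xOm E mE.
  rewrite /mzero/= add0r => H.
  have mQE : measurable (ball x r `&` E) by apply: measurableI => //; exact: measurable_ball_rV.
  have L1 : L2 Om \1_(ball x r `&` E).
    apply: (L2_bounded mOm (lebesgue_Om_fin oOm bOm) (M := 1)); first exact: measurable_indic.
    by move=> y _; rewrite indicE; case: (_ \in _); rewrite ?normr1 ?normr0.
  have pos (y : 'rV[R]_d) : 0 <= (- v) y * \1_(ball x r `&` E) y.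
    change ((- v) y) with (- v y).
    rewrite indicE; have [QE|QE] := pselect ((ball x r `&` E) y); last by rewrite memNset// mulr0.
    by rewrite mem_set// mulr1 oppr_ge0 ltW//; case: QE => _ [].
  have D0 : dotp Om (- v) \1_(ball x r `&` E) = 0.
    apply/eqP; rewrite eq_le; apply/andP; split; last by apply: Rintegral_ge0 => y _; exact: pos.
    by rewrite (sipNl (L2_sip mOm))// oppr_le0.
  have := dotp_eq0_ae mOm LN L1 (aeW _ (fun y _ => pos y)) D0.
  apply: filterS => y Hy Omy Qy; rewrite leNgt; apply/negP => vy0.
  have := Hy Omy; change ((- v) y) with (- v y).
  have QE : (ball x r `&` E) y by split => //; split.
  by rewrite indicE (mem_set QE) mulr1; lra.
have := ae_foralln ball0; apply: filterS => y Hy Omy.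
by have := Omy; rewrite {1}(open_bigcup_balls oOm) => -[n _ Qn]; exact: (Hy n Omy Qn).
Qed.

Lemma eq0_of_test (v : 'rV[R]_d -> R) : L2 Om v ->
  (forall phi, test_function Om phi -> dotp Om v phi = 0) ->
  {ae mu, forall x, Om x -> v x = 0}.
Proof.
move=> Lv Hv; have sip := L2_sip mOm.
have LN : L2 Om (- v) by exact: (sipN sip).
have h1 : nonneg_on Om v by apply: nonneg_of_test => // phi tp _; rewrite Hv.
have h2 : nonneg_on Om (- v).
  apply: nonneg_of_test => // phi tp _; rewrite (sipNl sip) ?Hv ?oppr0//.
  exact: (test_L2 oOm bOm tp).
apply: filterS2 h1 h2 => x H1 H2 Omx; apply/eqP; rewrite eq_le H1// andbT.
by have := H2 Omx; rewrite (_ : (- v) x = - v x)// oppr_ge0.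
Qed.

End fundamental_lemma.

Lemma ae_forall_fin d (X : measurableType d) (R : realType) (mu : {measure set X -> \bar R})
    (I : finType) (P : I -> X -> Prop) :
  (forall i, {ae mu, forall x, P i x}) -> {ae mu, forall x, forall i, P i x}.
Proof.
move=> HP; have : {ae mu, forall x, forall n : nat, if unpickle n is Some i then P i x else True}.
  apply: ae_foralln => n; case E : (unpickle n) => [i|]; last exact: aeW.
  exact: HP.
by apply: filterS => x Hx i; have := Hx (pickle i); rewrite pickleK.
Qed.

(** * The space H^1_0 *)

Section sobolev_theory.
Context {R : realType} {d : nat} (Om : set 'rV[R]_d).
Hypotheses (oOm : open Om) (bOm : bounded_set Om).
Implicit Types (u v w g phi psi : 'rV[R]_d -> R) (i : 'I_d).
Local Notation mu := (lebesgue_rV d).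
Local Notation test := (test_function Om).
Local Notation D i := (fun phi x => 'D_(delta_mx 0 i) phi x).

Let mOm : measurable Om. Proof. exact: open_measurable_rV. Qed.
Let sip := L2_sip mOm.

Lemma weak_partialP i u : H1 Om u ->
  L2 Om (weak_partial Om i u) /\ is_weak_partial Om i u (weak_partial Om i u).
Proof. by move=> [_ /(_ i)] Hg; exact: (xgetPex (fun=> 0) Hg). Qed.

(** [xget] depends only on the set it chooses from, so the chosen derivatives are equal as
    functions, not just almost everywhere. *)
Lemma weak_partial_congr i u v : (forall g, is_weak_partial Om i u g <-> is_weak_partial Om i v g) ->
  weak_partial Om i u = weak_partial Om i v.
Proof.
move=> uv; rewrite /weak_partial; congr xget.
by apply/seteqP; split => g [Lg wg]; split => //; exact/uv.
Qed.

Lemma dotpE u v : dotp Om u v = \int[mu]_(x in Om) (u x * v x). Proof. by []. Qed.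

Lemma H1norm_def u : H1norm Om u =
  Num.sqrt (L2norm Om u ^+ 2 + \sum_(i < d) L2norm Om (weak_partial Om i u) ^+ 2).
Proof. by []. Qed.

Lemma is_weak_partialE i u g : is_weak_partial Om i u g <->
  forall phi, test phi -> dotp Om u (D i phi) = - dotp Om g phi.
Proof. by []. Qed.

Lemma H1P u : H1 Om u <-> L2 Om u /\ forall i, exists g, L2 Om g /\ is_weak_partial Om i u g.
Proof. by []. Qed.

Lemma H10P u : H10 Om u <-> H1 Om u /\ forall e : R, 0 < e ->
  exists phi, test phi /\ H1norm Om (u - phi) < e.
Proof. by []. Qed.

Opaque dotp L2norm weak_partial H1norm is_weak_partial L2 H1 H10.

Lemma weak_partial_unique i u g g' : L2 Om g -> L2 Om g' ->
  is_weak_partial Om i u g -> is_weak_partial Om i u g' -> ae_eq mu Om g g'.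
Proof.
move=> Lg Lg' wg wg'; have := eq0_of_test oOm bOm (sipB sip Lg Lg').
have H phi : test phi -> dotp Om (g - g') phi = 0.
  move=> tp; have Lp := test_L2 oOm bOm tp; rewrite (sipBl sip)//.
  have := (iffLR (is_weak_partialE i u g)) wg phi tp; have := (iffLR (is_weak_partialE i u g')) wg' phi tp.
  by move=> -> /oppr_inj ->; rewrite subrr.
move=> /(_ H); apply: filterS => x Hx Omx; apply/eqP; rewrite -subr_eq0.
by apply/eqP; exact: Hx.
Qed.

Lemma weak_partial_L2 i u : H1 Om u -> L2 Om (weak_partial Om i u).
Proof. by move=> /(weak_partialP i)[]. Qed.

Lemma H1_L2 u : H1 Om u -> L2 Om u. Proof. by move=> /H1P[]. Qed.

Lemma weak_partial_ae i u g : H1 Om u -> L2 Om g -> is_weak_partial Om i u g ->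
  ae_eq mu Om (weak_partial Om i u) g.
Proof. by move=> Hu Lg wg; have [Lw ww] := weak_partialP i Hu; exact: (weak_partial_unique Lw Lg ww wg). Qed.

Lemma is_weak_partialD i u v g h : L2 Om u -> L2 Om v -> L2 Om g -> L2 Om h ->
  is_weak_partial Om i u g -> is_weak_partial Om i v h ->
  is_weak_partial Om i (u + v) (g + h).
Proof.
move=> Lu Lv Lg Lh /is_weak_partialE wu /is_weak_partialE wv; apply/is_weak_partialE => phi tp.
have Lp := test_L2 oOm bOm tp; have LD := test_L2 oOm bOm (test_derive (delta_mx 0 i) tp).
by rewrite (sipDl sip)// (sipDl sip)// wu// wv// opprD.
Qed.

Lemma is_weak_partialZ i a u g : L2 Om u -> L2 Om g ->
  is_weak_partial Om i u g -> is_weak_partial Om i (a *: u) (a *: g).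
Proof.
move=> Lu Lg /is_weak_partialE wu; apply/is_weak_partialE => phi tp.
have Lp := test_L2 oOm bOm tp; have LD := test_L2 oOm bOm (test_derive (delta_mx 0 i) tp).
by rewrite (sipZl sip)// (sipZl sip)// wu// mulrN.
Qed.

Lemma H1D u v : H1 Om u -> H1 Om v -> H1 Om (u + v).
Proof.
move=> /H1P[Lu Du] /H1P[Lv Dv]; apply/H1P; split; first exact: (sipD sip).
move=> i; have [g [Lg wg]] := Du i; have [h [Lh wh]] := Dv i.
by exists (g + h); split; [exact: (sipD sip)|exact: is_weak_partialD].
Qed.

Lemma H1Z a u : H1 Om u -> H1 Om (a *: u).
Proof.
move=> /H1P[Lu Du]; apply/H1P; split; first exact: (sipZ sip).
move=> i; have [g [Lg wg]] := Du i.
by exists (a *: g); split; [exact: (sipZ sip)|exact: is_weak_partialZ].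
Qed.

Lemma weak_partialD i u v : H1 Om u -> H1 Om v ->
  ae_eq mu Om (weak_partial Om i (u + v)) (weak_partial Om i u + weak_partial Om i v).
Proof.
move=> Hu Hv; have [? ?] := weak_partialP i Hu; have [? ?] := weak_partialP i Hv.
apply: weak_partial_ae; [exact: H1D|exact: (sipD sip)|].
by apply: is_weak_partialD => //; exact: H1_L2.
Qed.

Lemma weak_partialZ i a u : H1 Om u ->
  ae_eq mu Om (weak_partial Om i (a *: u)) (a *: weak_partial Om i u).
Proof.
move=> Hu; have [? ?] := weak_partialP i Hu.
apply: weak_partial_ae; [exact: H1Z|exact: (sipZ sip)|].
by apply: is_weak_partialZ => //; exact: H1_L2.
Qed.

Lemma test_H1 phi : test phi -> H1 Om phi.
Proof.
move=> tp; apply/H1P; split; first exact: test_L2.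
move=> i; exists (D i phi); split; last exact: test_weak_partial.
by apply: test_L2 => //; exact: test_derive.
Qed.

Lemma weak_partial_test i phi : test phi -> ae_eq mu Om (weak_partial Om i phi) (D i phi).
Proof.
move=> tp; apply: weak_partial_ae; first exact: test_H1.
  by apply: test_L2 => //; exact: test_derive.
exact: test_weak_partial.
Qed.

Definition H1dot u v : R := dotp Om u v + \sum_(i < d) dotp Om (weak_partial Om i u) (weak_partial Om i v).

Lemma H1_sip : semi_inner (H1 Om) H1dot.
Proof.
split.
- by apply: test_H1; exact: test0.
- exact: H1D.
- exact: H1Z.
- move=> u v Hu Hv; rewrite /H1dot (sipC sip); [|exact: H1_L2|exact: H1_L2].
  apply: (congr1 (fun s => dotp Om v u + s)); apply: eq_bigr => i _.
  exact: (sipC sip (weak_partial_L2 i Hu) (weak_partial_L2 i Hv)).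
- move=> u v w Hu Hv Hw; rewrite /H1dot (sipDl sip); [|exact: H1_L2|exact: H1_L2|exact: H1_L2].
  rewrite addrACA; congr (_ + _); rewrite -big_split; apply: eq_bigr => i _ /=.
  have Lu := weak_partial_L2 i Hu; have Lv := weak_partial_L2 i Hv.
  have Lw := weak_partial_L2 i Hw; have Luv := weak_partial_L2 i (H1D Hu Hv).
  rewrite -(sipDl sip)//.
  by apply: dotp_ae_eq (ae_eq_refl _ _ _); exact: weak_partialD.
- move=> a u w Hu Hw; rewrite /H1dot (sipZl sip); [|exact: H1_L2|exact: H1_L2].
  rewrite mulrDr; congr (_ + _); rewrite mulr_sumr; apply: eq_bigr => i _ /=.
  have Lu := weak_partial_L2 i Hu; have Lw := weak_partial_L2 i Hw.
  have Lau := weak_partial_L2 i (H1Z a Hu).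
  rewrite -(sipZl sip)//.
  by apply: dotp_ae_eq (ae_eq_refl _ _ _); exact: weak_partialZ.
- move=> u Hu; rewrite /H1dot addr_ge0 ?(sip_ge0 sip (H1_L2 Hu))//.
  by apply: sumr_ge0 => i _; apply: (sip_ge0 sip); exact: weak_partial_L2.
Qed.

Lemma H1normE u : H1norm Om u = Num.sqrt (H1dot u u).
Proof.
rewrite H1norm_def /H1dot L2norm_sqr//; congr (Num.sqrt (_ + _)).
by apply: eq_bigr => i _; rewrite L2norm_sqr.
Qed.

Lemma H1norm_ge0 u : 0 <= H1norm Om u. Proof. by rewrite H1normE sqrtr_ge0. Qed.

Lemma H1norm_sqr u : H1 Om u -> H1norm Om u ^+ 2 = H1dot u u.
Proof. by move=> Hu; rewrite H1normE sqr_sqrtr// (sip_ge0 H1_sip). Qed.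

Lemma L2norm_le_H1 u : L2norm Om u <= H1norm Om u.
Proof.
rewrite H1norm_def -[leLHS]ger0_norm ?L2norm_ge0// -sqrtr_sqr.
by rewrite ler_wsqrtr// lerDl; apply: sumr_ge0 => i _; exact: sqr_ge0.
Qed.

Lemma H1norm_triangle u v : H1 Om u -> H1 Om v -> H1norm Om (u + v) <= H1norm Om u + H1norm Om v.
Proof. by move=> Hu Hv; rewrite !H1normE; exact: (sip_triangle H1_sip Hu Hv). Qed.

Lemma H1normZ a u : H1 Om u -> H1norm Om (a *: u) = `|a| * H1norm Om u.
Proof. by move=> Hu; rewrite !H1normE; exact: (sip_normZ H1_sip a Hu). Qed.

Lemma H1norm0 : H1norm Om 0 = 0.
Proof. by rewrite H1normE; exact: (sip_norm0 H1_sip). Qed.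

Lemma H1norm_CS u v : H1 Om u -> H1 Om v -> `|H1dot u v| <= H1norm Om u * H1norm Om v.
Proof. by move=> Hu Hv; rewrite !H1normE; exact: (sip_CS H1_sip Hu Hv). Qed.

Lemma H1dotE u v : H1dot u v =
  dotp Om u v + \sum_(i < d) dotp Om (weak_partial Om i u) (weak_partial Om i v).
Proof. by []. Qed.

Opaque H1dot.

Lemma H10_H1 u : H10 Om u -> H1 Om u. Proof. by move=> /H10P[]. Qed.

Lemma H10_L2 u : H10 Om u -> L2 Om u. Proof. by move=> /H10_H1 /H1_L2. Qed.

Lemma H10D u v : H10 Om u -> H10 Om v -> H10 Om (u + v).
Proof.
move=> /H10P[Hu Tu] /H10P[Hv Tv]; apply/H10P; split; first exact: H1D.
move=> e e0; have e2 : 0 < e / 2 by rewrite divr_gt0.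
have [phi [tp hp]] := Tu _ e2; have [psi [tq hq]] := Tv _ e2.
exists (phi + psi); split; first exact: testD.
have Hup := sipB H1_sip Hu (test_H1 tp); have Hvp := sipB H1_sip Hv (test_H1 tq).
rewrite opprD addrACA; apply: le_lt_trans (H1norm_triangle Hup Hvp) _.
by rewrite (splitr e); exact: (ltrD hp hq).
Qed.

Lemma H10Z a u : H10 Om u -> H10 Om (a *: u).
Proof.
move=> /H10P[Hu Tu]; apply/H10P; split; first exact: H1Z.
move=> e e0; have e2 : 0 < e / (`|a| + 1) by rewrite divr_gt0// ltr_wpDl.
have [phi [tp hp]] := Tu _ e2; exists (a *: phi); split; first exact: testZ.
rewrite -scalerBr H1normZ; last exact: (sipB H1_sip Hu (test_H1 tp)).
apply: (@le_lt_trans _ _ ((`|a| + 1) * H1norm Om (u - phi))).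
  by rewrite ler_wpM2r ?H1norm_ge0// lerDl.
by rewrite mulrC -ltr_pdivlMr// ltr_wpDl.
Qed.

Lemma test_H10 phi : test phi -> H10 Om phi.
Proof.
move=> tp; apply/H10P; split; first exact: test_H1.
by move=> e e0; exists phi; split; rewrite // subrr H1norm0.
Qed.

Lemma H10_sip : semi_inner (H10 Om) H1dot.
Proof.
have [s0 sD sZ sC sDl sZl sge] := H1_sip.
split; [by apply: test_H10; exact: test0|exact: H10D|exact: H10Z| | | |].
- by move=> u v /H10_H1 ? /H10_H1 ?; exact: sC.
- by move=> u v w /H10_H1 ? /H10_H1 ? /H10_H1 ?; exact: sDl.
- by move=> a u w /H10_H1 ? /H10_H1 ?; exact: sZl.
- by move=> u /H10_H1 ?; exact: sge.
Qed.

(** Weak derivatives are tested through integrals, so changing u on a null set changes neither them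
    nor the H^1 distance to a test function. An initial condition is given only almost
    everywhere. *)
Lemma H10_ae_eq u v : H10 Om u -> L2 Om v -> ae_eq mu Om v u -> H10 Om v.
Proof.
move=> /H10P[Hu Tu] Lv vu.
have uv := ae_eq_sym vu.
have wE i (a c g : 'rV[R]_d -> R) : ae_eq mu Om a c -> is_weak_partial Om i a g -> is_weak_partial Om i c g.
  move=> ac /is_weak_partialE wa; apply/is_weak_partialE => phi tp.
  by rewrite -wa//; exact: (dotp_ae_eq (ae_eq_sym ac) (ae_eq_refl _ _ _)).
have Hv : H1 Om v.
  apply/H1P; split => [//|i]; have [g [Lg wg]] := (iffLR (H1P u) Hu).2 i; exists g; split; first exact: Lg.
  exact: wE uv wg.
apply/H10P; split; first exact: Hv.
move=> e e0; have [phi [tp hp]] := Tu e e0; exists phi; split; first exact: tp.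
have E : ae_eq mu Om (v - phi) (u - phi).
  by apply: filterS vu => x H Omx; rewrite /GRing.add/= H.
rewrite (_ : H1norm Om (v - phi) = H1norm Om (u - phi)); first exact: hp.
rewrite !H1norm_def (L2norm_ae_eq E); congr (Num.sqrt (_ + _)).
apply: eq_bigr => i _; congr (L2norm _ _ ^+ 2); apply: weak_partial_congr => g; split.
  exact: wE.
by apply: wE; exact: ae_eq_sym.
Qed.

Lemma H10_approx u (e : R) : H10 Om u -> 0 < e ->
  exists2 phi, test phi & H1norm Om (u - phi) < e.
Proof. by move=> /H10P[_ Tu] e0; have [phi [tp hp]] := Tu e e0; exists phi. Qed.

(* Two integrations by parts move all derivatives to the test function. *)
Lemma H1dot_test_le psi : test psi -> exists2 C, 0 <= C &
  forall w, H1 Om w -> `|H1dot psi w| <= C * L2norm Om w.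
Proof.
move=> tq; pose Dq i := 'D_(delta_mx 0 i) psi.
have tD i : test (fun x => 'D_(delta_mx 0 i) psi x) by exact: test_derive.
have tDD i : test (fun x => 'D_(delta_mx 0 i) (fun x => 'D_(delta_mx 0 i) psi x) x).
  exact: test_derive.
exists (L2norm Om psi + \sum_(i < d)
    L2norm Om (fun x => 'D_(delta_mx 0 i) (fun x => 'D_(delta_mx 0 i) psi x) x)).
  by rewrite addr_ge0 ?L2norm_ge0//; apply: sumr_ge0 => i _; rewrite L2norm_ge0.
move=> w Hw; have Lw := H1_L2 Hw.
have CS (a : 'rV[R]_d -> R) : test a -> `|dotp Om a w| <= L2norm Om a * L2norm Om w.
  by move=> ta; rewrite !L2normE; exact: (sip_CS sip (test_L2 oOm bOm ta) Lw).
rewrite H1dotE mulrDl; apply: le_trans (ler_normD _ _) _; apply: lerD; first exact: CS.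
rewrite mulr_suml; apply: le_trans (ler_norm_sum _ _ _) _; apply: ler_sum => i _.
have [Lwi wi] := weak_partialP i Hw.
rewrite (dotp_ae_eq (weak_partial_test i tq) (ae_eq_refl _ _ _)).
rewrite (sipC sip (test_L2 oOm bOm (tD i)) Lwi).
have := (iffLR (is_weak_partialE i w _)) wi _ (tD i) => /(congr1 -%R); rewrite opprK => <-.
rewrite normrN (sipC sip Lw (test_L2 oOm bOm (tDD i))).
exact: CS.
Qed.

End sobolev_theory.

(** * The energy form as a semi-inner product *)

Section energy_form.
Context {R : realType} {d : nat} (Om : set 'rV[R]_d) (B : 'rV[R]_d -> 'M[R]_d) (b : 'rV[R]_d -> R).
Hypotheses (oOm : open Om) (bOm : bounded_set Om) (csc : continuous_coercive_symmetric Om B b).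
Implicit Types (u v w : 'rV[R]_d -> R).
Local Notation mu := (lebesgue_rV d).
Local Notation a := (Defs.form Om B b).
Let mOm : measurable Om. Proof. exact: open_measurable_rV. Qed.

(** The chosen weak derivatives are linear in u only almost everywhere, so bilinearity is obtained
    under the integral sign. *)
Lemma form_sip : semi_inner (H10 Om) a.
Proof.
have [fint _ [c c0 coer] fsym] := csc.
have Hs := H10_sip oOm bOm.
split; [exact: (sip0 Hs)|by move=> u v; exact: (sipD Hs)|by move=> t u; exact: (sipZ Hs)|exact: fsym| | |].
- move=> u v w Hu Hv Hw; rewrite /Defs.form -(RintegralD mOm (fint _ _ Hu Hw) (fint _ _ Hv Hw)).
  rewrite /Rintegral; apply: (congr1 fine); apply: ae_eq_lower_integral.
  have : {ae mu, forall x, forall i : 'I_d, Om x -> weak_partial Om i (u + v) x =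
      weak_partial Om i u x + weak_partial Om i v x}.
    apply: ae_forall_fin => i.
    exact: (weak_partialD oOm bOm i (H10_H1 Hu) (H10_H1 Hv)).
  apply: filterS => x Hx Omx; congr EFin; rewrite /form_integrand.
  have E : (u + v) x = u x + v x by [].
  rewrite E addrACA; congr (_ + _); last by ring.
  rewrite -big_split; apply: eq_bigr => i _ /=; rewrite -big_split; apply: eq_bigr => j _ /=.
  by rewrite (Hx i Omx) mulrDl.
- move=> t u w Hu Hw; rewrite /Defs.form -(RintegralZl t mOm (fint _ _ Hu Hw)).
  rewrite /Rintegral; apply: (congr1 fine); apply: ae_eq_lower_integral.
  have : {ae mu, forall x, forall i : 'I_d, Om x -> weak_partial Om i (t *: u) x =
      t * weak_partial Om i u x}.
    apply: ae_forall_fin => i.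
    exact: (weak_partialZ oOm bOm i t (H10_H1 Hu)).
  apply: filterS => x Hx Omx; congr EFin; rewrite /form_integrand.
  have E : (t *: u) x = t * u x by [].
  rewrite E mulrDr mulr_sumr; congr (_ + _); last by ring.
  apply: eq_bigr => i _ /=; rewrite mulr_sumr; apply: eq_bigr => j _ /=.
  by rewrite (Hx i Omx) -mulrA.
- move=> u Hu; apply: le_trans (coer u Hu).
  by rewrite mulr_ge0 ?sqr_ge0// ltW.
Qed.

Lemma form_bound : exists2 C, 0 <= C & forall u v, H10 Om u -> H10 Om v ->
  `|a u v| <= C * H1norm Om u * H1norm Om v.
Proof.
have [_ [C HC] _ _] := csc; exists (Num.max C 0); first by rewrite le_max lexx orbT.
move=> u v Hu Hv; apply: le_trans (HC u v Hu Hv) _.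
rewrite -!mulrA ler_wpM2r ?mulr_ge0 ?H1norm_ge0// le_max lexx//.
Qed.

Lemma form_coercive : exists2 c, 0 < c & forall u, H10 Om u -> c * H1norm Om u ^+ 2 <= a u u.
Proof. by have [_ _ [c c0 coer] _] := csc; exists c. Qed.

End energy_form.
Opaque Defs.form.

Lemma divr_half {R : realType} (a c : R) : 0 < c -> a / (2 * c) * c = a / 2.
Proof. by move=> c0; field; rewrite gt_eqF. Qed.

(** Here D is the squared infimum of the distances, Z that of a near-minimiser, and the last
    hypothesis expands the distance after a step s. The first-order gain 2 s P is at least (7/4) s
    D, the second-order loss at most s D, so the distance squared falls below D + eta - (3/4) s D <
    D. *)
Lemma near_minimizer_absurd {R : realType} (D eta s K2 Z Y P kap : R) :
  0 < s * D -> eta <= s * D / 2 -> s * K2 = D -> kap = D / 8 -> 0 <= s ->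
  Y <= K2 -> D - kap <= P -> Z < D + eta ->
  D <= Z - 2 * (s * P) + s * (s * Y) -> False.
Proof.
move=> sD He sK -> s0 YK HP HZ H.
have h1 : s * (s * Y) <= s * D by rewrite -sK; do 2 apply: ler_wpM2l => //.
have h2 : s * (D - D / 8) <= s * P by exact: ler_wpM2l.
have h3 : s * (D - D / 8) = s * D * (7 / 8) by field.
lra.
Qed.

(** * Density of nonnegative test functions in the nonnegative cone of H^1_0 *)

Section convex_density.
Context {R : realType} {d : nat} (Om : set 'rV[R]_d).
Hypotheses (oOm : open Om) (bOm : bounded_set Om).
Implicit Types (u v w p q : 'rV[R]_d -> R).
Local Notation mu := (lebesgue_rV d).
Local Notation test := (test_function Om).
Let mOm : measurable Om. Proof. exact: open_measurable_rV. Qed.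
Let Hs := H10_sip oOm bOm.

(* A near-minimiser p of the distance to v satisfies an approximate variational
   inequality; testing it with q, which converges weakly to v, bounds |v - p|. *)
Lemma H1_dense_of_L2_dense (C : set ('rV[R]_d -> R)) v (M : R) :
  C `<=` H10 Om -> (forall p q (s : R), C p -> C q -> 0 <= s <= 1 -> C (p + s *: (q - p))) ->
  H10 Om v -> (forall eta : R, 0 < eta -> exists q, [/\ C q, H1norm Om q <= M & L2norm Om (q - v) < eta]) ->
  forall e : R, 0 < e -> exists2 p, C p & H1norm Om (v - p) < e.
Proof.
move=> CH Ccvx Hv HC e e0; apply: contrapT => /forall2NP Hno.
pose N := H1norm Om.
have N0 w : 0 <= N w by exact: H1norm_ge0.
pose A := [set N (v - p) | p in C].
have [q1 [Cq1 _ _]] := HC 1 ltr01.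
have A0 : A !=set0 by exists (N (v - q1)), q1.
have lbA : lbound A e.
  move=> _ [p Cp <-]; rewrite leNgt; apply/negP => pe.
  by have [] := Hno p.
have hA : has_inf A by split => //; exists e.
pose del := inf A.
have del0 : 0 < del by apply: lt_le_trans e0 _; exact: lb_le_inf.
have delP p : C p -> del <= N (v - p) by move=> Cp; apply: ge_inf; [exact: hA.2|exists p].
(* A bound for |q - p|: |q - v| is at most M + |v|, and |v - p| < del + 1 for a near-minimiser p. *)
pose K := M + N v + del + 1.
have M0 : 0 <= M by have [q [_ qM _]] := HC 1 ltr01; exact: le_trans (N0 q) qM.
have Nv0 := N0 v.
have K1 : del < K by rewrite /K; lra.
have K0 : 0 < K by exact: lt_trans del0 K1.
(* A step of this size keeps s^2 |q - p|^2 below s del^2, less than the first-order gain. *)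
pose s := del ^+ 2 / K ^+ 2.
have s0 : 0 < s by rewrite divr_gt0// exprn_gt0.
have s1 : s <= 1 by rewrite ler_pdivrMr ?exprn_gt0// mul1r ltW// ltrXn2r// ltW.
pose eta := Num.min 1 (s * del ^+ 2 / 2).
have eta0 : 0 < eta by rewrite lt_min ltr01/= divr_gt0// mulr_gt0// exprn_gt0.
have [p Cp Hp] : exists2 p, C p & N (v - p) ^+ 2 < del ^+ 2 + eta.
  have sq : del < Num.sqrt (del ^+ 2 + eta).
    rewrite -[ltLHS]ger0_norm ?(ltW del0)// -sqrtr_sqr ltr_sqrt ?ltrDl//.
    by rewrite addr_gt0// exprn_gt0.
  have [_ [p Cp <-] pd] := inf_lt A0 sq.
  exists p; first exact: Cp.
  rewrite -(sqr_sqrtr (a := del ^+ 2 + eta)) ?addr_ge0 ?sqr_ge0 ?(ltW eta0)//.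
  by rewrite ltr_sqr ?nnegrE ?sqrtr_ge0.
have eta1 : eta <= 1 by rewrite ge_min lexx.
have eta2 : eta <= s * del ^+ 2 / 2 by rewrite ge_min lexx orbT.
have Hp' := CH _ Cp.
pose z := v - p.
have Hz : H10 Om z := sipB Hs Hv Hp'.
have Nz : N z < del + 1.
  rewrite -ltr_sqr ?nnegrE ?N0//; last by rewrite ltW// ltr_wpDr.
  by apply: lt_le_trans Hp _; rewrite sqrrD expr1n mulr1; nra.
pose kap := del ^+ 2 / 8.
have kap0 : 0 < kap by rewrite divr_gt0// exprn_gt0.
have MN1 : 0 < M + N v + 1 by rewrite ltr_wpDl// addr_ge0.
have MN0 : 0 < 2 * (M + N v + 1) by rewrite mulr_gt0.
have [psi tpsi Hpsi] := H10_approx Hz (divr_gt0 kap0 MN0).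
have [Cp0 Cp1 HCpsi] := H1dot_test_le oOm bOm tpsi.
have Cp3 : 0 < Cp0 + 1 by rewrite ltr_wpDl.
have Cp2 : 0 < 2 * (Cp0 + 1) by rewrite mulr_gt0.
have [q [Cq qM qv]] := HC _ (divr_gt0 kap0 Cp2).
have Hq := CH _ Cq.
pose w := q - v.
have Hw : H10 Om w := sipB Hs Hq Hv.
have Hpsi' : H10 Om psi := test_H10 oOm bOm tpsi.
have Hzp : H10 Om (z - psi) := sipB Hs Hz Hpsi'.
have Nw : N w <= M + N v.
  apply: le_trans (H1norm_triangle oOm bOm (H10_H1 Hq) (H10_H1 (sipN Hs Hv))) _.
  apply: lerD; first exact: qM.
  rewrite -scaleN1r (H1normZ oOm bOm _ (H10_H1 Hv)) normrN1 mul1r; exact: lexx.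
(* Weak convergence made quantitative: z is replaced by a test function psi, against which w is
   controlled by its small L^2 norm; the error z - psi is controlled by the bounded H^1 norm of w.
   Each contributes kap / 2. *)
have zw : - kap <= H1dot Om z w.
  have E1 : H1dot Om z w = H1dot Om (z - psi) w + H1dot Om psi w.
    by rewrite (sipBl Hs Hz Hpsi' Hw) subrK.
  have := H1norm_CS oOm bOm (H10_H1 Hzp) (H10_H1 Hw); rewrite ler_norml => /andP[h1 _].
  have := HCpsi _ (H10_H1 Hw); rewrite ler_norml => /andP[h2 _].
  have Lw0 : 0 <= L2norm Om w := L2norm_ge0 Om w.
  have Nzp0 := N0 (z - psi); have Nw0 := N0 w.
  have k1 : H1norm Om (z - psi) * H1norm Om w <= kap / 2.
    apply: (@le_trans _ _ (kap / (2 * (M + N v + 1)) * (M + N v + 1))).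
      apply: ler_pM; [exact: Nzp0|exact: Nw0|exact: ltW Hpsi|].
      by apply: le_trans Nw _; rewrite lerDl.
    by rewrite (divr_half kap MN1).
  have k2 : Cp0 * L2norm Om w <= kap / 2.
    apply: (@le_trans _ _ ((Cp0 + 1) * (kap / (2 * (Cp0 + 1))))).
      by apply: ler_pM; [exact: Cp1|exact: Lw0|rewrite lerDl|exact: ltW qv].
    by rewrite mulrC (divr_half kap Cp3).
  rewrite E1 (splitr kap) opprD; apply: lerD.
    by apply: le_trans h1; rewrite lerN2.
  by apply: le_trans h2; rewrite lerN2.
pose y := q - p.
have Hy : H10 Om y := sipB Hs Hq Hp'.
have Ey : y = w + z by rewrite /y /w /z addrA subrK.
have Ny : N y <= K.
  rewrite Ey; apply: le_trans (H1norm_triangle oOm bOm (H10_H1 Hw) (H10_H1 Hz)) _.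
  by rewrite /K -addrA; apply: lerD => //; exact: ltW.
have zz : H1dot Om z z = N z ^+ 2 by rewrite (H1norm_sqr oOm bOm (H10_H1 Hz)).
have zy : del ^+ 2 - kap <= H1dot Om z y.
  rewrite Ey (sipDr Hs Hw Hz Hz) zz [leRHS]addrC; apply: (lerD _ zw).
  have h := delP _ Cp.
  by rewrite ler_sqr ?nnegrE; [exact: h|exact: ltW|exact: N0].
have s01 : 0 <= s <= 1 by rewrite (ltW s0).
have := delP _ (Ccvx p q s Cp Cq s01); rewrite -/y opprD addrA -/z => dely.
have Hsy : H10 Om (s *: y) := sipZ Hs s Hy.
have : del ^+ 2 <= N (z - s *: y) ^+ 2 by rewrite ler_sqr ?nnegrE ?N0 ?(ltW del0).
rewrite (H1norm_sqr oOm bOm (H10_H1 (sipB Hs Hz Hsy))) (sip_sqrB Hs Hz Hsy).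
rewrite (sipZr Hs s Hy Hz) (sipZr Hs s Hy Hsy) (sipZl Hs s Hy Hy) zz.
rewrite -(H1norm_sqr oOm bOm (H10_H1 Hy)) -/N => Hfin.
have sK : s * K ^+ 2 = del ^+ 2 by rewrite /s mulfVK// expf_neq0// gt_eqF.
have NyK : N y ^+ 2 <= K ^+ 2 by rewrite ler_sqr ?nnegrE ?N0// ltW.
have d20 : 0 < s * del ^+ 2 by rewrite mulr_gt0// exprn_gt0.
exact: (near_minimizer_absurd d20 eta2 sK erefl (ltW s0) NyK zy Hp Hfin).
Qed.

Lemma L2norm_le_ae u v : L2 Om u -> L2 Om v -> {ae mu, forall x, Om x -> `|v x| <= `|u x|} ->
  L2norm Om v <= L2norm Om u.
Proof.
move=> Lu Lv uv; rewrite !L2normE !dotpE ler_wsqrtr// /Rintegral fine_le//.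
- exact/integrable_fin_num/L2_integrableM.
- exact/integrable_fin_num/L2_integrableM.
apply: ae_ge0_le_lower_integral.
- by move=> x _; rewrite lee_fin -expr2 sqr_ge0.
- by move=> x _; rewrite lee_fin -expr2 sqr_ge0.
apply: filterS uv => x H Omx.
by rewrite lee_fin -!expr2 -(real_normK (num_real (v x))) -(real_normK (num_real (u x)))
  ler_sqr ?nnegrE ?H.
Qed.

Lemma H1norm_smooth_pos (k : R) phi : 0 < k -> test phi ->
  H1norm Om (smooth_pos k \o phi) <= H1norm Om phi.
Proof.
move=> k0 tp; have tG : test (smooth_pos k \o phi).
  by apply: test_comp tp; [exact: smooth_smooth_pos|exact: smooth_pos0].
rewrite !H1norm_def ler_wsqrtr// lerD//.
  rewrite ler_sqr ?nnegrE ?L2norm_ge0//; apply: L2norm_le_ae; try exact: test_L2.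
  by apply: aeW => x _; exact: smooth_pos_norm.
apply: ler_sum => i _; rewrite ler_sqr ?nnegrE ?L2norm_ge0//.
apply: L2norm_le_ae; try by apply: weak_partial_L2 => //; exact: test_H1.
have E1 := weak_partial_test oOm bOm i tp; have E2 := weak_partial_test oOm bOm i tG.
apply: filterS2 E1 E2 => x H1x H2x Omx; rewrite (H1x Omx) (H2x Omx).
rewrite derive_comp_smooth; [|exact: smooth_smooth_pos|exact: test_smooth tp].
by rewrite normrM ler_piMl// derive_smooth_pos_norm.
Qed.

Definition nonneg_test : set ('rV[R]_d -> R) := [set phi | test phi /\ forall x, 0 <= phi x].

Lemma nonneg_test_H10 : nonneg_test `<=` H10 Om.
Proof. by move=> phi [tp _]; exact: test_H10. Qed.

Lemma nonneg_testD phi psi : nonneg_test phi -> nonneg_test psi -> nonneg_test (phi + psi).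
Proof.
move=> [tp p0] [tq q0]; split; first exact: testD.
by move=> x; rewrite (_ : (phi + psi) x = phi x + psi x)// addr_ge0.
Qed.

Lemma nonneg_testZ (t : R) phi : 0 <= t -> nonneg_test phi -> nonneg_test (t *: phi).
Proof.
move=> t0 [tp p0]; split; first exact: testZ.
by move=> x; rewrite (_ : (t *: phi) x = t * phi x)// mulr_ge0.
Qed.

(** Applying [smooth_pos k] to a test function near phi gives a nonnegative test function that is
    close to phi in L^2 and has controlled H^1 norm. Closeness in H^1 is not claimed for it;
    convexity of the cone supplies that through [H1_dense_of_L2_dense]. *)
Lemma nonneg_test_dense phi : H10 Om phi -> nonneg_on Om phi -> forall e : R, 0 < e ->
  exists2 psi, nonneg_test psi & H1norm Om (phi - psi) < e.
Proof.
move=> Hphi phi0; apply: (@H1_dense_of_L2_dense nonneg_test phi (H1norm Om phi + 1) nonneg_test_H10 _ Hphi).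
  move=> p q s Cp Cq /andP[s0 s1].
  have -> : p + s *: (q - p) = (1 - s) *: p + s *: q.
    by rewrite scalerBr scalerBl scale1r addrA addrAC.
  apply: nonneg_testD; first by apply: nonneg_testZ Cp; rewrite subr_ge0.
  exact: nonneg_testZ Cq.
move=> eta eta0.
have L1 : L2 Om (cst 1).
  apply: (L2_bounded mOm (lebesgue_Om_fin oOm bOm) (M := 1)) => //.
  by move=> x _; rewrite /= normr1.
(* The uniform error 1/k of [smooth_pos k] then has L^2 norm at most eta / 2. In the next minimum, 1
   serves the H^1 bound and eta / 2 the remaining L^2 error. *)
pose k := 2 * (L2norm Om (cst 1) + 1) / eta.
have k0 : 0 < k by rewrite divr_gt0// mulr_gt0// ltr_wpDl// L2norm_ge0.
have e2 : 0 < Num.min 1 (eta / 2) by rewrite lt_min ltr01 divr_gt0.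
have [psi tpsi] := H10_approx Hphi e2; rewrite lt_min => /andP[h1 h2].
have Hpsi := test_H10 oOm bOm tpsi.
have tG : test (smooth_pos k \o psi).
  by apply: test_comp tpsi; [exact: smooth_smooth_pos|exact: smooth_pos0].
exists (smooth_pos k \o psi); split.
- by split; [exact: tG|move=> x; exact: smooth_pos_ge0].
- apply: le_trans (H1norm_smooth_pos k0 tpsi) _.
  have -> : psi = phi - (phi - psi) by rewrite opprB addrC subrK.
  have Hd := sipB Hs Hphi Hpsi.
  apply: le_trans (H1norm_triangle oOm bOm (H10_H1 Hphi) (H10_H1 (sipN Hs Hd))) _.
  rewrite lerD2l -scaleN1r (H1normZ oOm bOm _ (H10_H1 Hd)) normrN1 mul1r; exact: ltW.
have sip := L2_sip mOm.
have Ld : L2 Om (phi - psi) := H10_L2 (sipB Hs Hphi Hpsi).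
pose g : 'rV[R]_d -> R := fun x => `|(phi - psi) x| + k^-1.
have Lg0 : L2 Om (fun x => `|(phi - psi) x|).
  apply: (L2_le mOm Ld); first by apply: measurableT_comp => //; exact: L2_measurable.
  by move=> x _; rewrite normr_id.
have Lg : L2 Om g.
  have := sipD sip Lg0 (sipZ sip k^-1 L1); congr L2; apply/funext => x.
  by rewrite /g -[in RHS](mulr1 k^-1).
have tGL := test_L2 oOm bOm tG; have Lphi := H10_L2 Hphi.
apply: (@le_lt_trans _ _ (L2norm Om g)).
  apply: L2norm_le_ae => //; first exact: (sipB sip).
  apply: filterS phi0 => x H Omx.
  have -> : (smooth_pos k \o psi - phi) x = smooth_pos k (psi x) - phi x by [].
  apply: le_trans (smooth_pos_approx _ k0 (H Omx)) _.
  have -> : `|g x| = `|(phi - psi) x| + k^-1.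
    by rewrite /g ger0_norm// addr_ge0// invr_ge0 ltW.
  have -> : (phi - psi) x = phi x - psi x by [].
  by rewrite distrC.
have -> : g = (fun x => `|(phi - psi) x|) + k^-1 *: cst 1.
  by apply/funext => x; rewrite /g -[in LHS](mulr1 k^-1).
rewrite L2normE; apply: le_lt_trans (sip_triangle sip Lg0 (sipZ sip k^-1 L1)) _.
rewrite (sip_normZ sip k^-1 L1) -!L2normE (ger0_norm (x := k^-1)) ?invr_ge0 ?(ltW k0)//.
have h3 : L2norm Om (fun x => `|(phi - psi) x|) < eta / 2.
  apply: le_lt_trans h2; apply: le_trans (L2norm_le_H1 _ _).
  by apply: L2norm_le_ae => //; apply: aeW => x _; rewrite normr_id.
rewrite (splitr eta); apply: ltr_leD h3 _.
rewrite /k invf_div mulrAC ler_pdivrMr; last by rewrite mulr_gt0// ltr_wpDl// L2norm_ge0.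
by rewrite mulrA divfK// ler_wpM2l ?(ltW eta0)// lerDl.
Qed.

End convex_density.

(** * Positive parts in L^2 *)

Section positive_part.
Context {R : realType} {d : nat} (Om : set 'rV[R]_d).
Hypotheses (oOm : open Om) (bOm : bounded_set Om).
Implicit Types (u v w phi : 'rV[R]_d -> R) (E : set 'rV[R]_d).
Local Notation mu := (lebesgue_rV d).
Let mOm : measurable Om. Proof. exact: open_measurable_rV. Qed.
Lemma L2_cst1 : L2 Om (cst 1).
Proof.
apply: (L2_bounded mOm (lebesgue_Om_fin oOm bOm) (M := 1)) => //.
by move=> x _; rewrite /= normr1.
Qed.

Lemma L2_integrable u : L2 Om u -> mu.-integrable Om (EFin \o u).
Proof.
move=> Lu; have := L2_integrableM mOm Lu L2_cst1.
by congr (_.-integrable _ _); apply/funext => x /=; rewrite mulr1.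
Qed.

Lemma nonneg_of_sets u : mu.-integrable Om (EFin \o u) ->
  (forall E, measurable E -> E `<=` Om -> (0 <= \int[mu]_(x in E) (u x)%:E)%E) -> nonneg_on Om u.
Proof.
move=> iu H; have mu_ : measurable_fun Om u by apply/measurable_EFinP; exact: measurable_int iu.
pose E : set 'rV[R]_d := Om `&` [set x | u x < 0].
have mE : measurable E.
  have := mu_ mOm _ (measurable_itv `]-oo, 0[%R).
  by rewrite set_itvE.
have EOm : E `<=` Om by move=> x [].
have muE : measurable_fun E (EFin \o u).
  by apply/measurable_EFinP; exact: measurable_funS mu_.
have I0 : (\int[mu]_(x in E) `|(u x)%:E| = 0)%E.
  have E1 : (\int[mu]_(x in E) (u x)%:E = - \int[mu]_(x in E) `|(u x)%:E|)%E.
    rewrite -integral_ge0N; last by move=> x _; exact: abse_ge0.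
    apply: eq_integral => x /set_mem[_ ux].
    by rewrite -[RHS]/((- `|u x|)%:E) ltr0_norm// opprK.
  apply/eqP; rewrite eq_le integral_ge0 ?andbT; last by move=> x _; exact: abse_ge0.
  by rewrite -oppe_ge0 -E1; exact: H.
have /ae_eq_integral_abs := I0 => /(_ mE muE); apply: filterS => x Hx Omx.
rewrite leNgt; apply/negP => ux; have [] := Hx (conj Omx ux).
by move/eqP; rewrite lt_eqF.
Qed.

Lemma ae_le_of_sets u v : mu.-integrable Om (EFin \o u) -> mu.-integrable Om (EFin \o v) ->
  (forall E, measurable E -> E `<=` Om ->
     (\int[mu]_(x in E) (u x)%:E <= \int[mu]_(x in E) (v x)%:E)%E) ->
  {ae mu, forall x, Om x -> u x <= v x}.
Proof.
move=> iu iv H.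
have : nonneg_on Om (v - u).
  apply: nonneg_of_sets; first exact: (integrableB mOm iv iu).
  move=> E mE EOm.
  have iuE := integrableS mOm mE EOm iu; have ivE := integrableS mOm mE EOm iv.
  rewrite (integralB_EFin mE ivE iuE) sube_ge0; first exact: H.
  by rewrite integrable_fin_num.
by apply: filterS => x Hx Omx; rewrite -subr_ge0; exact: Hx.
Qed.

(** The majorant v makes m finite on Om and absolutely continuous there, which is what the
    Radon-Nikodym theorem requires of the restriction of m; it also puts the density in L^2. *)
Lemma radon_nikodym_L2 (m : {measure set 'rV[R]_d -> \bar R}) v : L2 Om v -> nonneg_on Om v ->
  (forall E, measurable E -> E `<=` Om -> (m E <= \int[mu]_(x in E) (v x)%:E)%E) ->
  exists w, [/\ L2 Om w, forall x, 0 <= w x, {ae mu, forall x, Om x -> w x <= v x},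
    forall E, measurable E -> E `<=` Om -> m E = (\int[mu]_(x in E) (w x)%:E)%E &
    forall phi, test_function Om phi -> (forall x, 0 <= phi x) ->
      \int[m]_(x in Om) phi x = dotp Om w phi].
Proof.
move=> Lv v0 mv.
have iv := L2_integrable Lv.
have moo : (m Om < +oo)%E.
  by apply: le_lt_trans (mv _ mOm _) _ => //; rewrite ltey_eq integrable_fin_num.
pose nu : {finite_measure set 'rV[R]_d -> \bar R} := mfrestr mOm moo.
have nuE E : nu E = m (E `&` Om) by [].
have dom : nu `<< mu.
  apply/null_content_dominatesP => A mA A0; rewrite nuE.
  have mAO : measurable (A `&` Om) by exact: measurableI.
  apply/eqP; rewrite eq_le measure_ge0 andbT.
  apply: le_trans (mv _ mAO _) _ => //.
  rewrite null_set_integral//.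
    apply/measurable_EFinP; apply: (measurable_funS mOm) => //; exact: L2_measurable.
  by apply/eqP; rewrite eq_le measure_ge0 andbT -A0 le_measure ?inE.
pose g := Radon_Nikodym_SigmaFinite.f nu mu.
have g0 := Radon_Nikodym_SigmaFinite.f_ge0 dom; rewrite -/g in g0.
have gf := Radon_Nikodym_SigmaFinite.f_fin_num dom; rewrite -/g in gf.
have gi := Radon_Nikodym_SigmaFinite.f_integrable dom; rewrite -/g in gi.
pose w x := fine (g x).
have wg x : (w x)%:E = g x by rewrite fineK.
have w0 x : 0 <= w x by rewrite fine_ge0.
have mw : measurable_fun setT w.
  have /integrableP[mg _] := gi.
  by apply/measurable_EFinP; apply: eq_measurable_fun mg => x _ /=; rewrite wg.
have mwO : measurable_fun Om w by exact: measurable_funTS.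
have mE E : measurable E -> E `<=` Om -> m E = (\int[mu]_(x in E) (w x)%:E)%E.
  move=> mE EOm; rewrite -(setIidl EOm) -nuE (Radon_Nikodym_SigmaFinite.f_integral dom)//.
    by rewrite (setIidl EOm); apply: eq_integral => x _; rewrite wg.
have wv : {ae mu, forall x, Om x -> w x <= v x}.
  apply: ae_le_of_sets => //; last by move=> E mE' EOm; rewrite -mE//; exact: mv.
  apply: (@integrableS _ _ _ _ setT) => //.
  by apply: eq_integrable gi => // x _ /=; rewrite wg.
have Lw : L2 Om w.
  (* w <= v holds only almost everywhere; w' is dominated everywhere and agrees with w off a null
     set. *)
  pose w' x := Num.min (w x) `|v x|.
  have Lw' : L2 Om w'.
    apply: (L2_le mOm Lv).
      apply: measurable_minr => //; apply: measurableT_comp => //; exact: L2_measurable.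
    move=> x _; have h : 0 <= w' x by rewrite le_min w0 normr_ge0.
    by rewrite (ger0_norm h) ge_min lexx orbT.
  apply: (L2_ae_eq mOm Lw') => //; apply: filterS2 v0 wv => x h1 h2 Omx.
  by rewrite /w' (ger0_norm (h1 Omx)) min_l// h2.
exists w; split => // phi tp p0.
rewrite dotpE /Rintegral; apply: (congr1 fine).
rewrite (@eq_measure_integral _ _ _ Om nu); last by move=> A mA AO; rewrite -[in LHS](setIidl AO).
rewrite -(Radon_Nikodym_SigmaFinite.change_of_variables dom)//.
- by apply: eq_integral => x _; rewrite -/g -wg -EFinM mulrC.
- by apply/measurable_EFinP; apply: measurable_funTS; exact: measurable_test tp.
Qed.

Implicit Types l : ('rV[R]_d -> R) -> R.

Lemma pos_part_nonneg l w : pos_part_eq Om l w -> nonneg_on Om w.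
Proof.
move=> [Lw [m [_ mE]]]; apply: nonneg_of_sets; first exact: L2_integrable.
by move=> E mE' EOm; rewrite -mE.
Qed.

(** The negative measure only lowers l(phi). The positive one is known to have density w on sets;
    Radon-Nikodym with w as its own majorant transfers this to integrals of test functions. *)
Lemma pos_part_test_le l w phi : pos_part_eq Om l w -> nonneg_test Om phi -> l phi <= dotp Om w phi.
Proof.
move=> lw [tp p0]; have w0 := pos_part_nonneg lw; move: lw => [Lw [m [lm mE]]].
have mE' E : measurable E -> E `<=` Om -> (rpos m E <= \int[mu]_(x in E) (w x)%:E)%E.
  by move=> mE' EOm; rewrite mE.
have [w' [Lw' _ w'w w'E w'phi]] := radon_nikodym_L2 Lw w0 mE'.
have ww' : {ae mu, forall x, Om x -> w x <= w' x}.
  apply: ae_le_of_sets; try exact: L2_integrable.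
  by move=> E mE1 EOm; rewrite -w'E// mE.
have -> : dotp Om w phi = dotp Om w' phi.
  apply: dotp_ae_eq; last exact: aeW.
  by apply: filterS2 w'w ww' => x h1 h2 Omx; apply/eqP; rewrite eq_le h1//= h2.
rewrite lm// w'phi// gerDl oppr_le0.
by apply: Rintegral_ge0 => x _.
Qed.

Lemma rpos_le_density l (m : signed_radon Om) v : represents m l -> L2 Om v -> nonneg_on Om v ->
  (forall phi, nonneg_test Om phi -> l phi <= dotp Om v phi) ->
  forall E, measurable E -> E `<=` Om -> (rpos m E <= \int[mu]_(x in E) (v x)%:E)%E.
Proof.
move=> lm Lv v0 lv E mE EOm.
apply: (measure_le_density oOm bOm (@rpos_locfin _ _ _ m) (@rneg_locfin _ _ _ m) Lv _ (H := rhahn m)) => //.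
- by move=> phi tp p0; rewrite -lerBlDl -lm//; exact: lv.
- exact: rhahn_measurable.
- exact: rpos_hahn.
- exact: rneg_hahn.
Qed.

(** The two densities may come from different measures representing l. Minimality of the Hahn
    decomposition compares them: w' dominates l on nonnegative test functions, hence it dominates
    the positive measure that has density w. *)
Lemma pos_part_unique l w w' : pos_part_eq Om l w -> pos_part_eq Om l w' -> ae_eq mu Om w w'.
Proof.
have H v v' : pos_part_eq Om l v -> pos_part_eq Om l v' -> {ae mu, forall x, Om x -> v x <= v' x}.
  move=> lv lv'; have v0' := pos_part_nonneg lv'.
  have lv'' phi : nonneg_test Om phi -> l phi <= dotp Om v' phi by exact: pos_part_test_le.
  case: lv => Lv [m [lm mE]]; case: lv' => Lv' _.
  apply: ae_le_of_sets; try exact: L2_integrable.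
  by move=> E mE' EOm; rewrite -mE//; exact: (rpos_le_density lm).
move=> h h'; apply: filterS2 (H _ _ h h') (H _ _ h' h) => x h1 h2 Omx.
by apply/eqP; rewrite eq_le h1//= h2.
Qed.

Lemma pos_part_normE l w : pos_part_eq Om l w -> pos_part_norm Om l = (L2norm Om w)%:E.
Proof.
move=> lw; rewrite /pos_part_norm (_ : [set _ | _ in _] = [set (L2norm Om w)%:E]) ?ereal_inf1//.
apply/seteqP; split => [_ [w' lw' <-]|_ ->]; last by exists w.
by rewrite /= (L2norm_ae_eq (pos_part_unique lw' lw)).
Qed.

Lemma pos_part_exists l v : is_radon Om l -> L2 Om v -> nonneg_on Om v ->
  (forall phi, nonneg_test Om phi -> l phi <= dotp Om v phi) ->
  exists w, [/\ pos_part_eq Om l w, forall x, 0 <= w x & {ae mu, forall x, Om x -> w x <= v x}].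
Proof.
move=> [m lm] Lv v0 lv.
have [w [Lw w0 wv mE _]] := radon_nikodym_L2 Lv v0 (rpos_le_density lm Lv v0 lv).
by exists w; split => //; split => //; exists m.
Qed.

End positive_part.

Lemma extend_arith {R : realType} (A B' G W D nb nd C1 L N N2 e : R) :
  - A + G <= W -> - B' <= nb -> nb <= C1 * N -> D <= nd -> nd <= L * N2 -> L * N2 <= L * N ->
  (C1 + L) * N <= e -> - (A + B') + (G - W + D) <= e.
Proof. lra. Qed.

Lemma triangle_absurd {R : realType} (x p y K N del : R) : x <= y + p -> y <= K * N -> K * N < del ->
  p <= x - del -> False.
Proof. lra. Qed.

(** * The variational inequality, and lower semicontinuity of the energy *)

Section variational_inequality.
Context {R : realType} {d : nat} (Om : set 'rV[R]_d) (B : 'rV[R]_d -> 'M[R]_d) (b : 'rV[R]_d -> R).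
Hypotheses (oOm : open Om) (bOm : bounded_set Om) (csc : continuous_coercive_symmetric Om B b).
Implicit Types (u v w phi psi : 'rV[R]_d -> R).
Local Notation a := (Defs.form Om B b).
Let mOm : measurable Om. Proof. exact: open_measurable_rV. Qed.
Let sip := L2_sip mOm.
Let Hs := H10_sip oOm bOm.
Let As := form_sip oOm bOm csc.

(** Both sides are Lipschitz in phi for the H^1 norm and nonnegative test functions are dense in the
    cone; K is the Lipschitz constant of their difference, plus 1 to make it positive. *)
Lemma nonneg_test_extend u g w phi : H10 Om u -> L2 Om g -> L2 Om w ->
  (forall psi, nonneg_test Om psi -> - a u psi + dotp Om g psi <= dotp Om w psi) ->
  H10 Om phi -> nonneg_on Om phi -> - a u phi + dotp Om g phi <= dotp Om w phi.
Proof.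
move=> Hu Lg Lw H Hphi p0; apply/ler_addgt0Pr => e e0.
have [C C0 HC] := form_bound csc.
set K := C * H1norm Om u + L2norm Om (g - w) + 1.
have K1 : 0 <= C * H1norm Om u + L2norm Om (g - w) by rewrite addr_ge0 ?mulr_ge0 ?H1norm_ge0 ?L2norm_ge0.
have K0 : 0 < K by rewrite ltr_wpDl.
have [psi npsi Hpsi] := nonneg_test_dense oOm bOm Hphi p0 (divr_gt0 e0 K0).
have Hpsi' := nonneg_test_H10 oOm bOm npsi.
have Hd := sipB Hs Hphi Hpsi'.
have Lgw := sipB sip Lg Lw.
have E1 : a u phi = a u psi + a u (phi - psi) by rewrite (sipBr As Hphi Hpsi' Hu) addrC subrK.
have E2 : dotp Om g phi - dotp Om w phi = dotp Om g psi - dotp Om w psi + dotp Om (g - w) (phi - psi).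
  have Ld := H10_L2 Hd; have L1 := H10_L2 Hphi; have L2 := H10_L2 Hpsi'.
  by rewrite (sipBl sip Lg Lw Ld) (sipBr sip L1 L2 Lg) (sipBr sip L1 L2 Lw); ring.
have h1 := HC _ _ Hu Hd.
have h2 := sip_CS sip Lgw (H10_L2 Hd).
rewrite -!L2normE in h2.
have h3 : L2norm Om (phi - psi) <= H1norm Om (phi - psi) by exact: L2norm_le_H1.
have h4 := H _ npsi.
have h5 : (C * H1norm Om u + L2norm Om (g - w)) * H1norm Om (phi - psi) <= e.
  apply: le_trans (ler_wpM2l K1 (ltW Hpsi)) _.
  by rewrite mulrC -mulrA ler_piMr ?(ltW e0)// mulrC ler_pdivrMr// mul1r lerDl.
have h6 : L2norm Om (g - w) * L2norm Om (phi - psi) <= L2norm Om (g - w) * H1norm Om (phi - psi).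
  by apply: ler_wpM2l h3; exact: L2norm_ge0.
have := ler_norm (- a u (phi - psi)); rewrite normrN => h7.
have h8 := ler_norm (dotp Om (g - w) (phi - psi)).
rewrite E1 -lerBlDl -addrA.
rewrite E2; exact: extend_arith h4 h7 h1 h8 h2 h6 h5.
Qed.

Lemma obstacle_iff u g w : H10 Om u -> L2 Om g -> L2 Om w ->
  (forall phi, H10 Om phi -> nonneg_on Om phi -> - a u phi + dotp Om g phi <= dotp Om w phi) <->
  (forall z, H10 Om z -> nonneg_on Om (z - u) -> dotp Om w (u - z) + a u (u - z) <= dotp Om g (u - z)).
Proof.
move=> Hu Lg Lw.
have E phi : H10 Om phi ->
    (dotp Om w (- phi) + a u (- phi) <= dotp Om g (- phi)) =
    (- a u phi + dotp Om g phi <= dotp Om w phi).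
  move=> Hphi; have Lphi := H10_L2 Hphi.
  by rewrite (sipNr sip Lphi Lw) (sipNr As Hphi Hu) (sipNr sip Lphi Lg); apply/idP/idP; lra.
split=> [H z Hz zu|H phi Hphi p0].
  have Hd := sipB Hs Hz Hu.
  by rewrite -(opprB z u) E//; exact: H.
have Hz := sipD Hs Hphi Hu.
have E1 : phi = (phi + u) - u by rewrite addrK.
rewrite -E// [in dotp Om w _]E1 [in a u _]E1 [in dotp Om g _]E1 opprB.
by apply: (H _ Hz); rewrite addrK.
Qed.

Lemma form_norm_le_H1 : exists2 C, 0 < C & forall u, H10 Om u -> Num.sqrt (a u u) <= C * H1norm Om u.
Proof.
have [C C0 HC] := form_bound csc; exists (Num.sqrt (C + 1)); first by rewrite sqrtr_gt0 ltr_wpDl.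
move=> u Hu; have N0 := H1norm_ge0 Om u.
rewrite -{1}(ger0_norm N0) -sqrtr_sqr -sqrtrM ?ler_wsqrtr ?addr_ge0//.
apply: le_trans (ler_norm _) _; apply: le_trans (HC _ _ Hu Hu) _.
by rewrite -mulrA -expr2 ler_wpM2r ?sqr_ge0// lerDl.
Qed.

(** Otherwise v is an L^2 limit of points of a sublevel set of the energy norm. This set is convex,
    and bounded in H^1 by coercivity, so v is also an H^1 limit of its points, against the
    continuity of the norm. *)
Lemma form_norm_lsc v (del : R) : H10 Om v -> 0 < del -> exists2 eta : R, 0 < eta &
  forall q, H10 Om q -> L2norm Om (q - v) < eta -> Num.sqrt (a v v) - del <= Num.sqrt (a q q).
Proof.
move=> Hv d0; apply: contrapT => /forall2NP Hno.
pose C := [set q | H10 Om q /\ Num.sqrt (a q q) <= Num.sqrt (a v v) - del].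
have [c c0 coer] := form_coercive csc.
have [K K0 HK] := form_norm_le_H1.
have [p [Hp pv] pN] : exists2 p, C p & H1norm Om (v - p) < del / K.
  have CH : C `<=` H10 Om by move=> q [].
  have Ccvx p q s : C p -> C q -> 0 <= s <= 1 -> C (p + s *: (q - p)).
    move=> [Hp pv] [Hq qv] /andP[s0 s1].
    have -> : p + s *: (q - p) = (1 - s) *: p + s *: q.
      by rewrite scalerBr scalerBl scale1r addrA addrAC.
    have s1' : 0 <= 1 - s by rewrite subr_ge0.
    have H1 := sipZ Hs (1 - s) Hp; have H2 := sipZ Hs s Hq.
    refine (conj (sipD Hs H1 H2) _).
    apply: le_trans (sip_triangle As H1 H2) _.
    rewrite (sip_normZ As (1 - s) Hp) (sip_normZ As s Hq) (ger0_norm s0) (ger0_norm s1').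
    have := lerD (ler_wpM2l s1' pv) (ler_wpM2l s0 qv).
    by rewrite -mulrDl subrK mul1r.
  have Capp eta : 0 < eta ->
      exists q, [/\ C q, H1norm Om q <= Num.sqrt (a v v) / Num.sqrt c & L2norm Om (q - v) < eta].
    move=> eta0; have [/(_ eta0)//|/existsNP[q /not_implyP[Hq /not_implyP[qv /negP]]]] := Hno eta.
    rewrite -ltNge => qd; exists q.
    refine (And3 (conj Hq (ltW qd)) _ qv).
    rewrite ler_pdivlMr ?sqrtr_gt0// mulrC -(ger0_norm (H1norm_ge0 Om q)) -sqrtr_sqr -sqrtrM ?(ltW c0)//.
    apply: le_trans (ler_wsqrtr (coer _ Hq)) _; apply: le_trans (ltW qd) _.
    by rewrite gerBl ltW.
  exact: (H1_dense_of_L2_dense oOm bOm CH Ccvx Hv Capp (divr_gt0 d0 K0)).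
have := sip_triangleB As Hv Hp (sip0 Hs).
rewrite !subr0 => h1.
have h2 := HK _ (sipB Hs Hv Hp).
have h3 : K * H1norm Om (v - p) < del by rewrite mulrC -ltr_pdivlMr.
exact: triangle_absurd h1 h2 h3 pv.
Qed.

Lemma form_lsc v (e : R) : H10 Om v -> 0 < e -> exists2 eta : R, 0 < eta &
  forall q, H10 Om q -> L2norm Om (q - v) < eta -> a v v - e <= a q q.
Proof.
move=> Hv e0; have n0 : 0 <= Num.sqrt (a v v) := sqrtr_ge0 _.
(* With x and y < x the form norms of v and q, the difference x^2 - y^2 is at most (x - y)(2 x + 1),
   hence the tolerance e / (2 x + 1). *)
have c0 : 0 < 2 * Num.sqrt (a v v) + 1 by rewrite ltr_wpDl// mulr_ge0.
have [eta eta0 H] := form_norm_lsc Hv (divr_gt0 e0 c0).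
exists eta => // q Hq qv; have h := H q Hq qv.
have Ex := sip_norm_sqr As Hv; have Ey := sip_norm_sqr As Hq.
move: n0 c0 h Ex Ey (sqrtr_ge0 (a q q)).
move: (Num.sqrt (a v v)) (Num.sqrt (a q q)) => x y x0 c0 h <- <- y0.
have [xy|yx] := lerP x y.
  by rewrite lerBlDr -[leLHS]addr0 lerD ?(ltW e0)// ler_sqr.
have E : e = e / (2 * x + 1) * (2 * x + 1) by rewrite divfK// gt_eqF.
have k0 : 0 < e / (2 * x + 1) by rewrite divr_gt0.
rewrite lerBlDl E; move: (e / (2 * x + 1)) h k0 => k h k0.
have h1 : (x - y) * (x + y) <= k * (2 * x + 1).
  by apply: ler_pM; rewrite ?subr_ge0 ?addr_ge0//; lra.
lra.
Qed.

End variational_inequality.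

(** * Bochner measurable functions *)

Section ae_measurable.
Context {disp : measure_display} {T : measurableType disp} {R : realType}
  (mu : {measure set T -> \bar R}).
Implicit Types (D E : set T) (p q k : T -> R).

(** Bochner functions are controlled only off null sets, so the scalar functions derived from them
    are measurable only after a modification on such a set. *)
Definition ae_measurable D q := exists2 k, measurable_fun D k & ae_eq mu D q k.

Definition ae_integrable D q := exists2 k, mu.-integrable D (EFin \o k) & ae_eq mu D q k.

Lemma measurable_ae D q : measurable_fun D q -> ae_measurable D q.
Proof. by move=> mq; exists q => //; exact: aeW. Qed.

Lemma ae_measurable_cst D (c : R) : ae_measurable D (cst c).
Proof. by apply: measurable_ae; exact: measurable_cst. Qed.

Lemma ae_measurable_eq D p q : ae_eq mu D p q -> ae_measurable D q -> ae_measurable D p.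
Proof.
by move=> pq [k mk qk]; exists k => //; apply: filterS2 pq qk => x h1 h2 Dx; rewrite h1// h2.
Qed.

Lemma ae_measurable_comp D (G : R -> R) q : measurable_fun setT G ->
  ae_measurable D q -> ae_measurable D (G \o q).
Proof.
move=> mG [k mk qk]; exists (G \o k); first exact: measurableT_comp.
by apply: filterS qk => x h Dx /=; rewrite h.
Qed.

Lemma ae_measurableD D p q : ae_measurable D p -> ae_measurable D q -> ae_measurable D (p \+ q).
Proof.
move=> [k mk pk] [l ml ql]; exists (k \+ l); first exact: measurable_funD.
by apply: filterS2 pk ql => x h1 h2 Dx /=; rewrite h1// h2.
Qed.

Lemma ae_measurableB D p q : ae_measurable D p -> ae_measurable D q -> ae_measurable D (p \- q).
Proof.
move=> [k mk pk] [l ml ql]; exists (k \- l); first exact: measurable_funB.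
by apply: filterS2 pk ql => x h1 h2 Dx /=; rewrite h1// h2.
Qed.

Lemma ae_measurableM D p q : ae_measurable D p -> ae_measurable D q -> ae_measurable D (p \* q).
Proof.
move=> [k mk pk] [l ml ql]; exists (k \* l); first exact: measurable_funM.
by apply: filterS2 pk ql => x h1 h2 Dx /=; rewrite h1// h2.
Qed.

Lemma ae_measurableZ D (c : R) q : ae_measurable D q -> ae_measurable D (fun x => c * q x).
Proof. by move=> mq; apply: (ae_measurableM _ mq); exact: ae_measurable_cst. Qed.

Lemma ae_measurable_sub D E q : measurable D -> E `<=` D -> ae_measurable D q -> ae_measurable E q.
Proof.
move=> mD ED [k mk qk]; exists k; first exact: measurable_funS mk.
by apply: filterS qk => x h Ex; exact/h/ED.
Qed.

(** The upper limit of measurable representatives is measurable whether or not they converge, and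
    equals q almost everywhere. *)
Lemma ae_measurable_cvg D (qn : nat -> T -> R) q : (forall n, ae_measurable D (qn n)) ->
  {ae mu, forall x, D x -> qn n x @[n --> \oo] --> q x} -> ae_measurable D q.
Proof.
move=> /(_ _)/cid2-/all_sig2[k mk qk] qq.
exists (fun x => fine (limn_esup (fun n => (k n x)%:E))).
  apply: measurableT_comp => //.
  by apply: measurable_fun_limn_esup => n; exact/measurable_EFinP.
have : {ae mu, forall x, forall n, D x -> qn n x = k n x}.
  by apply/ae_foralln => n; exact: qk.
apply: filterS2 qq => x h1 h2 Dx.
have /cvg_limn_einf_sup[_ ->//] : (k n x)%:E @[n --> \oo] --> (q x)%:E.
apply: cvg_EFin; first exact: nearW.
by apply: cvg_trans (h1 Dx); apply: near_eq_cvg; apply: nearW => n /=; rewrite h2.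
Qed.

Lemma integrable_ae_integrable D q : mu.-integrable D (EFin \o q) -> ae_integrable D q.
Proof. by move=> iq; exists q => //; exact: aeW. Qed.

Lemma ae_integrable_measurable D q : ae_integrable D q -> ae_measurable D q.
Proof. by move=> [k /measurable_int/measurable_EFinP mk qk]; exists k. Qed.

Lemma ae_integrable_eq D p q : ae_eq mu D p q -> ae_integrable D q -> ae_integrable D p.
Proof.
by move=> pq [k mk qk]; exists k => //; apply: filterS2 pq qk => x h1 h2 Dx; rewrite h1// h2.
Qed.

Lemma Rintegral_ae_eq D p q : ae_eq mu D p q -> \int[mu]_(x in D) p x = \int[mu]_(x in D) q x.
Proof.
move=> pq; rewrite /Rintegral; apply: (congr1 fine); apply: ae_eq_lower_integral.
by apply: filterS pq => x h Dx /=; rewrite h.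
Qed.

Section measurable_domain.
Context D (mD : measurable D).

Lemma ae_integrableD p q : ae_integrable D p -> ae_integrable D q -> ae_integrable D (p \+ q).
Proof.
move=> [k ik pk] [l il ql]; exists (k \+ l); first exact: (integrableD mD ik il).
by apply: filterS2 pk ql => x h1 h2 Dx /=; rewrite h1// h2.
Qed.

Lemma ae_integrableZ (c : R) q : ae_integrable D q -> ae_integrable D (fun x => c * q x).
Proof.
move=> [k ik qk]; exists (fun x => c * k x); first exact: (integrableZl mD c ik).
by apply: filterS qk => x h Dx /=; rewrite h.
Qed.

Lemma ae_integrableB p q : ae_integrable D p -> ae_integrable D q -> ae_integrable D (p \- q).
Proof.
move=> [k ik pk] [l il ql]; exists (k \- l); first exact: (integrableB mD ik il).
by apply: filterS2 pk ql => x h1 h2 Dx /=; rewrite h1// h2.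
Qed.

Lemma ae_integrable_norm q : ae_integrable D q -> ae_integrable D (fun x => `|q x|).
Proof.
move=> [k ik qk]; exists (fun x => `|k x|).
  have := integrable_abse ik; congr (_.-integrable _ _).
by apply: filterS qk => x h Dx; rewrite h.
Qed.

Lemma ae_integrable_le p q : ae_measurable D q -> ae_integrable D p ->
  {ae mu, forall x, D x -> `|q x| <= p x} -> ae_integrable D q.
Proof.
move=> [k mk qk] [l il pl] qp.
have ml : measurable_fun D l by apply/measurable_EFinP; exact: measurable_int il.
(* Truncation makes the domination hold everywhere instead of almost everywhere. *)
pose k' x := if `|k x| <= l x then k x else 0.
exists k'; last first.
  by apply: filterS3 qk pl qp => x h1 h2 h3 Dx; rewrite /k' -h1// -h2// h3.
apply: (le_integrable mD _ _ il).
  apply/measurable_EFinP; apply: measurable_fun_if => //.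
  - apply: measurable_fun_ler => //; exact: measurableT_comp.
  - by apply: measurable_funS mk.
move=> x Dx /=; rewrite lee_fin /k'; case: ifPn => [h|_]; first exact: le_trans (ler_norm _).
by rewrite normr0.
Qed.

Lemma RintegralD_ae p q : ae_integrable D p -> ae_integrable D q ->
  \int[mu]_(x in D) (p x + q x) = \int[mu]_(x in D) p x + \int[mu]_(x in D) q x.
Proof.
move=> [k ik pk] [l il ql].
rewrite (Rintegral_ae_eq pk) (Rintegral_ae_eq ql) -(RintegralD mD ik il).
by apply: Rintegral_ae_eq; apply: filterS2 pk ql => x h1 h2 Dx; rewrite h1// h2.
Qed.

Lemma RintegralB_ae p q : ae_integrable D p -> ae_integrable D q ->
  \int[mu]_(x in D) (p x - q x) = \int[mu]_(x in D) p x - \int[mu]_(x in D) q x.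
Proof.
move=> [k ik pk] [l il ql].
rewrite (Rintegral_ae_eq pk) (Rintegral_ae_eq ql) -(RintegralB mD ik il).
by apply: Rintegral_ae_eq; apply: filterS2 pk ql => x h1 h2 Dx; rewrite h1// h2.
Qed.

Lemma RintegralZ_ae (c : R) q : ae_integrable D q ->
  \int[mu]_(x in D) (c * q x) = c * \int[mu]_(x in D) q x.
Proof.
move=> [k ik qk]; rewrite (Rintegral_ae_eq qk) -(RintegralZl _ mD ik).
by apply: Rintegral_ae_eq; apply: filterS qk => x h Dx; rewrite h.
Qed.

Lemma EFin_Rintegral_ae q : ae_integrable D q ->
  (\int[mu]_(x in D) q x)%:E = (\int[mu]_(x in D) (q x)%:E)%E.
Proof.
move=> [k ik qk]; rewrite (Rintegral_ae_eq qk) fineK ?integrable_fin_num//.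
by apply: ae_eq_lower_integral; apply: filterS qk => x h Dx; rewrite h.
Qed.

Lemma le_Rintegral_ae p q : ae_integrable D p -> ae_integrable D q ->
  {ae mu, forall x, D x -> p x <= q x} -> \int[mu]_(x in D) p x <= \int[mu]_(x in D) q x.
Proof.
move=> ip iq pq; rewrite -subr_ge0 -RintegralB_ae//.
rewrite (_ : \int[mu]_(x in D) (q x - p x) = \int[mu]_(x in D) `|q x - p x|); last first.
  by apply: Rintegral_ae_eq; apply: filterS pq => x h Dx; rewrite ger0_norm// subr_ge0 h.
exact: Rintegral_ge0.
Qed.

Lemma Rintegral_ge0_ae q : {ae mu, forall x, D x -> 0 <= q x} -> 0 <= \int[mu]_(x in D) q x.
Proof.
move=> q0; rewrite (_ : \int[mu]_(x in D) q x = \int[mu]_(x in D) `|q x|).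
  exact: Rintegral_ge0.
by apply: Rintegral_ae_eq; apply: filterS q0 => x h Dx; rewrite ger0_norm// h.
Qed.

Lemma le_normr_Rintegral_ae q : ae_integrable D q ->
  `|\int[mu]_(x in D) q x| <= \int[mu]_(x in D) `|q x|.
Proof.
move=> iq; have in_ := ae_integrable_norm iq; rewrite ler_norml; apply/andP; split.
  rewrite lerNl -mulN1r -RintegralZ_ae//; apply: le_Rintegral_ae => //.
    exact: ae_integrableZ.
  by apply: aeW => x _; rewrite mulN1r -normrN ler_norm.
by apply: le_Rintegral_ae => //; apply: aeW => x _; exact: ler_norm.
Qed.

Lemma ae_integrable_sub E q : measurable E -> E `<=` D -> ae_integrable D q -> ae_integrable E q.
Proof.
move=> mE ED [k ik qk]; exists k; first exact: integrableS ik.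
by apply: filterS qk => x h Ex; exact/h/ED.
Qed.

Lemma ae_integrable_cst (c : R) : (mu D < +oo)%E -> ae_integrable D (cst c).
Proof.
move=> Dfin; apply: integrable_ae_integrable; apply/integrableP; split; first exact/measurable_EFinP/measurable_cst.
rewrite (_ : (\int[mu]_(x in D) _)%E = \int[mu]_(x in D) (cst `|c|%:E x))%E//.
by rewrite integral_cst// lte_mul_pinfty.
Qed.

Lemma ae_integrable_fin q : ae_measurable D q -> {ae mu, forall x, D x -> 0 <= q x} ->
  (\int[mu]_(x in D) (q x)%:E < +oo)%E -> ae_integrable D q.
Proof.
move=> [k mk qk] q0 qfin; exists k => //; apply/integrableP; split; first exact/measurable_EFinP.
apply: le_lt_trans qfin; rewrite le_eqVlt; apply/orP; left; apply/eqP.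
by apply: ae_eq_lower_integral; apply: filterS2 q0 qk => x h1 h2 Dx /=; rewrite -h2// ger0_norm// h1.
Qed.

Lemma Rintegral_eq0_ae q : ae_integrable D q -> {ae mu, forall x, D x -> 0 <= q x} ->
  \int[mu]_(x in D) q x <= 0 -> {ae mu, forall x, D x -> q x = 0}.
Proof.
move=> iq q0 I0; have [k ik qk] := iq.
have mk : measurable_fun D (EFin \o k) := measurable_int _ ik.
have : (\int[mu]_(x in D) `|(k x)%:E| = 0)%E.
  have -> : (\int[mu]_(x in D) `|(k x)%:E| = \int[mu]_(x in D) (q x)%:E)%E.
    apply: ae_eq_lower_integral; apply: filterS2 q0 qk => x h1 h2 Dx /=.
    by rewrite -h2// ger0_norm// h1.
  rewrite -EFin_Rintegral_ae//; apply: congr1; apply/eqP.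
  by rewrite eq_le I0 Rintegral_ge0_ae.
move=> /ae_eq_integral_abs-/(_ mD mk); apply: filterS2 qk => x h1 h2 Dx.
by rewrite h1//; have [] := h2 Dx.
Qed.

End measurable_domain.

End ae_measurable.

#[global] Instance ae_filter_lebesgue (R : realType) :
  Filter (almost_everywhere (@lebesgue_measure R)).
Proof. exact: ae_filter_ringOfSetsType. Qed.

(** * Compositions and pairings of Bochner functions *)

Section strongly_measurable.
Context {R : realType} {V : lmodType R} (S : set V) (beta : V -> V -> R) (N : V -> R).
Context (H : semi_inner S beta) (NE : forall u, N u = Num.sqrt (beta u u)).
Context (I : set R).
Hypothesis mI : measurable (I : set (measurableTypeR R)).
Local Notation leb := lebesgue_measure.
Implicit Types (s : seq (set R * V)) (u v c : V) (g : R -> V) (t : R).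

Lemma simple_fun_cons (p : set R * V) s t :
  simple_fun (p :: s) t = (\1_(p.1) t : R) *: p.2 + simple_fun s t.
Proof. by rewrite /simple_fun big_cons. Qed.

Lemma simple_cons (p : set R * V) s : simple S (p :: s) ->
  [/\ measurable p.1, S p.2 & simple S s].
Proof.
move=> ps; have [mp Sp] := ps p (mem_head _ _); split => // q qs.
by apply: ps; rewrite inE qs orbT.
Qed.

Lemma simple_funS s t : simple S s -> S (simple_fun s t).
Proof.
elim: s => [_|p s IH /simple_cons[mp Sp /IH Ss]]; first by rewrite /simple_fun big_nil; exact: sip0 H.
by rewrite simple_fun_cons; apply: (sipD H) => //; exact: (sipZ H).
Qed.

(** The sets E_k may overlap, so a value is the sum over the sublist of those containing t. A simple
    function therefore takes values in a finite set, the source of separability in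
    [strongly_measurable_dense]. *)
Lemma simple_fun_mask s t : exists m : bitseq, simple_fun s t = \sum_(p <- mask m s) p.2.
Proof.
elim: s => [|p s [m IH]]; first by exists [::]; rewrite /simple_fun !big_nil.
exists ((t \in p.1) :: m); rewrite simple_fun_cons IH indicE /=.
by case: (t \in p.1); rewrite ?big_cons ?scale1r ?scale0r ?add0r.
Qed.

Lemma simple_maskS s m : simple S s -> S (\sum_(p <- mask m s) p.2).
Proof.
elim: s m => [|p s IH] [|b m] ss; rewrite ?mask0 /= ?big_nil; try exact: sip0 H.
have [_ Sp /IH Ss] := simple_cons ss.
case: b => /=; last exact: Ss.
by rewrite big_cons; apply: (sipD H) => //; exact: Ss.
Qed.

(** Q is not linear in its second argument, so the induction carries a vector c, the sum of the
    values already met, and branches on whether t lies in the next set. *)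
Lemma simple_comp_ae_measurable (Q : R -> V -> R) s c :
  (forall v, S v -> ae_measurable leb I (Q^~ v)) -> simple S s -> S c ->
  ae_measurable leb I (fun t => Q t (c + simple_fun s t)).
Proof.
move=> mQ; elim: s c => [|p s IH] c ss Sc.
  by rewrite /simple_fun; under eq_fun do rewrite big_nil addr0; exact: mQ.
have [mp Sp ss'] := simple_cons ss.
have m1 : ae_measurable leb I (\1_(p.1) : R -> R) by apply: measurable_ae; exact: measurable_indic.
have -> : (fun t => Q t (c + simple_fun (p :: s) t)) =
    (\1_(p.1) \* (fun t => Q t ((c + p.2) + simple_fun s t))) \+
    ((cst 1 \- \1_(p.1)) \* (fun t => Q t (c + simple_fun s t))).
  apply/funext => t /=; rewrite simple_fun_cons indicE.
  case: (t \in p.1); rewrite ?scale1r ?scale0r ?mul1r ?subrr ?mul0r ?addr0 ?addrA//.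
  by rewrite subr0 mul1r !add0r addr0.
apply: ae_measurableD; apply: ae_measurableM => //.
- by apply: IH => //; exact: (sipD H).
- by apply: ae_measurableB => //; exact: ae_measurable_cst.
- exact: IH.
Qed.

(** A Caratheodory argument: Q is measurable in t, sequentially continuous in v, and g is almost
    everywhere a limit of simple functions. *)
Lemma strongly_measurable_comp (Q : R -> V -> R) g : strongly_measurable S N I g ->
  (forall v, S v -> ae_measurable leb I (Q^~ v)) ->
  {ae leb, forall t, I t -> S (g t) -> forall v : nat -> V, (forall n, S (v n)) ->
     N (v n - g t) @[n --> \oo] --> (0 : R) -> Q t (v n) @[n --> \oo] --> Q t (g t)} ->
  ae_measurable leb I (fun t => Q t (g t)).
Proof.
move=> [Sg [s [ss sg]]] mQ Qc.
apply: (@ae_measurable_cvg _ _ _ leb I (fun n t => Q t (0 + simple_fun (s n) t))).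
  by move=> n; apply: simple_comp_ae_measurable => //; exact: sip0 H.
apply: filterS3 Sg sg Qc => t h1 h2 h3 It.
under eq_cvg do rewrite add0r.
apply: h3 => //; [exact: h1|by move=> n; exact: simple_funS|exact: h2].
Qed.

(** The values of all approximating simple functions are sums over sublists, hence countably many,
    and they come arbitrarily close to almost every value of g. *)
Lemma strongly_measurable_dense g : strongly_measurable S N I g ->
  exists c : nat -> V, (forall n, S (c n)) /\
    {ae leb, forall t, I t -> forall e : R, 0 < e -> exists n, N (c n - g t) < e}.
Proof.
move=> [Sg [s [ss sg]]].
pose c n := if unpickle n is Some (k, m) then \sum_(p <- mask m (s k)) p.2 else 0.
exists c; split=> [n|].
  by rewrite /c; case: unpickle => [[k m]|]; [exact: simple_maskS|exact: sip0 H].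
apply: filterS sg => t h It e e0.
have /cvgrPdist_lt/(_ e e0)[k _ /(_ k (leqnn k))] := h It.
rewrite /= sub0r normrN => kt.
have [m Em] := simple_fun_mask (s k) t.
exists (pickle (k, m)); rewrite /c pickleK -Em.
exact: le_lt_trans (ler_norm _) kt.
Qed.

Lemma simple_norm_sub_ae_measurable s g : simple S s -> strongly_measurable S N I g ->
  ae_measurable leb I (fun t => N (simple_fun s t - g t)).
Proof.
move=> ss mg.
apply: (@strongly_measurable_comp (fun t v => N (simple_fun s t - v))) => // [v Sv|].
  rewrite (_ : (fun t => _) = fun t => (fun=> fun x => N (x - v)) t (0 + simple_fun s t)).
    apply: (@simple_comp_ae_measurable (fun=> fun x => N (x - v)) s 0) => //; last exact: sip0 H.
    by move=> x Sx; exact: ae_measurable_cst.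
  by apply/funext => t; rewrite add0r.
apply: aeW => t It Sgt v Sv vg; have St := simple_funS t ss.
apply/cvgrPdist_le => e e0; have /cvgr0_norm_le/(_ e e0) := vg.
apply: filterS => n; apply: le_trans; rewrite distrC !NE.
have := sip_norm_dist H (sipB H St (Sv n)) (sipB H St Sgt).
have -> : simple_fun s t - v n - (simple_fun s t - g t) = g t - v n by rewrite opprB addrC subrKA.
move=> /le_trans; apply.
by rewrite (sip_norm_distC H Sgt (Sv n)); exact: ler_norm.
Qed.

Section bounded_form.
Context (gam : V -> V -> R) (Hgam : semi_inner S gam) (C : R).
Hypothesis gam_bound : forall u v, S u -> S v -> `|gam u v| <= C * N u * N v.

Lemma strongly_measurable_form g h : strongly_measurable S N I g ->
  {ae leb, forall t, I t -> S (h t)} ->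
  (forall v, S v -> ae_measurable leb I (fun t => gam v (h t))) ->
  ae_measurable leb I (fun t => gam (g t) (h t)).
Proof.
move=> mg Sh mh; apply: (@strongly_measurable_comp (fun t v => gam v (h t))) => //.
apply: filterS Sh => t Sht It Sgt v Sv vg; have Sh' := Sht It.
apply/cvgrPdist_le => e e0.
have cv : C * N (v n - g t) * N (h t) @[n --> \oo] --> C * 0 * N (h t).
  by apply: cvgM; [apply: cvgM => //; exact: cvg_cst|exact: cvg_cst].
rewrite mulr0 mul0r in cv; have /cvgr0_norm_le/(_ e e0) := cv.
apply: filterS => n; apply: le_trans; rewrite distrC -(sipBl Hgam (Sv n) Sgt Sh').
by apply: le_trans (gam_bound (sipB H (Sv n) Sgt) Sh') _; exact: ler_norm.
Qed.

Lemma strongly_measurable_form_cst g v : strongly_measurable S N I g -> S v ->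
  ae_measurable leb I (fun t => gam (g t) v).
Proof.
move=> mg Sv; apply: strongly_measurable_form => //; first exact: aeW.
by move=> w Sw; exact: ae_measurable_cst.
Qed.

Lemma strongly_measurable_form2 g h : strongly_measurable S N I g -> strongly_measurable S N I h ->
  ae_measurable leb I (fun t => gam (g t) (h t)).
Proof.
move=> mg mh; apply: strongly_measurable_form => //; first by case: mh.
move=> v Sv; apply: ae_measurable_eq (strongly_measurable_form_cst mh Sv).
by case: mh => Sh _; apply: filterS Sh => t Sht It; rewrite (sipC Hgam)//; exact: Sht.
Qed.

End bounded_form.

Section bochner_integral.
Hypothesis Ifin : (leb I < +oo)%E.

Lemma ae_integrable_indic (E : set R) : measurable E -> ae_integrable leb I (\1_E : R -> R).
Proof.
move=> mE; apply: (@ae_integrable_le _ _ _ leb I mI (cst 1)).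
- by apply: measurable_ae; exact: measurable_indic.
- exact: ae_integrable_cst.
- by apply: aeW => t _; rewrite indicE ger0_norm// lern1 leq_b1.
Qed.

Lemma simple_integral_pairing s v : simple S s -> S v ->
  [/\ S (simple_integral I s), ae_integrable leb I (fun t => beta (simple_fun s t) v) &
      beta (simple_integral I s) v = \int[leb]_(t in I) beta (simple_fun s t) v].
Proof.
move=> + Sv; elim: s => [_|p s IH /[dup] ps /simple_cons[mp Sp ss]].
  have z0 : beta 0 v = 0 by rewrite -(scale0r 0) (sipZl H)// ?mul0r//; exact: sip0 H.
  rewrite /simple_integral /simple_fun big_nil; split.
  - exact: sip0 H.
  - by under eq_fun do rewrite big_nil; exact: ae_integrable_cst.
  - rewrite z0; under eq_Rintegral do rewrite big_nil z0.
    by rewrite Rintegral_cst// mul0r.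
have [S1 i1 E1] := IH ss.
have iE := ae_integrable_indic mp.
have Epair t : beta (simple_fun (p :: s) t) v = beta p.2 v * \1_(p.1) t + beta (simple_fun s t) v.
  rewrite simple_fun_cons (sipDl H) ?(sipZl H)//; first by rewrite mulrC.
    exact: (sipZ H).
  exact: simple_funS.
have i2 := ae_integrableZ mI (beta p.2 v) iE.
rewrite /simple_integral big_cons -/(simple_integral I s); split.
- by apply: (sipD H) => //; exact: (sipZ H).
- by apply: ae_integrable_eq (ae_integrableD mI i2 i1); apply: aeW => t _; rewrite Epair.
- rewrite (sipDl H)//; last exact: (sipZ H).
  rewrite (sipZl H)// E1 (_ : \int[leb]_(t in I) beta (simple_fun (p :: s) t) v =
    \int[leb]_(t in I) (beta p.2 v * \1_(p.1) t + beta (simple_fun s t) v)); last first.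
    by apply: eq_Rintegral => t _; rewrite Epair.
  rewrite RintegralD_ae// RintegralZ_ae//; congr (_ + _).
  by rewrite mulrC; congr (_ * _); rewrite /Rintegral integral_indic.
Qed.

Lemma bochner_integral_pairing g w v : is_bochner_integral S N I g w -> S v ->
  ae_integrable leb I (fun t => beta (g t) v) /\
  beta w v = \int[leb]_(t in I) beta (g t) v.
Proof.
move=> [mg Sw [s [ss sg sw]]] Sv.
pose d n t := N (simple_fun (s n) t - g t).
have N0 x : 0 <= N x by rewrite NE sqrtr_ge0.
have mgv : ae_measurable leb I (fun t => beta (g t) v).
  apply: (strongly_measurable_form_cst H (C := 1)) => // x y Sx Sy.
  by rewrite mul1r !NE; exact: (sip_CS H Sx Sy).
have md n : ae_measurable leb I (d n) by exact: simple_norm_sub_ae_measurable.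
have [Sg _] := mg.
have dbound n : {ae leb, forall t, I t -> `|beta (simple_fun (s n) t) v - beta (g t) v| <= N v * d n t}.
  apply: filterS Sg => t Sgt It; have Sn := simple_funS t (ss n); have Sg' := Sgt It.
  by rewrite -(sipBl H)// mulrC /d !NE; apply: (sip_CS H) => //; exact: (sipB H).
have fd : \forall n \near \oo, ae_integrable leb I (d n).
  have := cvge0_lt sg ltr01; apply: filterS => n dn.
  apply: ae_integrable_fin => //; first by apply: aeW => t _; exact: N0.
  by apply: lt_le_trans dn _; rewrite leey.
have igv : ae_integrable leb I (fun t => beta (g t) v).
  have [n0 _ /(_ n0 (leqnn n0)) idn] := fd.
  have [_ i1 _] := simple_integral_pairing (ss n0) Sv.
  pose q t := beta (simple_fun (s n0) t) v - beta (g t) v.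
  have iq : ae_integrable leb I q.
    apply: (ae_integrable_le mI _ (ae_integrableZ mI (N v) idn)) (dbound n0).
    by apply: ae_measurableB mgv; exact: ae_integrable_measurable i1.
  apply: ae_integrable_eq (ae_integrableB mI i1 iq).
  by apply: aeW => t _; rewrite /q /= opprB addrC subrK.
split=> //.
apply/eqP; rewrite -subr_eq0 -normr_le0; apply/ler_addgt0Pr => e e0; rewrite add0r.
have K0 : 0 < 2 * (N v + 1) by rewrite mulr_gt0// ltr_wpDl.
have := cvge0_lt sg (divr_gt0 e0 K0); have /cvgr0_norm_lt/(_ _ (divr_gt0 e0 K0)) := sw.
move=> c1 c2; have [n [[h1 h2] h3]] := @filter_ex _ _ _ _ (filterI (filterI c1 c2) fd).
have [Sn i1 E1] := simple_integral_pairing (ss n) Sv.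
have hd : \int[leb]_(t in I) d n t < e / (2 * (N v + 1)).
  by rewrite -lte_fin EFin_Rintegral_ae.
have I0 : 0 <= \int[leb]_(t in I) d n t by apply: Rintegral_ge0 => t _; exact: N0.
have b1 : `|beta w v - beta (simple_integral I (s n)) v| <= N v * (e / (2 * (N v + 1))).
  rewrite distrC -(sipBl H)//; apply: le_trans (sip_CS H _ Sv) _; first exact: (sipB H).
  rewrite -!NE mulrC ler_wpM2l// ltW//; exact: le_lt_trans (ler_norm _) h1.
have b2 : `|beta (simple_integral I (s n)) v - \int[leb]_(t in I) beta (g t) v| <= N v * (e / (2 * (N v + 1))).
  rewrite E1 -RintegralB_ae//.
  have iq := ae_integrableB mI i1 igv.
  apply: le_trans (le_normr_Rintegral_ae mI iq) _.
  apply: (@le_trans _ _ (\int[leb]_(t in I) (N v * d n t))).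
    by apply: le_Rintegral_ae => //; [exact: ae_integrable_norm|exact: ae_integrableZ|exact: dbound].
  by rewrite RintegralZ_ae// ler_wpM2l// ltW.
have -> : beta w v - \int[leb]_(t in I) beta (g t) v =
  (beta w v - beta (simple_integral I (s n)) v) +
  (beta (simple_integral I (s n)) v - \int[leb]_(t in I) beta (g t) v) by rewrite addrA subrK.
apply: le_trans (ler_normD _ _) _; apply: le_trans (lerD b1 b2) _.
have N1 : 0 < N v + 1 by rewrite ltr_wpDl.
have -> : N v * (e / (2 * (N v + 1))) = e / 2 * (N v / (N v + 1)) by field; rewrite gt_eqF.
rewrite -mulrDl -splitr ler_piMr ?(ltW e0)//.
by rewrite ler_pdivrMr// mul1r lerDl.
Qed.

End bochner_integral.

End strongly_measurable.

(** * Evolutions *)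

Section interval_integrals.
Context {R : realType}.
Local Notation leb := (@lebesgue_measure R).
Implicit Types (a b c h t : R) (k q y z : R -> R).

Lemma lebesgue_itv_fin a b : (leb `]a, b[ < +oo)%E.
Proof. by rewrite lebesgue_measure_itv/=; case: ifP => // _; rewrite -EFinD ltry. Qed.

Lemma Rintegral_itv_cat a b c q : a <= b <= c -> ae_integrable leb `]a, c[ q ->
  \int[leb]_(t in `]a, c[) q t = \int[leb]_(t in `]a, b[) q t + \int[leb]_(t in `]b, c[) q t.
Proof.
move=> /andP[]; rewrite le_eqVlt => /predU1P[-> _ _|ab].
  by rewrite [in X in X + _]set_itv_ge ?bnd_simp ?ltxx// Rintegral_set0 add0r.
rewrite le_eqVlt => /predU1P[-> _|bc iq].
  by rewrite [in X in _ + X]set_itv_ge ?bnd_simp ?ltxx// Rintegral_set0 addr0.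
have [k ik qk] := iq.
have sub1 : `]a, b[%classic `<=` `]a, c[%classic.
  by apply: subset_itvl; rewrite bnd_simp ltW.
have sub2 : `]b, c[%classic `<=` `]a, c[%classic.
  by apply: subset_itvr; rewrite bnd_simp ltW.
have E1 : \int[leb]_(t in `]a, b[) q t = \int[leb]_(t in `]a, b[) k t.
  by apply: Rintegral_ae_eq; apply: filterS qk => t H Dt; exact/H/sub1.
have E2 : \int[leb]_(t in `]b, c[) q t = \int[leb]_(t in `]b, c[) k t.
  by apply: Rintegral_ae_eq; apply: filterS qk => t H Dt; exact/H/sub2.
rewrite E1 E2 (Rintegral_ae_eq qk).
rewrite -(Rintegral_itvB ik (x := b)) ?bnd_simp// ?(ltW ab)//.
rewrite (@Rintegral_itv_bndo_bndc _ (BRight a) b); last exact: (integrableS _ _ _ ik).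
by rewrite addrC subrK.
Qed.

Definition shiftR h : measurableTypeR R -> measurableTypeR R := +%R h.

Lemma measurable_shiftR h : measurable_fun setT (shiftR h).
Proof. by apply: measurable_funD => //; exact: measurable_cst. Qed.

HB.instance Definition _ h := isMeasurableFun.Build _ _ _ _ (shiftR h) (measurable_shiftR h).

(** Translation invariance, by uniqueness from the values on half-open intervals. *)
Lemma lebesgue_measure_shift h (A : set (measurableTypeR R)) : measurable A ->
  leb A = pushforward leb (shiftR h) A.
Proof.
move=> mA; apply: lebesgue_measure_unique => //= _ [[a b]] _ <-.
rewrite /pushforward (_ : _ @^-1` _ = `](a - h), (b - h)]%classic); last first.
  by apply/seteqP; split => t /=; rewrite !in_itv/= ltrBlDl lerBrDl.
rewrite !lebesgue_measure_itv/= !lte_fin ltrD2r.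
by case: ifP => // _; rewrite -!EFinD; congr EFin; ring.
Qed.

Lemma ae_shift h (P : R -> Prop) : {ae leb, forall t, P t} -> {ae leb, forall t, P (h + t)}.
Proof.
move=> [N [mN N0 PN]]; exists (shiftR h @^-1` N); split.
- by rewrite -[X in measurable X]setTI; exact: measurable_shiftR.
- by have := lebesgue_measure_shift h mN; rewrite N0 /pushforward => <-.
- by move=> t /= Pt; apply: PN.
Qed.

Lemma ae_integrable_shift h (D : set R) q : measurable (D : set (measurableTypeR R)) ->
  ae_integrable leb D q ->
  ae_integrable leb (shiftR h @^-1` D) (fun t => q (h + t)) /\
  \int[leb]_(t in shiftR h @^-1` D) q (h + t) = \int[leb]_(t in D) q t.
Proof.
move=> mD [k0 ik0 qk0].
pose k : R -> R := k0 \_ D.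
have ik : leb.-integrable D (EFin \o k).
  by apply: eq_integrable ik0 => // t tD; rewrite /k /= patchE tD.
have mk : measurable_fun setT (EFin \o k).
  apply/measurable_EFinP; apply/(measurable_restrictT _ mD).
  by apply/measurable_EFinP; exact: measurable_int ik0.
have qk : ae_eq leb D q k.
  by apply: filterS qk0 => t H Dt; rewrite /k patchE mem_set// H.
have qks : ae_eq leb (shiftR h @^-1` D) (fun t => q (h + t)) (fun t => k (h + t)).
  exact: (@ae_shift h (fun t => D t -> q t = k t)).
have mkc : measurable_fun setT (EFin \o (fun t : measurableTypeR R => k (h + t))).
  exact: (measurableT_comp mk (measurable_shiftR h)).
have Epf (f : measurableTypeR R -> \bar R) :
    (\int[pushforward leb (shiftR h)]_(t in D) f t = \int[leb]_(t in D) f t)%E.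
  by apply: eq_measure_integral => A mA _; exact/esym/lebesgue_measure_shift.
have iks : leb.-integrable (shiftR h @^-1` D) (EFin \o (fun t => k (h + t))).
  apply/integrableP; split; first exact: measurable_funTS.
  have /integrableP[_] := ik; congr (_ < _)%E.
  have := @ge0_integral_pushforward _ _ _ _ R (shiftR h) (measurable_shiftR h) leb D (fun t => `|(k t)%:E|%E) mD.
  rewrite -Epf => -> //.
    by apply: measurableT_comp => //; exact: measurable_funTS mk.
split; first by exists (fun t => k (h + t)).
rewrite (Rintegral_ae_eq qks) (Rintegral_ae_eq qk) /Rintegral; congr fine.
rewrite -(@integral_pushforward _ _ _ _ R (shiftR h) (measurable_shiftR h) leb D (EFin \o k) mk iks mD).
by rewrite Epf.
Qed.

Lemma ae_integrable_itv_shift a b h q : ae_integrable leb `](h + a), (h + b)[ q ->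
  ae_integrable leb `]a, b[ (fun t => q (h + t)) /\
  \int[leb]_(t in `]a, b[) q (h + t) = \int[leb]_(t in `](h + a), (h + b)[) q t.
Proof.
move=> /(ae_integrable_shift h (measurable_itv _)).
rewrite (_ : shiftR h @^-1` _ = `]a, b[%classic)//.
by apply/seteqP; split => t /=; rewrite !in_itv/= !ltrD2l.
Qed.

(** One-sided Lebesgue points: the difference quotients of the primitive of q, extended by 0,
    converge almost everywhere. *)
Lemma ae_average_cvg a b q : ae_integrable leb `]a, b[ q ->
  {ae leb, forall t, t \in `]a, b[ ->
    h^-1 * \int[leb]_(s in `]t, (t + h)[) q s @[h --> 0^'+] --> q t}.
Proof.
move=> [k ik qk]; pose g : R -> R := k \_ `]a, b[.
have mI : measurable (`]a, b[%classic : set (measurableTypeR R)) by exact: measurable_itv.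
have ig : leb.-integrable setT (EFin \o g).
  have := (integrable_mkcond (EFin \o k) mI).1 ik.
  by apply: eq_integrable => // t _; rewrite /g /= restrict_EFin.
have locg : locally_integrable setT g by exact: integrable_locally.
have igy (r : R) : leb.-integrable `]-oo, r] (EFin \o g) by exact: integrableS ig.
have := FTC1Ny igy locg; set F := fun r => _.
have qk0 := qk.
apply: filterS2 qk => t qk H tI; have [dF F'] := H.
have C : h^-1 *: (F (h + t) - F t) @[h --> (0 : R)^'+] --> q t.
  have -> : q t = 'D_1 F t.
    rewrite -derive1E F' qk; last exact: tI.
    by rewrite /g patchE mem_set.
  have dF' : h^-1 *: (F (h *: 1 + t) - F t) @[h --> (0 : R)^'] --> 'D_1 F t by exact: dF.
  have := cvg_dnbhs_at_right dF'; under eq_cvg do rewrite [_ *: 1]mulr1.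
  exact.
apply: cvg_trans C; apply: near_eq_cvg; near=> h.
rewrite /= /F; congr (_ * _).
have h0 : 0 < h by [].
have ltb : h + t < b.
  rewrite -ltrBrDr; near: h; apply: nbhs_right_lt; rewrite subr_gt0.
  by move: tI; rewrite in_itv/= => /andP[].
rewrite (Rintegral_itvB (igy (h + t)) (x := t)) ?bnd_simp//; last by rewrite lerDr ltW.
rewrite -Rintegral_itv_bndo_bndc; last exact: integrableS ig.
rewrite addrC; apply/esym/Rintegral_ae_eq; apply: filterS qk0 => s qs /=.
rewrite in_itv/= => /andP[ts sh].
have sI : `]a, b[%classic s.
  rewrite /= in_itv/= (lt_trans sh) ?(addrC t)// (lt_trans _ ts)//.
  by have := tI; rewrite in_itv/= => /andP[].
by rewrite (qs sI) /g patchE mem_set.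
Unshelve. all: by end_near. Qed.

Lemma Rintegral_derive a b (F : R -> R) : a < b -> smooth F ->
  ae_integrable leb `]a, b[ (fun t => 'D_1 F t) /\
  \int[leb]_(t in `]a, b[) 'D_1 F t = F b - F a.
Proof.
move=> ab sF; have cF : continuous (fun t : R => 'D_1 F t) by exact/smooth_continuous/smooth_derive.
have ic : leb.-integrable `[a, b] (EFin \o (fun t => 'D_1 F t)).
  apply: continuous_compact_integrable; first exact: segment_compact.
  exact: continuous_subspaceT.
have io : leb.-integrable `]a, b[ (EFin \o (fun t => 'D_1 F t)).
  by apply: (integrableS _ _ _ ic) => //; exact: subset_itv_oo_cc.
split; first exact: integrable_ae_integrable.
rewrite Rintegral_itv_bndo_bndc// Rintegral_itv_obnd_cbnd; last first.
  by apply: (integrableS _ _ _ ic) => //; exact: subset_itv_oc_cc.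
rewrite /Rintegral (@continuous_FTC2 _ _ F)//.
- exact: continuous_subspaceT.
- split; first by move=> x _; exact: smooth_derivable.
  + by apply: cvg_at_right_filter; exact: smooth_continuous.
  + by apply: cvg_at_left_filter; exact: smooth_continuous.
- by move=> x _; rewrite derive1E.
Qed.

(** It rises from 0 at c to 1 at c + 1/n, so its derivative approximates the Dirac mass at c. *)
Definition ramp (c n : R) (t : R) : R := smooth_step (n * t - n * c).

Lemma smooth_ramp c n : smooth (ramp c n).
Proof.
have := smooth_comp smooth_smooth_step (smooth_affine n (- (n * c))).
by [].
Qed.

Lemma ramp0 c n t : 0 < n -> t <= c -> ramp c n t = 0.
Proof. by move=> n0 tc; rewrite /ramp smooth_step0// subr_le0 ler_wpM2l// ltW. Qed.

Lemma ramp1 c n t : 0 < n -> c + n^-1 <= t -> ramp c n t = 1.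
Proof.
move=> n0 ct; rewrite /ramp smooth_step1// -mulrBr -(ler_pM2l (x := n^-1)) ?invr_gt0//.
by rewrite mulrA mulVf ?gt_eqF// mul1r mulr1 lerBrDl.
Qed.

Lemma ramp_near c t : \forall n \near \oo, ramp c n.+1%:R t = ((c < t)%R)%:R.
Proof.
have [ct|tc] := ltP c t; last by apply: nearW => n; rewrite ramp0.
have tc : 0 < t - c by rewrite subr_gt0.
near=> n; rewrite ramp1//= -lerBrDl ltW//.
by near: n; exact: near_infty_natSinv_lt (PosNum tc).
Unshelve. all: by end_near. Qed.

Lemma derive_ramp_bound : exists2 M, 0 <= M & forall c n t, 0 < n ->
  `|'D_1 (ramp c n) t| <= M * n /\ (t \notin `[c, c + n^-1] -> 'D_1 (ramp c n) t = 0).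
Proof.
have cS : continuous (fun t : R => 'D_1 smooth_step t).
  exact/smooth_continuous/smooth_derive/smooth_smooth_step.
have D0 (t : R) : ~ `[0, 1]%classic t -> 'D_1 smooth_step t = 0 :> R.
  move=> /= t01; have [t0|t0] := ltP t 0.
    apply: (derive_supported (K := [set x : R | 0 <= x])); first exact: closed_ge.
      by move=> x /= /negP; rewrite -ltNge => /ltW; exact: smooth_step0.
    by apply/negP; rewrite -ltNge.
  have t1 : 1 < t.
    by rewrite ltNge; apply/negP => t1; apply: t01; rewrite in_itv/= t0.
  (* Beyond 1 the step is constant but not 0; subtracting 1 makes it vanish there. *)
  have -> : 'D_1 smooth_step t = 'D_1 (smooth_step - cst 1) t.
    rewrite deriveB//; last exact: smooth_derivable smooth_smooth_step.
    by rewrite derive_cst subr0.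
  apply: (derive_supported (K := [set x : R | x <= 1])); first exact: closed_le.
    move=> x /= /negP; rewrite -ltNge => /ltW x1.
    by rewrite (_ : (smooth_step - cst 1) x = smooth_step x - 1)// smooth_step1// subrr.
  by apply/negP; rewrite -ltNge.
have [m _ mM] : exists2 m, m \in `[0, 1] & forall t, t \in `[0, 1] -> `|'D_1 (@smooth_step R) t| <= `|'D_1 smooth_step m|.
  apply: EVT_max => //; apply: continuous_subspaceT => x.
  exact: cvg_norm (cS x).
exists `|'D_1 smooth_step m|; first exact: normr_ge0.
move=> c n t n0; rewrite /ramp.
rewrite (derive_comp_smooth t 1 smooth_smooth_step (smooth_affine n (- (n * c)))).
rewrite (_ : 'D_1 _ t = n); last first.
  rewrite (_ : (fun _ => _) = n *: id + cst (- (n * c)))// deriveD// deriveZ// derive_id derive_cst addr0.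
  exact: mulr1.
have [t01|/negP t01] := boolP ((n * t - n * c) \in `[0, 1]).
  split; first by rewrite normrM (gtr0_norm n0) ler_wpM2r ?(ltW n0)// mM.
  move=> /negP[]; move: t01; rewrite -mulrBr !in_itv/= => /andP[h1 h2].
  rewrite -subr_ge0 -(pmulr_rge0 _ n0) h1/= -lerBlDl.
  by rewrite -(ler_pM2l n0) mulfV ?gt_eqF.
by rewrite D0// mul0r normr0 mulr_ge0// ltW.
Qed.

Variable T : R.
Local Notation I := (`]0, T[%classic : set R).

(** The derivative of the ramp has integral 1, lives on an interval of length 1/n and is at most M
    n, so averaging y against it misses y(c) by at most M times the oscillation. *)
Lemma ramp_average M : 0 <= M -> (forall c n t, 0 < n ->
    `|'D_1 (ramp c n) t| <= M * n /\ (t \notin `[c, c + n^-1] -> 'D_1 (ramp c n) t = 0)) ->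
  forall c n y (e : R), 0 <= e -> 0 < n -> 0 < c -> c + n^-1 < T -> ae_measurable leb I y ->
  (forall t, t \in `[c, c + n^-1] -> `|y t - y c| <= e) ->
  ae_integrable leb I (fun t => 'D_1 (ramp c n) t * y t) /\
  `|\int[leb]_(t in I) ('D_1 (ramp c n) t * y t) - y c| <= M * e.
Proof.
move=> M0 HM c n y e e0 n0 c0 cT my ye.
have mI : measurable (I : set (measurableTypeR R)) by exact: measurable_itv.
have Ifin := lebesgue_itv_fin 0 T.
have T0 : 0 < T by apply: lt_trans cT; rewrite addr_gt0 ?invr_gt0.
have [iD ED] := Rintegral_derive T0 (smooth_ramp c n).
have {}ED : \int[leb]_(t in I) 'D_1 (ramp c n) t = 1.
  by rewrite ED ramp1 ?(ltW cT)// ramp0 ?(ltW c0)// subr0.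
pose J : set (measurableTypeR R) := `[c, c + n^-1]%classic.
have mJ : measurable J by exact: measurable_itv.
have iJ := ae_integrable_indic mI Ifin mJ.
have iB := ae_integrableZ mI (M * n * e) iJ.
pose p t := 'D_1 (ramp c n) t * (y t - y c).
have mp : ae_measurable leb I p.
  apply: ae_measurableM; first exact: ae_integrable_measurable iD.
  by apply: ae_measurableB my _; exact: ae_measurable_cst.
have pB t : `|p t| <= M * n * e * \1_J t.
  have [h1 h2] := HM c n t n0; rewrite /p normrM indicE.
  have [tJ|tJ] := boolP (t \in `[c, c + n^-1]).
    rewrite mem_set// mulr1 ler_pM//; exact: ye.
  by rewrite h2// normr0 mul0r !mulr_ge0// ltW.
have ip : ae_integrable leb I p.
  by apply: (ae_integrable_le mI mp iB); apply: aeW => t _; exact: pB.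
have iyD := ae_integrableZ mI (y c) iD.
have E t : 'D_1 (ramp c n) t * y t = p t + y c * 'D_1 (ramp c n) t.
  by rewrite /p mulrBr (mulrC (y c)) subrK.
have i0 : ae_integrable leb I (fun t => 'D_1 (ramp c n) t * y t).
  by apply: ae_integrable_eq (ae_integrableD mI ip iyD); apply: aeW => t _ /=; rewrite E.
split => //.
rewrite (_ : \int[leb]_(t in I) _ = \int[leb]_(t in I) (p t + y c * 'D_1 (ramp c n) t)); last first.
  by apply: eq_Rintegral => t _; rewrite E.
rewrite RintegralD_ae// RintegralZ_ae// ED mulr1 addrK.
apply: le_trans (le_normr_Rintegral_ae mI ip) _.
apply: (@le_trans _ _ (\int[leb]_(t in I) (M * n * e * \1_J t))).
  by apply: le_Rintegral_ae => //; [exact: ae_integrable_norm|apply: aeW => t _; exact: pB].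
rewrite RintegralZ_ae// /Rintegral integral_indic//.
have h : (leb (J `&` I) <= (n^-1)%:E)%E.
  apply: (@le_trans _ _ (leb J)); first by rewrite le_measure ?inE//; exact: measurableI.
  by rewrite lebesgue_measure_itv/= lte_fin ltrDl invr_gt0 n0 -EFinD addrAC subrr add0r.
have fJ : leb (J `&` I) \is a fin_num by rewrite ge0_fin_numE// (le_lt_trans h)// ltry.
have h' : fine (leb (J `&` I)) <= n^-1 by rewrite -lee_fin fineK.
apply: le_trans (ler_wpM2l _ h') _; first by rewrite !mulr_ge0// ltW.
by rewrite mulrAC mulfK// gt_eqF.
Qed.

Lemma ramp_average_cvg c y : 0 < c -> c < T -> ae_measurable leb I y ->
  y t @[t --> c] --> y c ->
  (\forall n \near \oo, ae_integrable leb I (fun t => 'D_1 (ramp c n.+1%:R) t * y t)) /\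
  \int[leb]_(t in I) ('D_1 (ramp c n.+1%:R) t * y t) @[n --> \oo] --> y c.
Proof.
move=> c0 cT my yc; have [M M0 HM] := derive_ramp_bound.
have key (e : R) : 0 < e -> \forall n \near \oo,
    ae_integrable leb I (fun t => 'D_1 (ramp c n.+1%:R) t * y t) /\
    `|\int[leb]_(t in I) ('D_1 (ramp c n.+1%:R) t * y t) - y c| <= M * e.
  move=> e0; have /cvgrPdist_le/(_ e e0)/nbhs_ballP[del /= del0 Hdel] := yc.
  have Tc : 0 < T - c by rewrite subr_gt0.
  near=> n; have n0 : 0 < n.+1%:R :> R by rewrite ltr0n.
  have n1 : n.+1%:R^-1 < del by near: n; exact: near_infty_natSinv_lt (PosNum del0).
  have n2 : n.+1%:R^-1 < T - c by near: n; exact: near_infty_natSinv_lt (PosNum Tc).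
  apply: (ramp_average M0 HM (ltW e0) n0 c0 _ my); first by rewrite -ltrBrDl.
  move=> t; rewrite in_itv/= => /andP[ct tc]; rewrite distrC; apply: Hdel.
  rewrite /ball/= distrC ger0_norm ?subr_ge0// ltrBlDl.
  by apply: le_lt_trans tc _; rewrite ltrD2l.
split; first by have := key 1 ltr01; apply: filterS => n [].
have M1 : 0 < M + 1 by rewrite ltr_wpDl.
apply/cvgrPdist_le => e e0; have := key (e / (M + 1)) (divr_gt0 e0 M1).
apply: filterS => n [_ h]; rewrite distrC; apply: le_trans h _.
by rewrite mulrCA ler_piMr ?(ltW e0)// ler_pdivrMr// mul1r lerDl.
Unshelve. all: by end_near. Qed.

Lemma test_ramp a b n : 0 < a -> a < b -> 0 < n -> b + n^-1 < T ->
  test_function I (ramp a n - ramp b n).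
Proof.
move=> a0 ab n0 bT; split; first by apply: smoothB; exact: smooth_ramp.
exists `[a, b + n^-1]%classic; split; first exact: segment_compact.
  move=> t /=; rewrite !in_itv/= => /andP[h1 h2].
  by rewrite (lt_le_trans a0 h1) (le_lt_trans h2 bT).
move=> t /= /negP; rewrite in_itv/= negb_and -!ltNge => /orP[ta|tb].
  rewrite (_ : (ramp a n - ramp b n) t = ramp a n t - ramp b n t)//.
  by rewrite !ramp0 ?subr0// ltW// (lt_trans ta).
rewrite (_ : (ramp a n - ramp b n) t = ramp a n t - ramp b n t)//.
rewrite !ramp1 ?subrr// ltW//; apply: le_lt_trans tb.
by rewrite lerD2r ltW.
Qed.

(** Testing with the difference of two ramps, at a and at b: its derivative tends to the Dirac mass
    at a minus that at b, and the difference itself to the indicator of an interval. *)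
Lemma weak_derivative_ftc y z : ae_measurable leb I y -> ae_integrable leb I z ->
  (forall t, t \in `]0, T[ -> y s @[s --> t] --> y t) ->
  (forall psi : R -> R, test_function I psi ->
     \int[leb]_(t in I) ('D_1 psi t * y t) = - \int[leb]_(t in I) (psi t * z t)) ->
  forall a b, 0 < a -> a < b -> b < T -> y b - y a = \int[leb]_(t in `]a, b[) z t.
Proof.
move=> my iz cy H a b a0 ab bT.
have mI : measurable (I : set (measurableTypeR R)) by exact: measurable_itv.
have b0 := lt_trans a0 ab; have aT := lt_trans ab bT.
have aI : a \in `]0, T[ by rewrite in_itv/= a0.
have bI : b \in `]0, T[ by rewrite in_itv/= b0.
have [iA cA] := ramp_average_cvg a0 aT my (cy a aI).
have [iB cB] := ramp_average_cvg b0 bT my (cy b bI).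
have [k ik zk] := iz.
pose psi n : R -> R := ramp a n.+1%:R - ramp b n.+1%:R.
have c1 : \int[leb]_(t in I) ('D_1 (psi n) t * y t) @[n --> \oo] --> y a - y b.
  apply: cvg_trans (cvgB cA cB); apply: near_eq_cvg; apply: filterS2 iA iB => n iA iB.
  transitivity (\int[leb]_(t in I) ('D_1 (ramp a n.+1%:R) t * y t - 'D_1 (ramp b n.+1%:R) t * y t)).
    exact/esym/(RintegralB_ae mI iA iB).
  apply: eq_Rintegral => t _.
  by rewrite /psi deriveB ?mulrBl//; exact: smooth_derivable (smooth_ramp _ _).
have psiE n t : psi n t = ramp a n.+1%:R t - ramp b n.+1%:R t by [].
have psi1 n t : `|psi n t| <= 1.
  have ra c : 0 <= ramp c n.+1%:R t <= 1 by rewrite smooth_step_ge0 smooth_step_le1.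
  have /andP[a1 a2] := ra a; have /andP[b1 b2] := ra b.
  rewrite psiE ler_norml; apply/andP; split; lra.
have c2 : \int[leb]_(t in I) (psi n t * z t) @[n --> \oo] --> \int[leb]_(t in `]a, b[) z t.
  (* The ramp at b is still 0 at t = b, so the pointwise limit is the indicator of the half-open
     interval. *)
  pose J : set (measurableTypeR R) := `]a, b]%classic.
  have JI (t : R) : `]a, b]%classic t -> I t.
    by rewrite /= !in_itv/= => /andP[h1 h2]; rewrite (lt_trans a0 h1) (le_lt_trans h2 bT).
  have mk : measurable_fun I k by apply/measurable_EFinP; exact: measurable_int ik.
  have mpsi n : measurable_fun I (psi n).
    apply: measurable_funTS; apply: continuous_measurable_fun.
    by apply: smooth_continuous; apply: smoothB; exact: smooth_ramp.
  have mf n : measurable_fun I (fun t => (psi n t * k t)%:E).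
    by apply/measurable_EFinP; apply: measurable_funM.
  have mL : measurable_fun I (fun t => (\1_J t * k t)%:E).
    have mJ : measurable J by exact: measurable_itv.
    have m1 : measurable_fun I (\1_J : R -> R) by exact: measurable_indic.
    by apply/measurable_EFinP; exact: (measurable_funM m1 mk).
  have cvgL : {ae leb, forall t, I t -> (psi n t * k t)%:E @[n --> \oo] --> (\1_J t * k t)%:E}.
    apply: aeW => t It; apply: cvg_EFin; first exact: nearW.
    apply: cvgM; last exact: cvg_cst.
    have tJ (r : R) : (r \in J) = (a < r <= b).
      by apply/idP/idP => [/set_mem|h]; [rewrite /J /= in_itv|apply: mem_set; rewrite /J /= in_itv].
    apply: cvg_near_cst; apply: filterS2 (ramp_near a t) (ramp_near b t) => n ra rb.
    rewrite /= psiE indicE tJ ra rb leNgt.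
    by case: ltP => ta; case: ltP => tb; rewrite ?subrr ?subr0//; have := lt_le_trans ab (le_trans (ltW tb) ta); rewrite ltxx.
  have bnd : {ae leb, forall t n, I t -> (`|(psi n t * k t)%:E| <= `|(k t)%:E|)%E}.
    apply: aeW => t n It; rewrite /= lee_fin normrM ler_piMl//.
  have [iL _ cI] := dominated_convergence mI mf mL cvgL (integrable_abse ik) bnd.
  have EJ : \int[leb]_(t in I) (\1_J t * k t) = \int[leb]_(t in `]a, b[) z t.
    have JI' : `]a, b[%classic `<=` I.
      by move=> t /=; rewrite !in_itv/= => /andP[h1 h2]; rewrite (lt_trans a0 h1) (lt_trans h2 bT).
    rewrite [RHS](Rintegral_ae_eq (q := k)); last by apply: filterS zk => t h Jt; exact/h/JI'.
    rewrite (@Rintegral_itv_bndo_bndc _ (BRight a) b); last exact: (integrableS _ _ _ ik).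
    rewrite Rintegral_mkcond [RHS]Rintegral_mkcond; apply: eq_Rintegral => t _.
    rewrite !patchE indicE; case: (boolP (t \in J)) => tJ.
      by rewrite (mem_set (JI _ (set_mem tJ))) mul1r.
    by case: ifP; rewrite ?mul0r.
  rewrite -EJ; have fL : (\int[leb]_(t in I) (\1_J t * k t)%:E)%E \is a fin_num by exact: integrable_fin_num.
  have cI' : (fun n => \int[leb]_(t in I) (psi n t * k t)) @ \oo --> \int[leb]_(t in I) (\1_J t * k t).
    by apply: fine_cvg; rewrite fineK//; exact: cI.
  apply: cvg_trans cI'; apply: near_eq_cvg.
  apply: nearW => n; apply: Rintegral_ae_eq; apply: filterS zk => t zt It.
  by rewrite zt.
have c3 : \int[leb]_(t in I) ('D_1 (psi n) t * y t) @[n --> \oo] --> - \int[leb]_(t in `]a, b[) z t.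
  have Tb : 0 < T - b by rewrite subr_gt0.
  apply: cvg_trans (cvgN c2); apply: near_eq_cvg; near=> n.
  rewrite /= H//; apply: test_ramp => //.
  by rewrite -ltrBrDl; near: n; exact: near_infty_natSinv_lt (PosNum Tb).
have h : y a - y b = - \int[leb]_(t in `]a, b[) z t by apply: (cvg_unique _ c1 c3).
by rewrite -opprB h opprK.
Unshelve. all: by end_near. Qed.

End interval_integrals.

Lemma cross_sub {R : realType} (a b c d : R) : a + b = c + d -> d - a = b - c.
Proof. by move=> h; lra. Qed.

Section fatou.
Context {disp : measure_display} {T : measurableType disp} {R : realType}
  (mu : {measure set T -> \bar R}).
Implicit Types (D E : set T) (q f : T -> R).

Lemma Rintegral_restrict D E q : E `<=` D ->
  \int[mu]_(x in D) (q \_ E) x = \int[mu]_(x in E) q x.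
Proof.
move=> ED; rewrite Rintegral_mkcond [RHS]Rintegral_mkcond; apply: eq_Rintegral => x _.
rewrite !patchE; case: ifPn => // /negP xD; rewrite ifF//; apply/negP => /set_mem xE.
by apply: xD; apply: mem_set; exact: ED.
Qed.

Lemma ae_integrable_restrict D E q : measurable D -> measurable E -> E `<=` D ->
  ae_integrable mu E q -> ae_integrable mu D (q \_ E).
Proof.
move=> mD mE ED [k ik qk]; exists (k \_ E).
  have := (integrable_mkcond (EFin \o k) mE).1 ik => /(integrableS measurableT mD (@subsetT _ D)).
  by apply: eq_integrable => // x _; rewrite /= restrict_EFin.
by apply: filterS qk => x H Dx; rewrite !patchE; case: ifPn => // /set_mem; exact: H.
Qed.

(** Fatou's lemma for real integrals, with nonnegativity, measurability and convergence up to null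
    sets, in the form of an eventual lower bound. *)
Lemma fatou_near D (F : nat -> T -> R) f (e : R) : measurable D ->
  (forall n, ae_integrable mu D (F n)) -> (forall n, {ae mu, forall x, D x -> 0 <= F n x}) ->
  {ae mu, forall x, D x -> F n x @[n --> \oo] --> f x} -> ae_integrable mu D f -> 0 < e ->
  \forall n \near \oo, \int[mu]_(x in D) f x - e <= \int[mu]_(x in D) F n x.
Proof.
move=> mD iF F0 Ff if_ e0.
have /(_ _)/cid2-/all_sig2[k ik Fk] := iF.
pose k' n x : R := `|k n x|.
have mk' n : measurable_fun D (fun x => (k' n x)%:E).
  have /measurable_EFinP mk := measurable_int _ (ik n).
  by apply/measurable_EFinP; apply: measurableT_comp.
have Fk' n : ae_eq mu D (F n) (k' n).
  by apply: filterS2 (F0 n) (Fk n) => x h1 h2 Dx; rewrite /k' -h2// ger0_norm// h1.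
have k0 n x : D x -> (0 <= (k' n x)%:E)%E by move=> _; rewrite lee_fin normr_ge0.
have := fatou mu mD mk' k0.
have -> : (\int[mu]_(x in D) limn_einf (fun n => (k' n x)%:E) = \int[mu]_(x in D) (f x)%:E)%E.
  apply: ae_eq_lower_integral.
  have Fk2 : {ae mu, forall x, forall n, D x -> F n x = k' n x} by apply/ae_foralln => n; exact: Fk'.
  apply: filterS2 Ff Fk2 => x h1 h2 Dx.
  have : (k' n x)%:E @[n --> \oo] --> (f x)%:E.
    apply: cvg_EFin; first exact: nearW.
    by apply: cvg_trans (h1 Dx); apply: near_eq_cvg; apply: nearW => n /=; rewrite h2.
  by move=> /cvg_limn_einf_sup[].
rewrite -EFin_Rintegral_ae// limn_einf_lim => H.
have cs := @cvg_einfs_sup _ (fun n => (\int[mu]_(x in D) (k' n x)%:E)%E).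
rewrite (cvg_lim _ cs)// in H.
have : ((\int[mu]_(x in D) f x - e)%:E < ereal_sup (range (einfs (fun n => (\int[mu]_(x in D) (k' n x)%:E)%E))))%E.
  by apply: lt_le_trans H; rewrite lte_fin ltrBlDr ltrDl.
move=> /ereal_sup_gt[_ [m _ <-] hm]; exists m => // n /= mn.
have ik' : ae_integrable mu D (k' n).
  by apply: ae_integrable_eq (iF n); apply: filterS (Fk' n) => x h Dx; rewrite h.
rewrite -lee_fin (Rintegral_ae_eq (Fk' n)) (EFin_Rintegral_ae mD ik').
apply: le_trans (ltW hm) _; apply: ereal_inf_lbound => /=; exists n => //.
Qed.

End fatou.

Lemma liminf_arith {R : realType} (a b c a' b' c' e : R) : a' <= a -> c' <= c ->
  a + 2 * b + c - 2 * e <= a' + 2 * b' + c' -> b - e <= b'.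
Proof. lra. Qed.

Lemma cvg_shiftR {R : realType} (y : R -> R) (h t l : R) :
  y s @[s --> h + t] --> l -> y (h + s) @[s --> t] --> l.
Proof.
move=> yl; apply: cvg_comp yl; apply: cvgD; first exact: cvg_cst.
exact: cvg_id.
Qed.

(** * Difference quotients of an evolution *)

Section evolutions.
Context {R : realType} {d : nat} (Om : set 'rV[R]_d) (T : R).
Hypotheses (oOm : open Om) (bOm : bounded_set Om) (T0 : 0 < T).
Local Notation leb := (@lebesgue_measure R).
Local Notation I := (`]0, T[%classic : set R).
Local Notation N := (L2norm Om).
Local Notation dot := (dotp Om).
Local Notation V := ('rV[R]_d -> R).
Let mOm : measurable Om. Proof. exact: open_measurable_rV. Qed.
Let sip := L2_sip mOm.
Let mI : measurable (I : set (measurableTypeR R)). Proof. exact: measurable_itv. Qed.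
Let NE (u : V) : N u = Num.sqrt (dot u u). Proof. exact: L2normE. Qed.
Implicit Types (g k u du : R -> V) (h : R) (v c : V).

Lemma L2_CS v c : L2 Om v -> L2 Om c -> `|dot v c| <= N v * N c.
Proof. by move=> Lv Lc; rewrite !NE; exact: (sip_CS sip Lv Lc). Qed.

Lemma L2_CS1 v c : L2 Om v -> L2 Om c -> `|dot v c| <= 1 * N v * N c.
Proof. by rewrite mul1r; exact: L2_CS. Qed.

Lemma L2norm_triangleB v c w : L2 Om v -> L2 Om c -> L2 Om w -> N (v - w) <= N (v - c) + N (c - w).
Proof. by move=> Lv Lc Lw; rewrite !NE; exact: (sip_triangleB sip Lv Lc Lw). Qed.

Lemma L2norm_distC v c : L2 Om v -> L2 Om c -> N (v - c) = N (c - v).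
Proof. by move=> Lv Lc; rewrite !NE; exact: (sip_norm_distC sip Lv Lc). Qed.

Lemma strongly_measurable_sub (S : set V) (n : V -> R) (J K : set R) g : J `<=` K ->
  strongly_measurable S n K g -> strongly_measurable S n J g.
Proof.
move=> JK [Sg [s [ss sg]]]; split; first by apply: filterS Sg => t H Jt; exact/H/JK.
by exists s; split => //; apply: filterS sg => t H Jt; exact/H/JK.
Qed.

Lemma L2_0T_L2_measurable g : L2_0T_L2 Om T g -> strongly_measurable (L2 Om) N I g.
Proof. by case. Qed.

Lemma strongly_measurable_dotp g k : strongly_measurable (L2 Om) N I g ->
  strongly_measurable (L2 Om) N I k -> ae_measurable leb I (fun t => dot (g t) (k t)).
Proof. exact: (strongly_measurable_form2 sip sip L2_CS1). Qed.

Lemma L2_0T_L2_integrable g : L2_0T_L2 Om T g -> ae_integrable leb I (fun t => dot (g t) (g t)).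
Proof.
move=> [mg gfin]; apply: ae_integrable_fin => //; first exact: strongly_measurable_dotp.
  by apply: aeW => t _; rewrite -L2norm_sqr ?sqr_ge0.
move: gfin; rewrite unlock.
rewrite (_ : (\int[leb]_x _)%E = (\int[leb]_(t in I) (dot (g t) (g t))%:E)%E).
  by apply: contraPP => /negP; rewrite -leNgt leye_eq => /eqP ->; rewrite poweRyr// ltxx.
rewrite [RHS]integral_mkcond; apply: eq_integral => t _.
rewrite /= !patchE; case: ifP => _; last by rewrite normr0 powR0// pnatr_eq0.
by rewrite powR_mulrn// real_normK ?num_real// L2norm_sqr.
Qed.

Lemma ae_integrable_dotp (J : set R) g k : measurable (J : set (measurableTypeR R)) ->
  {ae leb, forall t, J t -> L2 Om (g t)} -> {ae leb, forall t, J t -> L2 Om (k t)} ->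
  ae_measurable leb J (fun t => dot (g t) (k t)) ->
  ae_integrable leb J (fun t => dot (g t) (g t)) -> ae_integrable leb J (fun t => dot (k t) (k t)) ->
  ae_integrable leb J (fun t => dot (g t) (k t)).
Proof.
move=> mJ Lg Lk mgk ig ik; apply: (ae_integrable_le mJ mgk (ae_integrableD mJ ig ik)).
apply: filterS2 Lg Lk => t Lg Lk Jt; apply: le_trans (L2_CS (Lg Jt) (Lk Jt)) _ => /=.
rewrite -!(L2norm_sqr Om); have := sqr_ge0 (N (g t) - N (k t)); rewrite sqrrB.
have := L2norm_ge0 Om (g t); have := L2norm_ge0 Om (k t).
move: (N (g t)) (N (k t)) => x y x0 y0; nra.
Qed.

Lemma Rintegral_itv_cst (a b c : R) : a <= b -> \int[leb]_(t in `]a, b[) cst c t = (b - a) * c.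
Proof.
move=> ab; rewrite Rintegral_cst//.
have -> : fine (leb `]a, b[) = b - a; last by rewrite mulrC.
rewrite lebesgue_measure_itv/= lte_fin; case: ltP => // ba.
by apply/esym/eqP; rewrite subr_eq0 eq_le ba ab.
Qed.

Lemma primitive_continuous q : ae_integrable leb I q ->
  {within `[0, T], continuous (fun x => \int[leb]_(t in `]0, x[) q t)}.
Proof.
move=> [k ik qk]; pose k0 : R -> R := k \_ I.
have ik0 : leb.-integrable setT (EFin \o k0).
  have := (integrable_mkcond (EFin \o k) mI).1 ik.
  by apply: eq_integrable => // t _; rewrite /k0 /= restrict_EFin.
have ik1 : leb.-integrable `[0, T] (EFin \o k0) by exact: (integrableS _ _ _ ik0).
apply: (subspace_eq_continuous _ (parameterized_integral_continuous (ltW T0) ik1)).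
move=> x /set_mem xT; rewrite /from_subspace/=.
have [x0 xT'] : 0 <= x /\ x <= T by move: xT; rewrite /= in_itv/= => /andP[].
rewrite /parameterized_integral -Rintegral_itv_obnd_cbnd; last exact: (integrableS _ _ _ ik0).
rewrite -Rintegral_itv_bndo_bndc; last exact: (integrableS _ _ _ ik0).
apply/esym; apply: Rintegral_ae_eq; apply: filterS qk => t H tx.
have It : I t by move: tx; rewrite /= !in_itv/= => /andP[-> h]; rewrite (lt_le_trans h xT').
by rewrite H// /k0 patchE mem_set.
Qed.

Lemma primitive_measurable q : ae_integrable leb I q ->
  ae_measurable leb I (fun x => \int[leb]_(t in `]0, x[) q t).
Proof.
move=> /primitive_continuous cK; apply: measurable_ae.
apply: (measurable_funS (measurable_itv `[0, T])).
  exact: subset_itv_oo_cc.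
by apply: subspace_continuous_measurable_fun => //; exact: measurable_itv.
Qed.

Lemma primitive_near_T q (e : R) : ae_integrable leb I q -> 0 < e ->
  exists2 del : R, 0 < del & forall x, 0 <= x <= T -> T - del < x ->
    `|\int[leb]_(t in `]0, x[) q t - \int[leb]_(t in I) q t| <= e.
Proof.
move=> /primitive_continuous cK e0.
have TT : `[0, T]%classic T by rewrite /= in_itv/= lexx andbT ltW.
have := (continuous_within_itvP _ T0).1 cK => -[_ _ /cvgrPdist_le/(_ e e0)].
rewrite /at_left near_withinE => /nbhs_ballP[del /= del0 H]; exists del => // x /andP[x0].
rewrite le_eqVlt => /predU1P[-> _|xT xd]; first by rewrite subrr normr0 ltW.
rewrite distrC; apply: H => //; rewrite /ball/= ger0_norm ?subr_ge0 ?(ltW xT)//.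
by rewrite ltrBlDr -ltrBlDl.
Qed.

Section increments.
Variables (u du : R -> V).
Hypothesis ev : evolution Om T u du.

Lemma evolution_L2 t : t \in `[0, T] -> L2 Om (u t).
Proof. by case: ev => _ _ _ _ H /H[]. Qed.

Lemma evolution_L2_oo t : I t -> L2 Om (u t).
Proof. by move=> It; apply: evolution_L2; exact: subset_itv_oo_cc It. Qed.

Lemma evolution_continuous t : I t -> N (u s - u t) @[s --> t] --> (0 : R).
Proof.
move=> It; have tI : t \in `[0, T] by exact: subset_itv_oo_cc It.
case: ev => _ _ _ _ /(_ t tI)[_] /cvgrPdist_le H; apply/cvgrPdist_le => e e0.
have := H e e0; rewrite near_withinE.
have nI : \forall s \near t, s \in `]0, T[ by exact: near_in_itvoo.
by apply: filterS2 nI => s sI; apply; exact: subset_itv_oo_cc sI.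
Qed.

Lemma evolution_measurable : strongly_measurable (L2 Om) N I u.
Proof. by case: ev => _ /L2_0T_L2_measurable. Qed.

Lemma derivative_measurable : strongly_measurable (L2 Om) N I du.
Proof. by case: ev => _ _ /L2_0T_L2_measurable. Qed.

Lemma derivative_integrable : ae_integrable leb I (fun t => dot (du t) (du t)).
Proof. by case: ev => _ _ /L2_0T_L2_integrable. Qed.

Lemma derivative_L2 : {ae leb, forall t, I t -> L2 Om (du t)}.
Proof. by case: derivative_measurable. Qed.

Lemma pairing_integrable v : L2 Om v -> ae_integrable leb I (fun t => dot (du t) v).
Proof.
move=> Lv; apply: ae_integrable_dotp => //; first exact: derivative_L2.
- exact: aeW.
- exact: (strongly_measurable_form_cst sip sip L2_CS1 derivative_measurable Lv).
- exact: derivative_integrable.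
- by apply: ae_integrable_cst => //; exact: lebesgue_itv_fin.
Qed.

Lemma evolution_pairing v a b : L2 Om v -> 0 < a -> a < b -> b < T ->
  dot (u b - u a) v = \int[leb]_(t in `]a, b[) dot (du t) v.
Proof.
move=> Lv a0 ab bT.
have aI : I a by rewrite /= in_itv/= a0 (lt_trans ab).
have bI : I b by rewrite /= in_itv/= bT (lt_trans a0).
rewrite (sipBl sip (evolution_L2_oo bI) (evolution_L2_oo aI) Lv).
apply: (@weak_derivative_ftc _ T (fun t => dot (u t) v)) => //.
- exact: (strongly_measurable_form_cst sip sip L2_CS1 evolution_measurable Lv).
- exact: pairing_integrable.
- move=> t It; apply/cvgrPdist_le => e e0.
  have c0 : N (u s - u t) * N v @[s --> t] --> (0 : R).
    by rewrite -[X in _ --> X](mul0r (N v)); apply: cvgM; [exact: evolution_continuous|exact: cvg_cst].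
  have /cvgr0_norm_le/(_ e e0) := c0.
  have nI : \forall s \near t, I s.
    by apply: near_in_itvoo.
  move=> h; apply: filterS2 nI h => s Is; apply: le_trans.
  rewrite distrC -(sipBl sip (evolution_L2_oo Is) (evolution_L2_oo It) Lv).
  apply: le_trans (L2_CS (sipB sip (evolution_L2_oo Is) (evolution_L2_oo It)) Lv) _.
  exact: ler_norm.
- move=> psi tpsi; case: ev => _ _ _ /(_ psi tpsi)[w [b1 b2]] _.
  have Ifin := lebesgue_itv_fin 0 T.
  have [_ E1] := bochner_integral_pairing sip NE mI Ifin b1 Lv.
  have [_ E2] := bochner_integral_pairing sip NE mI Ifin b2 Lv.
  have Lw : L2 Om w by case: b1.
  rewrite (sipNl sip Lw Lv) E1 in E2.
  transitivity (\int[leb]_(t in I) dot ('D_1 psi t *: u t) v).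
    apply: eq_Rintegral => t /set_mem It.
    by rewrite (sipZl sip _ (evolution_L2_oo It) Lv).
  rewrite -[LHS]opprK E2; congr (- _); apply: Rintegral_ae_eq.
  by apply: filterS derivative_L2 => t Lt It; rewrite (sipZl sip _ (Lt It) Lv).
Qed.

Lemma norm_sub_integrable c : L2 Om c -> ae_integrable leb I (fun t => N (du t - c)).
Proof.
move=> Lc; have mN : ae_measurable leb I (fun t => N (du t - c)).
  have := @simple_norm_sub_ae_measurable _ _ _ _ _ sip NE I [:: (setT, c)] du _ derivative_measurable.
  have sc : simple (L2 Om) [:: ([set: R], c)].
    by move=> p; rewrite inE => /eqP ->; split => //; exact: measurableT.
  move=> /(_ sc); apply: ae_measurable_eq; apply: filterS derivative_L2 => t Lt It.
  rewrite /simple_fun big_seq1 /= indicE mem_set// scale1r.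
  exact: L2norm_distC (Lt It) Lc.
have i1 := ae_integrableD mI derivative_integrable (ae_integrable_cst mI (1 + N c) (lebesgue_itv_fin 0 T)).
apply: (ae_integrable_le mI mN i1); apply: filterS derivative_L2 => t Lt It /=.
rewrite ger0_norm ?L2norm_ge0//; have := L2norm_triangleB (Lt It) (sip0 sip) Lc.
rewrite subr0 -(L2norm_sqr Om) sub0r.
have := sip_normN sip Lc; rewrite -!NE => ->.
by have := L2norm_ge0 Om (du t); move: (N (du t)) (N c) (N (du t - c)) => x y z; nra.
Qed.

(** The vector v whose norm is estimated is itself the test vector in the pairing, and
    Cauchy-Schwarz under the integral leaves one factor N v to divide by. *)
Lemma increment_le c a b : L2 Om c -> 0 < a -> a < b -> b < T ->
  N (u b - u a - (b - a) *: c) <= \int[leb]_(t in `]a, b[) N (du t - c).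
Proof.
move=> Lc a0 ab bT.
have aI : I a by rewrite /= in_itv/= a0 (lt_trans ab).
have bI : I b by rewrite /= in_itv/= bT (lt_trans a0).
have Ld := sipB sip (evolution_L2_oo bI) (evolution_L2_oo aI).
have Lbc := sipZ sip (b - a) Lc.
have Lv := sipB sip Ld Lbc.
set v := u b - u a - (b - a) *: c in Lv *.
have JI : `]a, b[%classic `<=` I.
  by move=> t /=; rewrite !in_itv/= => /andP[h1 h2]; rewrite (lt_trans a0 h1) (lt_trans h2 bT).
have mJ : measurable (`]a, b[%classic : set (measurableTypeR R)) by exact: measurable_itv.
have iN := ae_integrable_sub mI mJ JI (norm_sub_integrable Lc).
have ip := ae_integrable_sub mI mJ JI (pairing_integrable Lv).
have K0 : 0 <= \int[leb]_(t in `]a, b[) N (du t - c) by apply: Rintegral_ge0 => t _; exact: L2norm_ge0.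
have : N v ^+ 2 <= (\int[leb]_(t in `]a, b[) N (du t - c)) * N v.
  rewrite L2norm_sqr {1}/v (sipBl sip Ld Lbc Lv) (sipZl sip _ Lc Lv) (evolution_pairing Lv a0 ab bT).
  have Ec : (b - a) * dot c v = \int[leb]_(t in `]a, b[) cst (dot c v) t.
    by rewrite Rintegral_itv_cst ?(ltW ab).
  have ic := ae_integrable_cst mJ (dot c v) (lebesgue_itv_fin a b).
  rewrite Ec -(RintegralB_ae mJ ip ic) mulrC -(RintegralZ_ae mJ _ iN).
  apply: le_Rintegral_ae => //; first exact: ae_integrableB.
    exact: ae_integrableZ.
  apply: filterS derivative_L2 => t Lt Jt; have {}Lt := Lt (JI t Jt).
  rewrite /= -(sipBl sip Lt Lc Lv) mulrC.
  apply: le_trans (ler_norm _) _; exact: L2_CS (sipB sip Lt Lc) Lv.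
have := L2norm_ge0 Om v; rewrite le_eqVlt => /predU1P[<- //|v0].
by rewrite expr2 ler_pM2r.
Qed.

Lemma increment_sq a b : 0 < a -> a < b -> b < T ->
  N (u b - u a) ^+ 2 <= (b - a) * \int[leb]_(t in `]a, b[) dot (du t) (du t).
Proof.
move=> a0 ab bT; have := increment_le (sip0 sip) a0 ab bT.
rewrite scaler0 subr0; set X := N _; set K := \int[_]_(_ in _) dot _ _ => HX.
have JI : `]a, b[%classic `<=` I.
  by move=> t /=; rewrite !in_itv/= => /andP[h1 h2]; rewrite (lt_trans a0 h1) (lt_trans h2 bT).
have mJ : measurable (`]a, b[%classic : set (measurableTypeR R)) by exact: measurable_itv.
have iN := ae_integrable_sub mI mJ JI (norm_sub_integrable (sip0 sip)).
have iK := ae_integrable_sub mI mJ JI derivative_integrable.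
have ba : 0 < b - a by rewrite subr_gt0.
(* The maximiser of 2 m X - m^2 (b - a), so that 2 m x - m^2 <= x^2 integrates to the Cauchy-Schwarz
   inequality. *)
pose m := X / (b - a).
have h : 2 * m * X - m ^+ 2 * (b - a) <= K.
  apply: (@le_trans _ _ (2 * m * (\int[leb]_(t in `]a, b[) N (du t - 0)) - m ^+ 2 * (b - a))).
    by rewrite lerD2r ler_wpM2l// mulr_ge0// divr_ge0 ?L2norm_ge0// ltW.
  have Ec : m ^+ 2 * (b - a) = \int[leb]_(t in `]a, b[) cst (m ^+ 2) t.
    by rewrite Rintegral_itv_cst ?(ltW ab)// mulrC.
  have ic := ae_integrable_cst mJ (m ^+ 2) (lebesgue_itv_fin a b).
  rewrite Ec -(RintegralZ_ae mJ _ iN) -(RintegralB_ae mJ (ae_integrableZ mJ _ iN) ic).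
  apply: le_Rintegral_ae => //; first by apply: ae_integrableB => //; exact: ae_integrableZ.
  apply: aeW => t _ /=; rewrite subr0 -(L2norm_sqr Om).
  by have := sqr_ge0 (N (du t) - m); rewrite sqrrB; lra.
rewrite mulrC -ler_pdivrMr//; apply: le_trans h; rewrite /m.
by rewrite le_eqVlt; apply/orP; left; apply/eqP; field; rewrite gt_eqF.
Qed.

(** The shift by 2 keeps every step strictly between 0 and T. *)
Definition step (n : nat) : R := T / n.+2%:R.
Definition diff_quot n t : V := (step n)^-1 *: (u (step n + t) - u t).

Lemma step_gt0 n : 0 < step n. Proof. by rewrite divr_gt0// ltr0n. Qed.

Lemma step_lt n : step n < T.
Proof. by rewrite ltr_pdivrMr ?ltr0n// ltr_pMr// ltr1n. Qed.

Lemma step_cvg (e : R) : 0 < e -> \forall n \near \oo, step n < e.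
Proof.
move=> e0; have eT : 0 < e / T by rewrite divr_gt0.
have := near_infty_natSinv_lt (PosNum eT); apply: filterS => n /= h.
rewrite /step mulrC -ltr_pdivlMr//; apply: le_lt_trans h.
by rewrite lef_pV2 ?posrE ?ltr0n// ler_nat.
Qed.

Local Notation J n := (`]0, (T - step n)[%classic : set R).

Lemma step_sub n : J n `<=` I.
Proof. by move=> t /=; rewrite !in_itv/= => /andP[-> h]; rewrite (lt_trans h)// gtrBl step_gt0. Qed.

Lemma step_shift n t : J n t -> I (step n + t).
Proof.
move=> /=; rewrite !in_itv/= => /andP[h1 h2]; rewrite addr_gt0 ?step_gt0//=.
by rewrite -ltrBrDl.
Qed.

Lemma measurable_step n : measurable (J n : set (measurableTypeR R)).
Proof. exact: measurable_itv. Qed.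

(** The telescoping behind all limits of quotients: only the integrals over the two end intervals of
    length [step n] survive. *)
Lemma shift_difference q n : ae_integrable leb I q ->
  ae_integrable leb (J n) (fun t => q (step n + t) - q t) /\
  \int[leb]_(t in J n) (q (step n + t) - q t) =
    \int[leb]_(t in `](T - step n), T[) q t - \int[leb]_(t in `]0, (step n)[) q t.
Proof.
move=> iq; have h0 := step_gt0 n; have hT := step_lt n; have mJ := measurable_step n.
have i1 : ae_integrable leb `](step n + 0), (step n + (T - step n))[ q.
  rewrite addr0 addrC subrK; apply: (ae_integrable_sub mI) iq; first exact: measurable_itv.
  by move=> t /=; rewrite !in_itv/= => /andP[h ->]; rewrite (lt_trans h0 h).
have [i2 E2] := ae_integrable_itv_shift i1.
have i3 := ae_integrable_sub mI mJ (@step_sub n) iq.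
split; first exact: ae_integrableB.
rewrite (RintegralB_ae mJ i2 i3) E2 addr0 (addrC (step n) (T - step n)) subrK.
have b1 : 0 <= step n <= T by rewrite !ltW.
have b2 : 0 <= T - step n <= T by rewrite subr_ge0 gerBl !ltW.
have := Rintegral_itv_cat b1 iq; rewrite (Rintegral_itv_cat b2 iq).
exact: cross_sub.
Qed.

Lemma diff_quot_L2 n t : J n t -> L2 Om (diff_quot n t).
Proof.
move=> Jt; apply: (sipZ sip); apply: (sipB sip).
  exact: evolution_L2_oo (step_shift Jt).
exact: evolution_L2_oo (step_sub Jt).
Qed.

Lemma diff_quot_sub_le n t c : J n t -> L2 Om c ->
  N (diff_quot n t - c) <= (step n)^-1 * \int[leb]_(s in `]t, (t + step n)[) N (du s - c).
Proof.
move=> Jt Lc; have h0 := step_gt0 n.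
have t0 : 0 < t by move: Jt; rewrite /= in_itv/= => /andP[].
have tT : step n + t < T by move: (step_shift Jt); rewrite /= in_itv/= => /andP[].
have tt : t < step n + t by rewrite ltrDr.
have := increment_le Lc t0 tt tT; rewrite addrK (addrC t) => H.
have -> : diff_quot n t - c = (step n)^-1 *: (u (step n + t) - u t - step n *: c).
  by rewrite scalerBr scalerA mulVf ?scale1r// gt_eqF.
rewrite NE (sip_normZ sip); last first.
  apply: (sipB sip); last exact: (sipZ sip).
  exact: (sipB sip (evolution_L2_oo (step_shift Jt)) (evolution_L2_oo (step_sub Jt))).
by rewrite gtr0_norm ?invr_gt0// -NE ler_wpM2l// invr_ge0 ltW.
Qed.

(** Lebesgue points of a vector-valued function: almost every t is a Lebesgue point of all scalar
    functions N (du - c_k), with c_k dense in the essential range of du. A c_k within e / 3 of du(t)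
    then stands in for du(t). *)
Lemma diff_quot_cvg : {ae leb, forall t, I t -> N (diff_quot n t - du t) @[n --> \oo] --> (0 : R)}.
Proof.
have [c [Lc cd]] := strongly_measurable_dense sip derivative_measurable.
have av : {ae leb, forall t, forall n, I t ->
    h^-1 * \int[leb]_(s in `]t, (t + h)[) N (du s - c n) @[h --> 0^'+] --> N (du t - c n)}.
  by apply/ae_foralln => n; exact: ae_average_cvg (norm_sub_integrable (Lc n)).
apply: filterS3 cd av derivative_L2 => t cd av Lt It; have {}Lt := Lt It.
apply/cvgrPdist_le => e e0.
have e3 : 0 < e / 3 by rewrite divr_gt0.
have [k ck] := cd It (e / 3) e3.
have /cvgrPdist_lt/(_ (e / 3) e3) := av k It.
rewrite /at_right near_withinE => /nbhs_ballP[del /= del0 Hdel].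
have Tt : 0 < T - t by rewrite subr_gt0; move: It; rewrite /= in_itv/= => /andP[].
have n1 := step_cvg del0; have n2 := step_cvg Tt.
apply: filterS2 n1 n2 => n n1 n2.
have Jt : J n t.
  by move: It; rewrite /= !in_itv/= => /andP[-> _]; rewrite ltrBrDl -ltrBrDr.
have h0 := step_gt0 n.
have := diff_quot_sub_le Jt (Lc k).
have := Hdel (step n); rewrite /ball/= sub0r normrN gtr0_norm// => /(_ n1 h0).
rewrite ltr_distlC => /andP[_ h1] h2.
have h3 := L2norm_triangleB (diff_quot_L2 Jt) (Lc k) Lt.
rewrite sub0r normrN ger0_norm ?L2norm_ge0//.
rewrite (L2norm_distC Lt (Lc k)) in h1.
apply: le_trans h3 _; rewrite [leRHS](_ : e = e / 3 + e / 3 + e / 3); last by field.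
apply: lerD; last exact: ltW.
apply: le_trans h2 _; apply: le_trans (ltW h1) _.
by rewrite lerD2r ltW.
Qed.

Lemma pairing_continuous v t : L2 Om v -> I t -> dot v (u s) @[s --> t] --> dot v (u t).
Proof.
move=> Lv It; apply/cvgrPdist_le => e e0.
have c0 : N v * N (u s - u t) @[s --> t] --> (0 : R).
  by rewrite -[X in _ --> X](mulr0 (N v)); apply: cvgM; [exact: cvg_cst|exact: evolution_continuous].
have /cvgr0_norm_le/(_ e e0) := c0.
have nI : \forall s \near t, I s by apply: near_in_itvoo.
move=> h; apply: filterS2 nI h => s Is; apply: le_trans.
have Ls := evolution_L2_oo Is; have Lt := evolution_L2_oo It.
rewrite distrC -(sipBr sip Ls Lt Lv).
apply: le_trans (L2_CS Lv (sipB sip Ls Lt)) _.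
exact: ler_norm.
Qed.

(** Continuity of u into L^2 spares the question whether the translated function is strongly
    measurable. *)
Lemma shift_pairing_measurable v n : L2 Om v ->
  ae_measurable leb (J n) (fun t => dot v (u (step n + t))).
Proof.
move=> Lv; apply: measurable_ae; apply: open_continuous_measurable_fun; first exact: interval_open.
move=> t /set_mem Jt.
exact: (cvg_shiftR (pairing_continuous Lv (step_shift Jt))).
Qed.

Lemma strongly_measurable_shift_pairing g n : strongly_measurable (L2 Om) N I g ->
  ae_measurable leb (J n) (fun t => dot (g t) (u (step n + t))).
Proof.
move=> /(strongly_measurable_sub (@step_sub n)) mg.
apply: (strongly_measurable_form sip sip L2_CS1 mg).
  by apply: aeW => t Jt; exact: evolution_L2_oo (step_shift Jt).
by move=> v Lv; exact: shift_pairing_measurable.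
Qed.

Lemma pairing_sub_measurable g k n : strongly_measurable (L2 Om) N I g ->
  strongly_measurable (L2 Om) N I k -> ae_measurable leb (J n) (fun t => dot (g t) (k t)).
Proof.
move=> mg mk; apply: (ae_measurable_sub mI (@step_sub n)).
exact: strongly_measurable_dotp.
Qed.

Lemma dotp_diff_quotE n t v : J n t -> L2 Om v ->
  dot v (diff_quot n t) = (step n)^-1 * (dot v (u (step n + t)) - dot v (u t)).
Proof.
move=> Jt Lv; have L1 := evolution_L2_oo (step_shift Jt); have L2 := evolution_L2_oo (step_sub Jt).
by rewrite /diff_quot (sipZr sip _ (sipB sip L1 L2) Lv) (sipBr sip L1 L2 Lv).
Qed.

Lemma diff_quot_pairing_measurable g n : strongly_measurable (L2 Om) N I g ->
  ae_measurable leb (J n) (fun t => dot (g t) (diff_quot n t)).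
Proof.
move=> mg; have [Lg _] := mg.
have m1 := strongly_measurable_shift_pairing n mg.
have m2 := pairing_sub_measurable n mg evolution_measurable.
apply: ae_measurable_eq (ae_measurableZ (step n)^-1 (ae_measurableB m1 m2)).
by apply: filterS Lg => t Lg Jt; rewrite (dotp_diff_quotE Jt (Lg (step_sub Jt))).
Qed.

Lemma diff_quot_sq_measurable n : ae_measurable leb (J n) (fun t => dot (diff_quot n t) (diff_quot n t)).
Proof.
have m0 : ae_measurable leb (J n) (fun t => dot (u (step n + t)) (u (step n + t))).
  apply: measurable_ae; apply: open_continuous_measurable_fun; first exact: interval_open.
  move=> t /set_mem Jt; have It := step_shift Jt.
  have c1 : dot (u s) (u s) @[s --> step n + t] --> dot (u (step n + t)) (u (step n + t)).
    rewrite -(L2norm_sqr Om); under eq_cvg do rewrite -(L2norm_sqr Om).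
    have cN : N (u s) @[s --> step n + t] --> N (u (step n + t)).
      apply/cvgrPdist_le => e e0; have /cvgr0_norm_le/(_ e e0) := evolution_continuous It.
      have nI : \forall s \near step n + t, I s by apply: near_in_itvoo.
      move=> h; apply: filterS2 nI h => s Is; apply: le_trans.
      rewrite distrC !NE; apply: le_trans (sip_norm_dist sip (evolution_L2_oo Is) (evolution_L2_oo It)) _.
      by rewrite -NE; exact: ler_norm.
    by rewrite expr2; apply: cvgM.
  exact: (cvg_shiftR c1).
have m1 := strongly_measurable_shift_pairing n evolution_measurable.
have m2 := diff_quot_pairing_measurable n evolution_measurable.
apply: ae_measurable_eq (ae_measurableB (ae_measurableZ (step n)^-1
  (ae_measurableZ (step n)^-1 (ae_measurableB m0 m1))) (ae_measurableZ (step n)^-1 m2)).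
apply: aeW => t Jt /=; have L1 := evolution_L2_oo (step_shift Jt); have L2 := evolution_L2_oo (step_sub Jt).
have Lq := diff_quot_L2 Jt.
rewrite (dotp_diff_quotE Jt Lq) (sipC sip Lq L1) (sipC sip Lq L2) !(dotp_diff_quotE Jt) //.
by rewrite (sipC sip L1 L2); ring.
Qed.

(** With K the primitive of |du|^2, the squared quotient is at most (K(t + h) - K(t)) / h. The
    integral telescopes to averages of K over the end intervals, and 0 <= K <= K(T). *)
Lemma diff_quot_sq_le n : ae_integrable leb (J n) (fun t => dot (diff_quot n t) (diff_quot n t)) /\
  \int[leb]_(t in J n) dot (diff_quot n t) (diff_quot n t) <= \int[leb]_(t in I) dot (du t) (du t).
Proof.
pose q t := dot (du t) (du t); pose D := \int[leb]_(t in I) q t.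
pose K t := \int[leb]_(s in `]0, t[) q s.
have iq := derivative_integrable; have h0 := step_gt0 n.
have q0 t : 0 <= q t by rewrite /q -L2norm_sqr sqr_ge0.
have K0 t : 0 <= K t by apply: Rintegral_ge0.
have KD t : I t -> K t <= D.
  rewrite /= in_itv/= => /andP[t0 tT]; rewrite /D (Rintegral_itv_cat (b := t)) ?(ltW t0) ?(ltW tT)//.
  by rewrite lerDl; apply: Rintegral_ge0.
have D0 : 0 <= D by apply: Rintegral_ge0.
have iK : ae_integrable leb I K.
  apply: (ae_integrable_le mI (primitive_measurable iq) (ae_integrable_cst mI D (lebesgue_itv_fin 0 T))).
  by apply: aeW => t It; rewrite (ger0_norm (K0 t)); exact: KD.
have [iS ES] := shift_difference n iK.
have mJ := measurable_step n.
have bnd t : J n t -> dot (diff_quot n t) (diff_quot n t) <= (step n)^-1 * (K (step n + t) - K t).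
  move=> Jt.
  have t0 : 0 < t by move: Jt; rewrite /= in_itv/= => /andP[].
  have tT : step n + t < T by move: (step_shift Jt); rewrite /= in_itv/= => /andP[].
  have tt : t < step n + t by rewrite ltrDr.
  have := increment_sq t0 tt tT; rewrite addrK.
  have -> : \int[leb]_(s in `]t, (step n + t)[) dot (du s) (du s) = K (step n + t) - K t.
    rewrite /K (Rintegral_itv_cat (a := 0) (b := t) (c := step n + t)) ?(ltW t0) ?(ltW tt)//.
      by rewrite addrAC subrr add0r.
    apply: (ae_integrable_sub mI) iq; first exact: measurable_itv.
    by move=> s /=; rewrite !in_itv/= => /andP[-> h]; rewrite (lt_trans h).
  move=> H.
  rewrite -(L2norm_sqr Om) NE (sip_normZ sip); last first.
    exact: (sipB sip (evolution_L2_oo (step_shift Jt)) (evolution_L2_oo (step_sub Jt))).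
  rewrite gtr0_norm ?invr_gt0// -NE exprMn.
  rewrite -(ler_pM2l (_ : 0 < step n ^+ 2)) ?exprn_gt0// mulrA -exprMn divff ?gt_eqF// expr1n mul1r.
  by rewrite expr2 -mulrA (mulrA (step n) _^-1) divff ?gt_eqF// mul1r.
have i1 := ae_integrableZ mJ (step n)^-1 iS.
have i2 : ae_integrable leb (J n) (fun t => dot (diff_quot n t) (diff_quot n t)).
  apply: (ae_integrable_le mJ (diff_quot_sq_measurable n) i1).
  by apply: aeW => t Jt; rewrite ger0_norm ?bnd// -L2norm_sqr sqr_ge0.
split => //.
apply: le_trans (le_Rintegral_ae mJ i2 i1 _) _; first by apply: aeW => t Jt; exact: bnd.
rewrite (RintegralZ_ae mJ _ iS) ES mulrC ler_pdivrMr//.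
have h1 : 0 <= \int[leb]_(t in `]0, (step n)[) K t by apply: Rintegral_ge0.
have h2 : \int[leb]_(t in `](T - step n), T[) K t <= D * step n.
  have mL : measurable (`](T - step n), T[%classic : set (measurableTypeR R)) by exact: measurable_itv.
  have LI : `](T - step n), T[%classic `<=` I.
    by move=> t /=; rewrite !in_itv/= => /andP[h ->]; rewrite (lt_trans _ h)// subr_gt0 step_lt.
  apply: le_trans (le_Rintegral_ae mL (ae_integrable_sub mI mL LI iK)
    (ae_integrable_cst mL D (lebesgue_itv_fin _ _)) _) _.
    by apply: aeW => t Lt; apply: KD; exact: LI.
  rewrite Rintegral_itv_cst; last by rewrite gerBl ltW.
  by rewrite opprB addrC subrK mulrC.
by rewrite lerBlDr; apply: le_trans h2 _; rewrite lerDl.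
Qed.

(** Fatou's lemma is applied to |q_n + g|^2, with q_n the quotient. As \int |q_n|^2 does not exceed
    \int |du|^2, the lower bound has to come from the cross term; it carries the factor 2, hence the
    tolerance 2 e. *)
Lemma diff_quot_liminf g (e : R) : strongly_measurable (L2 Om) N I g ->
  ae_integrable leb I (fun t => dot (g t) (g t)) -> 0 < e -> \forall n \near \oo,
  \int[leb]_(t in I) dot (g t) (du t) - e <= \int[leb]_(t in J n) dot (g t) (diff_quot n t).
Proof.
move=> mg ig e0; have [Sg _] := mg; have Sd := derivative_L2; have id := derivative_integrable.
have igd : ae_integrable leb I (fun t => dot (g t) (du t)).
  by apply: ae_integrable_dotp => //; exact: strongly_measurable_dotp mg derivative_measurable.
have igJ n := ae_integrable_sub mI (measurable_step n) (@step_sub n) ig.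
have igq n : ae_integrable leb (J n) (fun t => dot (g t) (diff_quot n t)).
  apply: ae_integrable_dotp => //.
  - by apply: filterS Sg => t H Jt; exact: (H (step_sub Jt)).
  - by apply: aeW => t; exact: diff_quot_L2.
  - exact: diff_quot_pairing_measurable.
  - by case: (diff_quot_sq_le n).
pose F n t := dot (diff_quot n t) (diff_quot n t) + 2 * dot (g t) (diff_quot n t) + dot (g t) (g t).
have FE n : {ae leb, forall t, J n t -> F n t = N (diff_quot n t + g t) ^+ 2}.
  apply: filterS Sg => t Lgt Jt; have {}Lgt := Lgt (step_sub Jt); have Lq := diff_quot_L2 Jt.
  by rewrite L2norm_sqr (sip_sqrD sip Lq Lgt) (sipC sip Lq Lgt).
have iF n : ae_integrable leb (J n) (F n).
  have [i1 _] := diff_quot_sq_le n; have mJ := measurable_step n.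
  exact: (ae_integrableD mJ (ae_integrableD mJ i1 (ae_integrableZ mJ 2 (igq n))) (igJ n)).
have iFI n := ae_integrable_restrict mI (measurable_step n) (@step_sub n) (iF n).
pose G t := dot (du t) (du t) + 2 * dot (g t) (du t) + dot (g t) (g t).
have iG : ae_integrable leb I G.
  exact: (ae_integrableD mI (ae_integrableD mI id (ae_integrableZ mI 2 igd)) ig).
have F0 n : {ae leb, forall t, I t -> 0 <= (F n \_ (J n)) t}.
  apply: filterS (FE n) => t H It; rewrite patchE; case: ifPn => // /set_mem Jt.
  by rewrite H// sqr_ge0.
have FG : {ae leb, forall t, I t -> (F n \_ (J n)) t @[n --> \oo] --> G t}.
  have FE' : {ae leb, forall t, forall n, J n t -> F n t = N (diff_quot n t + g t) ^+ 2}.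
    by apply/ae_foralln => n; exact: FE.
  have Sgd : {ae leb, forall t, I t -> L2 Om (g t) /\ L2 Om (du t)}.
    by apply: filterS2 Sg Sd => t h1 h2 It; split; [exact: h1|exact: h2].
  apply: filterS3 FE' Sgd diff_quot_cvg => t FE' Sgd cq It.
  have [Lgt Ldt] := Sgd It; have {}cq := cq It.
  have EG : G t = N (du t + g t) ^+ 2.
    by rewrite L2norm_sqr (sip_sqrD sip Ldt Lgt) (sipC sip Ldt Lgt).
  have Tt : 0 < T - t by rewrite subr_gt0; move: It; rewrite /= in_itv/= => /andP[].
  have nJ : \forall n \near \oo, J n t.
    apply: filterS (step_cvg Tt) => n n2.
    by move: It; rewrite /= !in_itv/= => /andP[-> _]; rewrite ltrBrDl -ltrBrDr.
  have cN : N (diff_quot n t + g t) @[n --> \oo] --> N (du t + g t).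
    apply/cvgrPdist_le => r r0; have /cvgr0_norm_le/(_ r r0) := cq.
    move=> h; apply: filterS2 nJ h => n Jt; apply: le_trans.
    have Lq := diff_quot_L2 Jt.
    rewrite distrC !NE; apply: le_trans (sip_norm_dist sip (sipD sip Lq Lgt) (sipD sip Ldt Lgt)) _.
    by rewrite opprD addrACA subrr addr0 -NE ler_norm.
  rewrite EG expr2; apply: cvg_trans (cvgM cN cN); apply: near_eq_cvg.
  apply: filterS nJ => n Jt /=.
  by rewrite patchE mem_set// FE'// expr2.
have e2 : 0 < 2 * e by rewrite mulr_gt0.
have := fatou_near mI iFI F0 FG iG e2; apply: filterS => n.
rewrite Rintegral_restrict; last exact: step_sub.
have mJ := measurable_step n.
have [i1 D1] := diff_quot_sq_le n.
rewrite (RintegralD_ae mJ (ae_integrableD mJ i1 (ae_integrableZ mJ 2 (igq n))) (igJ n)).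
rewrite (RintegralD_ae mJ i1 (ae_integrableZ mJ 2 (igq n))) (RintegralZ_ae mJ 2 (igq n)).
rewrite (RintegralD_ae mI (ae_integrableD mI id (ae_integrableZ mI 2 igd)) ig).
rewrite (RintegralD_ae mI id (ae_integrableZ mI 2 igd)) (RintegralZ_ae mI 2 igd).
have gJ : \int[leb]_(t in J n) dot (g t) (g t) <= \int[leb]_(t in I) dot (g t) (g t).
  rewrite -(Rintegral_restrict leb _ (@step_sub n)).
  apply: le_Rintegral_ae => //; first exact: (ae_integrable_restrict mI mJ (@step_sub n)).
  apply: aeW => t It; rewrite patchE; case: ifP => // _.
  by rewrite -(L2norm_sqr Om) sqr_ge0.
exact: liminf_arith D1 gJ.
Qed.

(** Against a nonnegative test function the increment is the integral of nonnegative pairings. It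
    holds for every t in J n, without a null set. *)
Lemma diff_quot_nonneg n t : {ae leb, forall t, I t -> nonneg_on Om (du t)} -> J n t ->
  nonneg_on Om (diff_quot n t).
Proof.
move=> du0 Jt; apply: (nonneg_of_test oOm bOm (diff_quot_L2 Jt)) => phi tphi phi0.
have Lphi := test_L2 oOm bOm tphi; have h0 := step_gt0 n.
rewrite (sipC sip (diff_quot_L2 Jt) Lphi) (dotp_diff_quotE Jt Lphi).
have L1 := evolution_L2_oo (step_shift Jt); have L2 := evolution_L2_oo (step_sub Jt).
rewrite -(sipBr sip L1 L2 Lphi) (sipC sip Lphi (sipB sip L1 L2)).
have t0 : 0 < t by move: Jt; rewrite /= in_itv/= => /andP[].
have tT : step n + t < T by move: (step_shift Jt); rewrite /= in_itv/= => /andP[].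
have tt : t < step n + t by rewrite ltrDr.
rewrite (evolution_pairing Lphi t0 tt tT) mulr_ge0 ?invr_ge0 ?(ltW h0)//.
apply: Rintegral_ge0_ae; apply: filterS du0 => s H sI; apply: dotp_ge0; last exact: aeW.
apply: H; move: sI; rewrite /= !in_itv/= => /andP[h1 h2].
by rewrite (lt_trans t0 h1) (lt_trans h2 tT).
Qed.

End increments.

End evolutions.

(** * Gradient flows *)

Section measurable_minorant.
Import HBNNSimple.
Context {disp : measure_display} {T : measurableType disp} {R : realType}
  (mu : {measure set T -> \bar R}).
Variables (D : set T) (P : T -> \bar R).
Hypotheses (mD : measurable D) (P0 : forall x, D x -> (0 <= P x)%E)
  (Pfin : (\int[mu]_(x in D) P x < +oo)%E).

(** The supremum of a sequence of simple minorants whose integrals approach the lower integral is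
    measurable and still a minorant. *)
Lemma lower_integral_attained : exists h : T -> R, [/\ measurable_fun D h, forall x, 0 <= h x,
  forall x, D x -> ((h x)%:E <= P x)%E, ae_integrable mu D h &
  (\int[mu]_(x in D) (h x)%:E = \int[mu]_(x in D) P x)%E].
Proof.
move: Pfin; set A := (\int[mu]_(x in D) P x)%E => Afin'.
have A0 : (0 <= A)%E by exact: integral_ge0.
have Afin : A \is a fin_num by rewrite ge0_fin_numE.
have PD0 x : (0 <= (P \_ D) x)%E by rewrite patchE; case: ifPn => // /set_mem; exact: P0.
have AE : A = ereal_sup [set sintegral mu g | g in [set g : {nnsfun T >-> R} | forall x, ((g x)%:E <= (P \_ D) x)%E]].
  by rewrite /A integral_mkcond ge0_integralTE.
have : forall n : nat, exists2 g : {nnsfun T >-> R}, (forall x, ((g x)%:E <= (P \_ D) x)%E) &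
    (A - (n.+1%:R^-1)%:E < sintegral mu g)%E.
  move=> n; have : (A - (n.+1%:R^-1)%:E < A)%E.
    by rewrite lteBlDr// lteDl// lte_fin invr_gt0.
  by rewrite {2}AE => /ereal_sup_gt[_ [g gP <-] Ag]; exists g.
move=> /(_ _)/cid2-/all_sig2[g gP gA].
pose G x : \bar R := ereal_sup (range (fun n => (g n x)%:E)).
have GE x : G x = esups (fun n => (g n x)%:E) 0%N.
  by rewrite /G /esups /sdrop; congr ereal_sup; apply/seteqP; split => _ [n nn <-]; exists n.
have mG : measurable_fun setT G.
  apply: (eq_measurable_fun (fun x => esups (fun n => (g n x)%:E) 0%N)).
    by move=> x _; rewrite GE.
  by apply: measurable_fun_esups => n; exact/measurable_EFinP.
have GP x : (G x <= (P \_ D) x)%E by apply: ge_ereal_sup => _ [n _ <-].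
have gG n x : ((g n x)%:E <= G x)%E by apply: ereal_sup_ubound; exists n.
have G0 x : (0 <= G x)%E by apply: le_trans (gG 0%N x); rewrite lee_fin.
have IG : (\int[mu]_(x in D) G x = A)%E.
  apply/eqP; rewrite eq_le; apply/andP; split.
    apply: ge0_le_lower_integral => // x Dx.
    by have := GP x; rewrite patchE mem_set.
  apply/lee_addgt0Pr => e e0.
  have [n _ hn] := near_infty_natSinv_lt (PosNum e0).
  have {hn} := hn n (leqnn n); rewrite /= => hn.
  rewrite -leeBlDr//; apply: (@le_trans _ _ (A - (n.+1%:R^-1)%:E)%E).
    by rewrite leeB// lee_fin ltW.
  apply: le_trans (ltW (gA n)) _.
  rewrite -integralT_nnsfun [leRHS]integral_mkcond; apply: ge0_le_lower_integral => x _.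
    by rewrite lee_fin.
  rewrite patchE; case: ifPn => [_|xD]; first exact: gG.
  by have := gP n x; rewrite patchE (negbTE xD).
have iG : mu.-integrable D G.
  apply/integrableP; split; first exact: measurable_funTS.
  by under eq_integral do rewrite gee0_abs//; rewrite IG.
exists (fun x => fine (G x)).
have hG x : ((fine (G x))%:E <= G x)%E by case: (G x) (G0 x).
have hGe : ae_eq mu D (fun x => (fine (G x))%:E) G.
  by apply: filterS (integrable_ae mD iG) => x H Dx; rewrite fineK// H.
have mh : measurable_fun D (fun x => fine (G x)).
  by apply: measurableT_comp => //; exact: measurable_funTS.
have Ih : (\int[mu]_(x in D) (fine (G x))%:E = A)%E.
  by rewrite -IG; exact: ae_eq_lower_integral.
split => //.
- by move=> x; rewrite fine_ge0.
- by move=> x Dx; apply: le_trans (hG x) _; have := GP x; rewrite patchE mem_set.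
- apply: ae_integrable_fin; first exact: measurable_ae.
    by apply: aeW => x _; rewrite fine_ge0.
  by rewrite Ih.
Qed.

(** The maximum of h and p is again a minorant almost everywhere, so its integral does not exceed
    that of h, and the two agree almost everywhere. *)
Lemma maximal_minorant (h : T -> R) : ae_integrable mu D h ->
  (forall x, D x -> ((h x)%:E <= P x)%E) -> (forall x, 0 <= h x) ->
  (\int[mu]_(x in D) (h x)%:E = \int[mu]_(x in D) P x)%E ->
  forall p, ae_measurable mu D p -> {ae mu, forall x, D x -> ((p x)%:E <= P x)%E} ->
  {ae mu, forall x, D x -> p x <= h x}.
Proof.
move=> ih hP h0 hI p mp pP.
pose m x := Num.max (h x) (p x).
have mE x : m x = h x + Num.max 0 (p x - h x).
  by rewrite /m; case: (leP (h x) (p x)); case: (leP 0 (p x - h x)); lra.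
have mpos : ae_measurable mu D (fun x => Num.max 0 (p x - h x)).
  apply: (@ae_measurable_comp _ _ _ mu D (fun r => Num.max 0 r)).
    by apply: measurable_maxr => //; exact: measurable_cst.
  by apply: ae_measurableB => //; exact: ae_integrable_measurable ih.
have mm : ae_measurable mu D m.
  apply: ae_measurable_eq (ae_measurableD (ae_integrable_measurable ih) mpos).
  by apply: aeW => x _; rewrite mE.
have m0 x : 0 <= m x by rewrite le_max h0.
have mP : {ae mu, forall x, D x -> ((m x)%:E <= P x)%E}.
  by apply: filterS pP => x H Dx; rewrite /m maxEle; case: ifP => _; [exact: H|exact: hP].
have mI : (\int[mu]_(x in D) (m x)%:E <= \int[mu]_(x in D) P x)%E.
  by apply: ae_ge0_le_lower_integral => // x _; rewrite lee_fin.
have im : ae_integrable mu D m.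
  by apply: (ae_integrable_fin mm); [exact: aeW|exact: le_lt_trans mI Pfin].
have id := ae_integrableB mD im ih.
have d0 : \int[mu]_(x in D) (m x - h x) <= 0.
  rewrite (RintegralB_ae mD im ih) subr_le0 -lee_fin.
  by rewrite (EFin_Rintegral_ae mD im) (EFin_Rintegral_ae mD ih) hI.
have dpos : {ae mu, forall x, D x -> 0 <= m x - h x}.
  by apply: aeW => x _; rewrite subr_ge0 /m le_max lexx.
have := Rintegral_eq0_ae mD id dpos d0; apply: filterS => x H Dx.
by have /eqP := H Dx; rewrite /= subr_eq0 => /eqP <-; rewrite /m le_max lexx orbT.
Qed.

End measurable_minorant.

Section negative_part.
Context {R : realType} {d : nat} (Om : set 'rV[R]_d).
Hypothesis oOm : open Om.
Local Notation N := (L2norm Om).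
Implicit Types v w : 'rV[R]_d -> R.
Let mOm : measurable Om. Proof. exact: open_measurable_rV. Qed.
Let sip := L2_sip mOm.

(** Its L^2 norm vanishes exactly when v >= 0 a.e. and is Lipschitz in v, so nonnegativity of u'(t)
    becomes an equation between functions of t that are measurable up to a null set. *)
Definition neg_part v : 'rV[R]_d -> R := fun x => Num.max (- v x) 0.

Lemma neg_part_L2 v : L2 Om v -> L2 Om (neg_part v).
Proof.
move=> Lv; apply: (L2_le mOm Lv).
  apply: measurable_maxr => //; apply: measurableT_comp => //; exact: L2_measurable.
move=> x _; rewrite /neg_part maxEle; case: ifP => _; first by rewrite normr0.
by rewrite normrN.
Qed.

Lemma neg_part_lip v w : L2 Om v -> L2 Om w -> `|N (neg_part v) - N (neg_part w)| <= N (v - w).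
Proof.
move=> Lv Lw; have L1 := neg_part_L2 Lv; have L2 := neg_part_L2 Lw.
rewrite !L2normE; apply: le_trans (sip_norm_dist sip L1 L2) _; rewrite -!L2normE.
apply: L2norm_le_ae => //; [exact: (sipB sip Lv Lw)|exact: (sipB sip L1 L2)|].
apply: aeW => x _; rewrite (_ : (neg_part v - neg_part w) x = Num.max (- v x) 0 - Num.max (- w x) 0)//.
rewrite (_ : (v - w) x = v x - w x)//; move: (v x) (w x) => r s.
rewrite ler_norml; case: (leP (- r) 0); case: (leP (- s) 0) => h1 h2;
  have := ler_norm (r - s); have := ler_norm (- (r - s)); rewrite normrN; lra.
Qed.

Lemma neg_part_nonneg v : nonneg_on Om v -> N (neg_part v) = 0.
Proof.
move=> v0; have -> : N (neg_part v) = N (0 : 'rV[R]_d -> R).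
  apply: L2norm_ae_eq; apply: filterS v0 => x H Omx.
  by rewrite /neg_part max_r// oppr_le0 H.
by rewrite L2normE; exact: sip_norm0 sip.
Qed.

Lemma nonneg_neg_part v : L2 Om v -> N (neg_part v) = 0 -> nonneg_on Om v.
Proof.
move=> Lv N0; have Ln := neg_part_L2 Lv.
have : dotp Om (neg_part v) (neg_part v) = 0 by rewrite -(L2norm_sqr Om) N0 expr0n.
move=> /(L2norm_eq0_ae mOm Ln); apply: filterS => x H Omx.
have := H Omx; rewrite /neg_part => h.
by rewrite -oppr_le0 -[leRHS]h le_max lexx.
Qed.

End negative_part.

Section indicator_integrals.
Context {R : realType}.
Local Notation leb := (@lebesgue_measure R).
Implicit Types (D E : set R) (q : R -> R).

Lemma indic_mulE E q t : \1_E t * q t = (q \_ E) t.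
Proof. by rewrite indicE patchE; case: ifP; rewrite ?mul1r ?mul0r. Qed.

Lemma Rintegral_indicM D E q : E `<=` D ->
  \int[leb]_(t in D) (\1_E t * q t) = \int[leb]_(t in E) q t.
Proof.
move=> ED; rewrite -(Rintegral_restrict leb q ED).
by apply: eq_Rintegral => t _; rewrite indic_mulE.
Qed.

Lemma ae_integrable_indicM D E q : measurable (D : set (measurableTypeR R)) ->
  measurable (E : set (measurableTypeR R)) -> ae_integrable leb D q ->
  ae_integrable leb D (fun t => \1_E t * q t).
Proof.
move=> mD mE iq; apply: (ae_integrable_le mD _ (ae_integrable_norm iq)).
  apply: ae_measurableM; last exact: ae_integrable_measurable.
  by apply: measurable_ae; exact: measurable_indic.
by apply: aeW => t _; rewrite normrM ler_piMl// indicE ger0_norm// lern1 leq_b1.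
Qed.

Lemma strongly_measurable_affine (V : lmodType R) (S : set V) (beta : V -> V -> R) (N : V -> R)
    (H : semi_inner S beta) (NE : forall u, N u = Num.sqrt (beta u u)) D E (g : R -> V) (lam : R) (v : V) :
  strongly_measurable S N D g -> measurable (E : set (measurableTypeR R)) -> S v ->
  strongly_measurable S N D (fun t => lam *: g t + (\1_E t : R) *: v).
Proof.
move=> [Sg [s [ss sg]]] mE Sv; split.
  by apply: filterS Sg => t Sgt Dt; apply: (sipD H); apply: (sipZ H) => //; exact: Sgt.
exists (fun n => [seq (p.1, lam *: p.2) | p <- s n] ++ [:: (E, v)]); split.
  move=> n p; rewrite mem_cat inE => /orP[/mapP[p' p's ->]|/eqP ->]; last by split.
  by have [mp Sp] := ss n p' p's; split => //=; exact: (sipZ H).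
apply: filterS2 Sg sg => t Sgt sgt Dt; have {}Sgt := Sgt Dt; have {}sgt := sgt Dt.
have Esum n : simple_fun ([seq (p.1, lam *: p.2) | p <- s n] ++ [:: (E, v)]) t -
    (lam *: g t + (\1_E t : R) *: v) = lam *: (simple_fun (s n) t - g t).
  rewrite /simple_fun big_cat big_seq1 /= big_map opprD addrACA subrr addr0 scalerBr; congr (_ - _).
  by rewrite scaler_sumr; apply: eq_bigr => p _ /=; rewrite !scalerA mulrC.
have c0 : `|lam| * N (simple_fun (s n) t - g t) @[n --> \oo] --> `|lam| * 0.
  by apply: cvgM => //; exact: cvg_cst.
rewrite mulr0 in c0; apply: cvg_trans c0; apply: near_eq_cvg; apply: nearW => n /=.
by rewrite Esum !NE (sip_normZ H _ (sipB H (simple_funS H t (ss n)) Sgt)).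
Qed.

End indicator_integrals.

Lemma difference_arith {R : realType} (h e K eta x y : R) :
  h * (e - eta) <= x -> y <= h * (e - K + eta) -> (K - 2 * eta) * h <= x - y.
Proof. nra. Qed.

Lemma competitor_arith {R : realType} (lam eps s k y q z fd w G D : R) : 0 <= lam ->
  2^-1 * G - fd - 2 * s <= k -> lam * fd - lam * eps * z - s <= y -> q <= D ->
  D + (2 * lam * k + 2 * y - lam ^+ 2 * q + w) <= G ->
  D + lam * G - lam ^+ 2 * D + (w - 2 * lam * eps * z) <= G + s * (4 * lam + 2).
Proof.
move=> l0 h1 h2 h3; have := ler_wpM2l l0 h1; have := ler_wpM2l (sqr_ge0 lam) h3; nra.
Qed.

Lemma perturbation_arith {R : realType} (C s t x v z : R) : s * (C + 2) = t ->
  - (C * s) <= x <= C * s -> - s <= z <= s -> - s <= v <= s -> - t <= x - v + z <= t.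
Proof. by move=> <-; lra. Qed.

Lemma gt_of_subr_le {R : realType} (x y z : R) : 2 * z < y -> y - x <= z -> z < x.
Proof. by move=> *; lra. Qed.

Lemma subr_le_contra {R : realType} (x y z w : R) :
  w < x -> - w <= y - z - x -> y <= z -> False.
Proof. by move=> *; lra. Qed.

Lemma pos_part_eq_ae {R : realType} {d : nat} (Om : set 'rV[R]_d) l v w :
  pos_part_eq Om l w -> L2 Om v -> ae_eq (lebesgue_rV d) Om v w -> pos_part_eq Om l v.
Proof.
move=> [_ [m [lm mE]]] Lv vw; split => //; exists m; split => // E mE' EOm.
rewrite (mE E mE' EOm); apply: ae_eq_lower_integral.
by apply: filterS vw => x H Ex; rewrite H//; exact: EOm.
Qed.

(** * Dissipation and energy along the flow *)

Section gradient_flow.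
Context {R : realType} {d : nat} (Om : set 'rV[R]_d) (T : R)
  (B : 'rV[R]_d -> 'M[R]_d) (b : 'rV[R]_d -> R) (f u du : R -> 'rV[R]_d -> R).
Hypotheses (oOm : open Om) (bOm : bounded_set Om) (T0 : 0 < T)
  (csc : continuous_coercive_symmetric Om B b) (Lf : L2_0T_L2 Om T f)
  (flow : unilateral_gradient_flow Om T B b f u du) (Hu0 : H10 Om (u 0)).
Local Notation leb := (@lebesgue_measure R).
Local Notation I := (`]0, T[%classic : set R).
Local Notation N := (L2norm Om).
Local Notation dot := (dotp Om).
Local Notation a := (Defs.form Om B b).
Local Notation V := ('rV[R]_d -> R).
Let mOm : measurable Om. Proof. exact: open_measurable_rV. Qed.
Let sip := L2_sip mOm.
Let Hs := H10_sip oOm bOm.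
Let As := form_sip oOm bOm csc.
Let mI : measurable (I : set (measurableTypeR R)). Proof. exact: measurable_itv. Qed.
Let ev : evolution Om T u du. Proof. by case: flow. Qed.
Let mf := L2_0T_L2_measurable Lf.
Let mdu := derivative_measurable ev.

Let force t : ('rV[R]_d -> R) -> R := Auf Om B b f u t.
Let P t : \bar R := (L2plus_norm Om (du t) ^+ 2 + pos_part_norm Om (force t) ^+ 2)%E.
Let e t : R := 2^-1 * a (u t) (u t).

Let P0 t : I t -> (0 <= P t)%E.
Proof.
by move=> _; apply: adde_ge0; exact: sqre_ge0.
Qed.

Let fdu_integrable : ae_integrable leb I (fun t => dot (f t) (du t)).
Proof.
apply: ae_integrable_dotp => //.
- by case: mf.
- exact: derivative_L2 ev.
- exact: strongly_measurable_dotp.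
- exact: L2_0T_L2_integrable.
- exact: derivative_integrable ev.
Qed.

Lemma flow_energyE s : H10 Om (u s) -> energy Om B b (u s) = (e s)%:E.
Proof. by move=> Hus; rewrite /energy asboolT. Qed.

(** The right-hand side is below +oo, and the energy is +oo outside H^1_0. So u(s) is in H^1_0 for
    every s, not just almost every s, and its difference quotients are admissible. *)
Lemma flow_H10 s : 0 <= s <= T -> H10 Om (u s) /\
  ((e s)%:E <= (e 0)%:E - (2^-1)%:E * \int[leb]_(t in `]0%R, s[) P t +
    (\int[leb]_(t in `]0%R, s[) dot (f t) (du t))%R%:E)%E.
Proof.
move=> s0; case: flow => _ _ /(_ s s0); rewrite (flow_energyE Hu0) -/P => H.
have fin : ((e 0)%:E - (2^-1)%:E * \int[leb]_(t in `]0%R, s[) P t +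
    (\int[leb]_(t in `]0%R, s[) dot (f t) (du t))%R%:E < +oo)%E.
  rewrite lte_add_pinfty ?ltry//; apply: (@le_lt_trans _ _ (e 0)%:E); last exact: ltry.
  rewrite -[leRHS]adde0 leeD2l// oppe_le0 mule_ge0//.
  by apply: integral_ge0 => t _; apply: adde_ge0; exact: sqre_ge0.
have Hus : H10 Om (u s).
  apply: contrapT => nH; move: H; rewrite /energy (asboolF nH) leye_eq => /eqP E.
  by rewrite E ltxx in fin.
by split; [exact: Hus|rewrite -(flow_energyE Hus); exact: H].
Qed.

Lemma flow_form_ge0 s : 0 <= s <= T -> 0 <= e s.
Proof. by move=> /flow_H10[Hus _]; rewrite /e mulr_ge0 ?invr_ge0//; exact: (sip_ge0 As Hus). Qed.

Lemma flow_dissipation_fin : (\int[leb]_(t in I) P t < +oo)%E.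
Proof.
have TT : 0 <= T <= T by rewrite lexx ltW.
have [_ H] := flow_H10 TT.
rewrite ltey; apply/eqP => E; move: H; rewrite E.
by rewrite mulry gtr0_sg ?invr_gt0// mul1e.
Qed.

(* P is not known to be measurable, so its integral is a lower integral; it is attained by a
   largest measurable minorant h, which replaces P in the sequel. *)
Lemma flow_minorant : exists h : R -> R, [/\ ae_integrable leb I h, forall t, 0 <= h t,
  forall t, I t -> ((h t)%:E <= P t)%E,
  forall p, ae_measurable leb I p -> {ae leb, forall t, I t -> ((p t)%:E <= P t)%E} ->
    {ae leb, forall t, I t -> p t <= h t} &
  forall s, 0 <= s <= T -> e s <= e 0 -
    \int[leb]_(t in `]0, s[) (2^-1 * h t - dot (f t) (du t))].
Proof.
have [h [mh h0 hP ih hI]] := lower_integral_attained mI P0 flow_dissipation_fin.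
exists h; split; [exact: ih|exact: h0|exact: hP|move=> p mp pP|].
  exact: (maximal_minorant mI P0 flow_dissipation_fin ih hP h0 hI mp pP).
move=> s sT; have [_] := flow_H10 sT.
have [s0 sT'] := andP sT.
have mJ : measurable (`]0, s[%classic : set (measurableTypeR R)) by exact: measurable_itv.
have JI : `]0, s[%classic `<=` I.
  by move=> t /=; rewrite !in_itv/= => /andP[-> h2]; rewrite (lt_le_trans h2 sT').
have i1 := ae_integrable_sub mI mJ JI ih.
have i2 := ae_integrable_sub mI mJ JI fdu_integrable.
rewrite (RintegralB_ae mJ (ae_integrableZ mJ 2^-1 i1) i2) (RintegralZ_ae mJ 2^-1 i1).
rewrite opprB addrA addrAC -lee_fin => H.
have hle : ((2^-1)%:E * (\int[leb]_(t in `]0%R, s[) h t)%R%:E <= (2^-1)%:E * \int[leb]_(t in `]0%R, s[) P t)%E.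
  apply: lee_wpmul2l; first by rewrite lee_fin invr_ge0.
  rewrite (EFin_Rintegral_ae mJ i1); apply: ge0_le_lower_integral => t Jt; first by rewrite lee_fin.
  by apply: hP; exact: JI.
apply: le_trans H _; rewrite EFinD EFinB EFinM.
by apply: leeD => //; apply: leeB.
Qed.

Lemma dissipation_slope t g : H10 Om (u t) -> L2 Om (f t) -> L2 Om (du t) -> H10 Om g -> nonneg_on Om g ->
  ((dot (du t) (du t) + (2 * (- a (u t) g + dot (f t) g) - dot g g))%:E <= P t)%E.
Proof.
move=> Hu Lft Ldt Hg g0; rewrite EFinD; apply: leeD.
  rewrite -(L2norm_sqr Om) /L2plus_norm; case: ifP => // _.
  by rewrite expe2 mulyy leey.
have Lg := H10_L2 Hg.
(* Without a density in L^2 the infimum is over the empty set, and P t is +oo. *)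
have [[w lw]|nw] := pselect (exists w, pos_part_eq Om (force t) w); last first.
  rewrite /pos_part_norm (_ : [set _ | _ in _] = set0) ?ereal_inf0.
    by rewrite expe2 mulyy leey.
  by apply/seteqP; split => // x [w lw _]; apply: nw; exists w.
have Lw : L2 Om w by case: lw.
rewrite (pos_part_normE oOm bOm lw) -EFin_expe lee_fin L2norm_sqr.
have h : - a (u t) g + dot (f t) g <= dot w g.
  apply: (nonneg_test_extend oOm bOm csc Hu Lft Lw _ Hg g0) => psi npsi.
  exact: (pos_part_test_le oOm bOm lw npsi).
have := sip_ge0 sip (sipB sip Lw Lg).
have := sip_sqrB sip Lw Lg.
move: h; move: (dot w g) (dot w w) (dot g g) (dot (w - g) (w - g)) => x y z k; move: (- _ + _) => F; lra.
Qed.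

Section with_minorant.
Variable h : R -> R.
Hypotheses (ih : ae_integrable leb I h) (h0 : forall t, 0 <= h t)
  (hP : forall t, I t -> ((h t)%:E <= P t)%E)
  (hmax : forall p, ae_measurable leb I p -> {ae leb, forall t, I t -> ((p t)%:E <= P t)%E} ->
    {ae leb, forall t, I t -> p t <= h t})
  (EI : forall s, 0 <= s <= T -> e s <= e 0 -
    \int[leb]_(t in `]0, s[) (2^-1 * h t - dot (f t) (du t))).

(** P is +oo where u' is not nonnegative, so every multiple n q of the norm q of the negative part
    is a minorant of P. By maximality n q <= h almost everywhere for all n, and h is real-valued. *)
Lemma flow_derivative_nonneg : {ae leb, forall t, I t -> nonneg_on Om (du t)}.
Proof.
pose q t := N (neg_part (du t)).
have mq : ae_measurable leb I q.
  apply: (@strongly_measurable_comp _ _ _ _ _ sip I (fun _ v => N (neg_part v)) du mdu).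
    by move=> v Lv; exact: ae_measurable_cst.
  apply: aeW => t It Lt v Lv vt; apply/cvgrPdist_le => r r0.
  have /cvgr0_norm_le/(_ r r0) := vt; apply: filterS => n; apply: le_trans.
  rewrite distrC; apply: le_trans (neg_part_lip oOm (Lv n) Lt) _; exact: ler_norm.
have Ld := derivative_L2 ev.
have : {ae leb, forall t, forall n : nat, I t -> n%:R * q t <= h t}.
  apply/ae_foralln => n; apply: (hmax (ae_measurableZ n%:R mq)).
  apply: filterS Ld => t Lt It; have {}Lt := Lt It.
  have [du0|ndu0] := pselect (nonneg_on Om (du t)).
    by rewrite /q (neg_part_nonneg oOm du0) mulr0; exact: P0.
  rewrite /P /L2plus_norm (asboolF ndu0) expe2 mulyy.
  by rewrite addye ?leey// gt_eqF// (lt_le_trans _ (sqre_ge0 _)).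
apply: filterS2 Ld => t Lt H It; apply: (nonneg_neg_part oOm (Lt It)).
apply/eqP; rewrite eq_le L2norm_ge0 andbT leNgt; apply/negP => q0.
have := H (Num.truncn (h t / q t)).+1 It; rewrite leNgt => /negP; apply.
by rewrite -ltr_pdivrMr//; exact: truncnS_gt.
Qed.

Let C0 := e 0 + \int[leb]_(t in I) `|dot (f t) (du t)|.

(** Strong measurability of u in H^1_0 makes e measurable up to a null set, and the energy
    inequality bounds it by C0. *)
Lemma flow_energy_integrable : ae_integrable leb I e.
Proof.
have [C _ HC] := form_bound csc.
have mu_ : strongly_measurable (H10 Om) (H1norm Om) I u by case: ev => -[].
have me : ae_measurable leb I e.
  apply: ae_measurableZ; apply: (strongly_measurable_form2 Hs As (C := C) _ mu_ mu_).
  by move=> v w Hv Hw; exact: HC.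
apply: (ae_integrable_le mI me (ae_integrable_cst mI C0 (lebesgue_itv_fin 0 T))).
apply: aeW => t It; have tT : 0 <= t <= T by move: It; rewrite /= in_itv/= => /andP[h1 h2]; rewrite !ltW.
rewrite ger0_norm ?flow_form_ge0//; apply: le_trans (EI tT) _; rewrite /C0 lerD2l.
have mJ : measurable (`]0, t[%classic : set (measurableTypeR R)) by exact: measurable_itv.
have JI : `]0, t[%classic `<=` I.
  by move=> s /=; rewrite !in_itv/= => /andP[-> h2]; rewrite (lt_le_trans h2)//; case/andP: tT.
have i1 := ae_integrable_sub mI mJ JI ih.
have i2 := ae_integrable_sub mI mJ JI fdu_integrable.
rewrite (RintegralB_ae mJ (ae_integrableZ mJ 2^-1 i1) i2) opprB.
apply: (@le_trans _ _ (\int[leb]_(s in `]0, t[) dot (f s) (du s))).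
  by rewrite gerBl; apply: Rintegral_ge0 => s _; rewrite mulr_ge0 ?invr_ge0.
apply: le_trans (ler_norm _) _; apply: le_trans (le_normr_Rintegral_ae mJ i2) _.
rewrite (Rintegral_itv_cat (a := 0) (b := t) (c := T)) //.
  by rewrite lerDl; apply: Rintegral_ge0.
exact: ae_integrable_norm.
Qed.

(** u is continuous at 0 in L^2 only, which is the topology of [form_lsc]. The tolerance for the
    form is 2 eta because the energy is half of it. *)
Lemma flow_energy_lsc (eta : R) : 0 < eta -> exists2 del : R, 0 < del &
  forall t, 0 < t < T -> t < del -> e 0 - eta <= e t.
Proof.
move=> eta0; have eta2 : 0 < 2 * eta by rewrite mulr_gt0.
have [r r0 Hr] := form_lsc oOm bOm csc Hu0 eta2.
have TT : 0 \in `[0, T] by rewrite in_itv/= lexx ltW.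
have [_] : L2 Om (u 0) /\ N (u s - u 0) @[s --> within `[0, T] (nbhs 0)] --> (0 : R).
  by case: ev => _ _ _ _; exact.
move=> /cvgr0_norm_lt/(_ r r0); rewrite near_withinE => /nbhs_ballP[del /= del0 H].
exists del => // t /andP[t0 tT] td.
have tT' : 0 <= t <= T by rewrite !ltW.
have [Hut _] := flow_H10 tT'.
have h1 : N (u t - u 0) < r.
  have hb : ball 0 del t by rewrite /ball/= sub0r normrN gtr0_norm.
  have := H t hb; rewrite ger0_norm ?L2norm_ge0//; apply.
  by rewrite /= in_itv.
have := Hr _ Hut h1; rewrite /e; move: (a (u 0) (u 0)) (a (u t) (u t)) => x y; lra.
Qed.

Local Notation J n := (`]0, (T - step T n)[%classic : set R).
Local Notation dq := (diff_quot T u).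
Let iE := flow_energy_integrable.

Let F (psi : V) t := - a (u t) psi + dot (f t) psi.

Lemma flow_H10_oo t : I t -> H10 Om (u t).
Proof.
rewrite /= in_itv/= => /andP[h1 h2]; have tT : 0 <= t <= T by rewrite !ltW.
by have [] := flow_H10 tT.
Qed.

Lemma force_integrable psi : H10 Om psi -> ae_integrable leb I (F psi).
Proof.
move=> Hpsi; have Lpsi := H10_L2 Hpsi.
have [C _ HC] := form_bound csc.
have mu_ : strongly_measurable (H10 Om) (H1norm Om) I u by case: ev => -[].
have m1 : ae_measurable leb I (fun t => a (u t) psi).
  by apply: (strongly_measurable_form_cst Hs As (C := C) _ mu_ Hpsi) => v w Hv Hw; exact: HC.
have i1 : ae_integrable leb I (fun t => a (u t) psi).
  apply: (ae_integrable_le mI m1 (ae_integrableD mI (ae_integrableZ mI 2 iE)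
    (ae_integrable_cst mI (a psi psi) (lebesgue_itv_fin 0 T)))).
  apply: aeW => t It; have Hu := flow_H10_oo It.
  apply: le_trans (sip_CS As Hu Hpsi) _; rewrite /= /e mulrA mulfV// mul1r.
  rewrite -(sip_norm_sqr As Hu) -(sip_norm_sqr As Hpsi) !sqrtr_sqr.
  rewrite !(ger0_norm (sqrtr_ge0 _)).
  have := sqrtr_ge0 (a (u t) (u t)); have := sqrtr_ge0 (a psi psi).
  move: (Num.sqrt (a (u t) (u t))) (Num.sqrt (a psi psi)) => x y; nra.
have i2 : ae_integrable leb I (fun t => dot (f t) psi).
  apply: ae_integrable_dotp => //; first by case: mf.
  - exact: aeW.
  - exact: (strongly_measurable_form_cst sip sip (@L2_CS1 _ _ Om oOm) mf Lpsi).
  - exact: L2_0T_L2_integrable.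
  - by apply: ae_integrable_cst => //; exact: lebesgue_itv_fin.
apply: ae_integrable_eq (ae_integrableB mI i2 i1).
by apply: aeW => t _; rewrite /F addrC.
Qed.

(* Convexity of the energy. *)
Lemma form_diff_quot_le n t : J n t ->
  a (u t) (dq n t) <= (step T n)^-1 * (e (step T n + t) - e t).
Proof.
move=> Jt; have H1 := flow_H10_oo (step_shift T0 Jt); have H2 := flow_H10_oo (step_sub T0 Jt).
rewrite /diff_quot (sipZr As _ (sipB Hs H1 H2) H2) ler_wpM2l ?invr_ge0 ?(ltW (step_gt0 T0 n))//.
rewrite (sipBr As H1 H2 H2) /e.
have := sip_ge0 As (sipB Hs H1 H2); rewrite (sip_sqrB As H1 H2) (sipC As H1 H2).
move: (a (u t) _) (a (u t) (u t)) (a (u (step T n + t)) _) => x y z; lra.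
Qed.

Let G := \int[leb]_(t in I) h t.
Let D := \int[leb]_(t in I) dot (du t) (du t).
Let kappa t := 2^-1 * h t - dot (f t) (du t).
Let ik : ae_integrable leb I kappa.
Proof. exact: (ae_integrableB mI (ae_integrableZ mI 2^-1 ih) fdu_integrable). Qed.
Let KT := \int[leb]_(t in I) kappa t.

(** KT is the energy loss that the energy inequality guarantees at time T; the primitive of kappa is
    continuous, so nearly the same loss is guaranteed on the last interval of length [step T n]. *)
Lemma energy_difference_ge (eta : R) : 0 < eta -> \forall n \near \oo,
  KT - 2 * eta <= - ((step T n)^-1 * \int[leb]_(t in J n) (e (step T n + t) - e t)).
Proof.
move=> eta0; have [d1 d10 H1] := flow_energy_lsc eta0.
have [d2 d20 H2] := primitive_near_T T0 ik eta0.
apply: filterS2 (step_cvg T0 d10) (step_cvg T0 d20) => n n1 n2.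
have hn := step_gt0 T0 n; have hT := step_lt T0 n.
have [_ ->] := shift_difference T0 n iE.
set A := \int[leb]_(t in `]0, _[) e t.
have hA : step T n * (e 0 - eta) <= A.
  have mL : measurable (`]0, (step T n)[%classic : set (measurableTypeR R)) by exact: measurable_itv.
  have LI : `]0, (step T n)[%classic `<=` I.
    by move=> t /=; rewrite !in_itv/= => /andP[-> h2]; exact: lt_trans hT.
  have := Rintegral_itv_cst (e 0 - eta) (ltW hn); rewrite subr0 => <-.
  apply: le_Rintegral_ae => //.
  - by apply: ae_integrable_cst => //; exact: lebesgue_itv_fin.
  - exact: ae_integrable_sub iE.
  - apply: aeW => t /=; rewrite in_itv/= => /andP[t0 th].
    by apply: H1; [rewrite t0 (lt_trans th hT)|exact: lt_trans n1].
have hB : \int[leb]_(t in `](T - step T n), T[) e t <= step T n * (e 0 - KT + eta).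
  have mL : measurable (`](T - step T n), T[%classic : set (measurableTypeR R)) by exact: measurable_itv.
  have LI : `](T - step T n), T[%classic `<=` I.
    by move=> t /=; rewrite !in_itv/= => /andP[h1 ->]; rewrite (lt_trans _ h1)// subr_gt0.
  have Th : T - step T n <= T by rewrite gerBl ltW.
  have E : T - (T - step T n) = step T n by rewrite opprB addrC subrK.
  have := Rintegral_itv_cst (e 0 - KT + eta) Th; rewrite E => <-.
  apply: le_Rintegral_ae => //.
  - exact: ae_integrable_sub iE.
  - by apply: ae_integrable_cst => //; exact: lebesgue_itv_fin.
  - apply: aeW => t Lt; move: (Lt); rewrite /= in_itv/= => /andP[t0 tT].
    have tT' : 0 <= t <= T by move: (LI _ Lt); rewrite /= in_itv/= => /andP[h1 h2]; rewrite !ltW.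
    apply: le_trans (EI tT') _.
    have td : T - d2 < t by apply: le_lt_trans t0; rewrite lerD2l lerN2 ltW.
    have := H2 t tT' td; rewrite ler_norml => /andP[h1 _].
    have {}h1 : - eta <= \int[leb]_(t in `]0, t[) kappa t - KT by exact: h1.
    rewrite -/(\int[leb]_(t in `]0, t[) kappa t); move: h1.
    move: KT (\int[leb]_(t in `]0, t[) kappa t) (e 0) => x z v; lra.
rewrite -[leRHS]mulrN opprB [leRHS]mulrC ler_pdivlMr//.
by apply: difference_arith hA hB.
Qed.

(** * Duality tested with a difference quotient and a localised perturbation *)

Section competitor.
Variables (lam eps : R) (psi : V) (E : set R) (n0 : nat).
Hypotheses (lam0 : 0 <= lam) (eps0 : 0 <= eps) (npsi : nonneg_test Om psi)
  (mE : measurable (E : set (measurableTypeR R))) (EJ : E `<=` J n0).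
Let Hpsi : H10 Om psi. Proof. exact: nonneg_test_H10 npsi. Qed.
Let Lpsi : L2 Om psi. Proof. exact: H10_L2. Qed.
(** All that is paired with the quotient: lam f from the force, and - lam eps 1_E psi from the mixed
    term of ||g||^2. A single use of [diff_quot_liminf] then covers both. *)
Let ft t : V := lam *: f t + (\1_E t : R) *: (- (lam * eps) *: psi).
(** A lower bound for 2 (Au + f, g) - ||g||^2, expanded, with - a(u, q) replaced by the energy
    difference that convexity provides. *)
Let r n t := 2 * lam * - ((step T n)^-1 * (e (step T n + t) - e t)) + 2 * dot (ft t) (dq n t)
  - lam ^+ 2 * dot (dq n t) (dq n t) + \1_E t * (2 * eps * F psi t - eps ^+ 2 * dot psi psi).

Lemma competitor_slope n t : J n t -> L2 Om (f t) -> L2 Om (du t) ->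
  ((dot (du t) (du t) + r n t)%:E <= P t)%E.
Proof.
move=> Jt Lft Ldt; have It := step_sub T0 Jt.
have Hu := flow_H10_oo It.
have Hq : H10 Om (dq n t).
  by apply: (sipZ Hs); apply: (sipB Hs _ Hu); exact: flow_H10_oo (step_shift T0 Jt).
have q0 : nonneg_on Om (dq n t) := diff_quot_nonneg oOm bOm T0 ev flow_derivative_nonneg Jt.
have Lq := H10_L2 Hq.
have [_ psi0] := npsi.
have i0 : 0 <= (\1_E t : R) by rewrite indicE.
pose g : V := lam *: dq n t + (eps * \1_E t) *: psi.
have Hg : H10 Om g by apply: (sipD Hs); exact: (sipZ Hs).
have g0 : nonneg_on Om g.
  apply: filterS q0 => x q0 Omx; rewrite (_ : g x = lam * dq n t x + eps * \1_E t * psi x)//.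
  exact: (addr_ge0 (mulr_ge0 lam0 (q0 Omx)) (mulr_ge0 (mulr_ge0 eps0 i0) (psi0 x))).
have := dissipation_slope Hu Lft Ldt Hg g0; apply: le_trans; rewrite lee_fin lerD2l.
have H1 := form_diff_quot_le Jt.
have HlZ := sipZ Hs lam Hq; have HeZ := sipZ Hs (eps * \1_E t) Hpsi.
have LlZ := sipZ sip lam Lq; have LeZ := sipZ sip (eps * \1_E t) Lpsi.
have Lp := sipZ sip (- (lam * eps)) Lpsi.
rewrite /r /g /F (sipDr As HlZ HeZ Hu) (sipZr As _ Hq Hu) (sipZr As _ Hpsi Hu).
rewrite (sipDr sip LlZ LeZ Lft) (sipZr sip _ Lq Lft) (sipZr sip _ Lpsi Lft).
rewrite (sip_sqrD sip LlZ LeZ) !(sipZl sip _ Lq) ?(sipZr sip _ Lq) ?(sipZl sip _ Lpsi) ?(sipZr sip _ Lpsi)//.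
rewrite /ft (sipDl sip (sipZ sip lam Lft) (sipZ sip _ Lp) Lq) (sipZl sip _ Lft Lq) (sipZl sip _ Lp Lq) (sipZl sip _ Lpsi Lq).
rewrite (sipC sip Lpsi Lq).
have i2 : (\1_E t : R) * \1_E t = \1_E t by rewrite indicE; case: (_ \in _); rewrite ?mulr1 ?mulr0.
move: H1; move: (_^-1 * _) => X; move: (a (u t) (dq n t)) => Y.
move: (dot (f t) (dq n t)) (dot (dq n t) psi) (dot psi psi) (dot (f t) psi) (a (u t) psi) (dot (dq n t) (dq n t)).
move: (\1_E t : R) i2 lam0 => i i2 l0 x y z w v k XY.
have : lam * Y <= lam * X by rewrite ler_wpM2l.
have : eps ^+ 2 * (i * i) * z = eps ^+ 2 * i * z by rewrite i2.
nra.
Qed.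

Let mft : strongly_measurable (L2 Om) N I ft.
Proof. exact: (strongly_measurable_affine sip (@L2normE _ _ Om) lam mf mE (sipZ sip _ Lpsi)). Qed.

Let ift : ae_integrable leb I (fun t => dot (ft t) (ft t)).
Proof.
have [Lf_ _] := mf.
have Lp := sipZ sip (- (lam * eps)) Lpsi; set v := - (lam * eps) *: psi in Lp.
apply: (ae_integrable_le mI (strongly_measurable_dotp oOm mft mft) (ae_integrableD mI
  (ae_integrableZ mI (2 * lam ^+ 2) (L2_0T_L2_integrable oOm Lf))
  (ae_integrable_cst mI (2 * dot v v) (lebesgue_itv_fin 0 T)))).
apply: filterS Lf_ => t Lft It; have {}Lft := Lft It.
have L1 := sipZ sip lam Lft; have L2 := sipZ sip (\1_E t : R) Lp.
rewrite ger0_norm; last exact: (sip_ge0 sip (sipD sip L1 L2)).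
rewrite [leRHS](_ : _ = 2 * lam ^+ 2 * dot (f t) (f t) + 2 * dot v v)//.
have := sip_ge0 sip (sipB sip L1 L2); rewrite (sip_sqrB sip L1 L2) (sip_sqrD sip L1 L2).
rewrite (sipZl sip _ Lft L1) (sipZr sip _ Lft Lft) (sipZl sip _ Lp L2) (sipZr sip _ Lp Lp).
have v0 := sip_ge0 sip Lp; have i1 : (\1_E t : R) * \1_E t <= 1.
  by rewrite indicE; case: (_ \in _); rewrite ?mulr1 ?mulr0.
move: v0 (ler_wpM2r v0 i1); move: (dot v v) (dot (f t) (f t)) (dot (lam *: f t) ((\1_E t : R) *: v)) (\1_E t : R) => x y z i; lra.
Qed.

(** E keeps away from T by [step T n0] and the steps decrease, so the perturbation is admissible for
    all later n. *)
Let step_subset n : (n0 <= n)%N -> E `<=` J n.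
Proof.
move=> n0n t /EJ; rewrite /= !in_itv/= => /andP[-> h1]; apply: (lt_le_trans h1).
rewrite lerD2l lerN2 ler_wpM2l ?(ltW T0)// lef_pV2 ?posrE ?ltr0n// ler_nat.
by rewrite !ltnS.
Qed.

Let r_integral n : ae_integrable leb (J n) (r n) /\
  \int[leb]_(t in J n) r n t =
    2 * lam * - ((step T n)^-1 * \int[leb]_(t in J n) (e (step T n + t) - e t)) +
    2 * (\int[leb]_(t in J n) dot (ft t) (dq n t)) -
    lam ^+ 2 * (\int[leb]_(t in J n) dot (dq n t) (dq n t)) +
    \int[leb]_(t in J n) (\1_E t * (2 * eps * F psi t - eps ^+ 2 * dot psi psi)).
Proof.
have mJ := measurable_step T n; have [iq _] := diff_quot_sq_le oOm T0 ev n.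
have [is_ _] := shift_difference T0 n iE; have [Sft _] := mft.
have idq : ae_integrable leb (J n) (fun t => dot (ft t) (dq n t)).
  apply: ae_integrable_dotp => //.
  - by apply: filterS Sft => t H Jt; exact: (H (step_sub T0 Jt)).
  - by apply: aeW => t; exact: (diff_quot_L2 oOm T0 ev).
  - exact: (diff_quot_pairing_measurable oOm T0 ev n mft).
  - exact: (ae_integrable_sub mI mJ (step_sub T0 (n := n)) ift).
have iF := ae_integrable_sub mI mJ (step_sub T0 (n := n)) (force_integrable Hpsi).
have j1 : ae_integrable leb (J n) (fun t => 2 * lam * - ((step T n)^-1 * (e (step T n + t) - e t))).
  have := ae_integrableZ mJ (2 * lam * - (step T n)^-1) is_.
  by apply: ae_integrable_eq; apply: aeW => t _; rewrite !mulrN mulNr mulrA.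
have j2 := ae_integrableZ mJ 2 idq.
have j3 := ae_integrableZ mJ (lam ^+ 2) iq.
have j4 : ae_integrable leb (J n) (fun t => \1_E t * (2 * eps * F psi t - eps ^+ 2 * dot psi psi)).
  apply: (ae_integrable_indicM mJ mE); apply: (ae_integrableB mJ (ae_integrableZ mJ _ iF)).
  by apply: ae_integrable_cst => //; exact: lebesgue_itv_fin.
have j12 := ae_integrableD mJ j1 j2; have j123 := ae_integrableB mJ j12 j3.
split; first exact: (ae_integrableD mJ j123 j4).
rewrite (RintegralD_ae mJ j123 j4) (RintegralB_ae mJ j12 j3) (RintegralD_ae mJ j1 j2).
rewrite (RintegralZ_ae mJ _ idq) (RintegralZ_ae mJ _ iq); congr (_ + _ - _ + _).
rewrite -[in RHS]mulNr -(RintegralZ_ae mJ _ is_) -RintegralZ_ae//; last exact: ae_integrableZ.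
by apply: eq_Rintegral => t _; rewrite mulNr.
Qed.

Let r_le n : D + \int[leb]_(t in J n) r n t <= G.
Proof.
have mJ := measurable_step T n; have [Lf_ _] := mf; have JI := step_sub T0 (n := n).
have ir := ae_integrable_restrict mI mJ JI (r_integral n).1.
have id := derivative_integrable oOm ev.
rewrite -(Rintegral_restrict leb _ JI) -(RintegralD_ae mI id ir).
apply: le_Rintegral_ae => //; first exact: ae_integrableD.
apply: hmax; first by apply: ae_integrable_measurable; exact: ae_integrableD.
apply: filterS2 Lf_ (derivative_L2 ev) => t Lft Ldt It; have {}Lft := Lft It; have {}Ldt := Ldt It.
rewrite patchE; case: ifPn => [/set_mem Jt|_]; first exact: competitor_slope.
(* Outside J n there is no quotient; the competitor g = 0 gives the bound ||u'||^2 <= P. *)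
have := dissipation_slope (flow_H10_oo It) Lft Ldt (sip0 Hs) (aeW _ (fun x _ => lexx 0)).
have S0 := sip0 sip; have H0 := sip0 Hs; rewrite -(scale0r (0 : V)).
rewrite (sipZr As _ H0 (flow_H10_oo It)) (sipZr sip _ S0 Lft) (sipZr sip _ S0 (sipZ sip 0 S0)).
by rewrite !mul0r !oppr0 !addr0 mulr0 addr0.
Qed.

Lemma competitor_le : D + lam * G - lam ^+ 2 * D +
  \int[leb]_(t in E) (2 * eps * (F psi t - lam * dot (du t) psi) - eps ^+ 2 * dot psi psi) <= G.
Proof.
have EI_ : E `<=` I := subset_trans EJ (step_sub T0 (n := n0)).
have iFE := ae_integrable_sub mI mE EI_ (force_integrable Hpsi).
have idp := pairing_integrable oOm ev Lpsi.
have idpE := ae_integrable_sub mI mE EI_ idp.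
have icE : ae_integrable leb E (fun=> eps ^+ 2 * dot psi psi).
  apply: (ae_integrable_sub mI mE EI_).
  by apply: ae_integrable_cst => //; exact: lebesgue_itv_fin.
have i1 := ae_integrableB mE (ae_integrableZ mE (2 * eps) iFE) icE.
have -> : \int[leb]_(t in E) (2 * eps * (F psi t - lam * dot (du t) psi) - eps ^+ 2 * dot psi psi) =
    \int[leb]_(t in E) (2 * eps * F psi t - eps ^+ 2 * dot psi psi) -
    2 * lam * eps * \int[leb]_(t in E) dot (du t) psi.
  rewrite -(RintegralZ_ae mE _ idpE) -(RintegralB_ae mE i1 (ae_integrableZ mE _ idpE)).
  apply: eq_Rintegral => t _.
  rewrite [RHS](_ : _ = 2 * eps * F psi t - eps ^+ 2 * dot psi psi - 2 * lam * eps * dot (du t) psi)//; ring.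
have Efd : \int[leb]_(t in I) dot (ft t) (du t) =
    lam * (\int[leb]_(t in I) dot (f t) (du t)) - lam * eps * \int[leb]_(t in E) dot (du t) psi.
  have j2 := ae_integrableZ mI (lam * eps) (ae_integrable_indicM mI mE idp).
  rewrite -(Rintegral_indicM _ EI_) -(RintegralZ_ae mI _ fdu_integrable).
  rewrite -(RintegralZ_ae mI _ (ae_integrable_indicM mI mE idp)).
  rewrite -(RintegralB_ae mI (ae_integrableZ mI _ fdu_integrable) j2).
  apply: Rintegral_ae_eq; have [Lf_ _] := mf; apply: filterS2 Lf_ (derivative_L2 ev) => t Lft Ldt It.
  have {}Lft := Lft It; have {}Ldt := Ldt It; have Lp := sipZ sip (- (lam * eps)) Lpsi.
  rewrite (sipDl sip (sipZ sip lam Lft) (sipZ sip _ Lp) Ldt) (sipZl sip _ Lft Ldt).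
  rewrite (sipZl sip _ Lp Ldt) (sipZl sip _ Lpsi Ldt) (sipC sip Lpsi Ldt); ring.
have EKT : KT = 2^-1 * G - \int[leb]_(t in I) dot (f t) (du t).
  by rewrite /KT (RintegralB_ae mI (ae_integrableZ mI 2^-1 ih) fdu_integrable) (RintegralZ_ae mI _ ih).
apply/ler_addgt0Pr => eta eta0.
(* The energy bound has error 2 s and weight 2 lam, the pairing has error s and weight 2: in total s
   (4 lam + 2). *)
have M0 : 0 < 4 * lam + 2 by rewrite ltr_wpDl// mulr_ge0.
have e0 : 0 < eta / (4 * lam + 2) by rewrite divr_gt0.
have [n [nn [A1 A2]]] : exists n, [/\ (n0 <= n)%N &
    KT - 2 * (eta / (4 * lam + 2)) <= - ((step T n)^-1 * \int[leb]_(t in J n) (e (step T n + t) - e t)) /\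
    \int[leb]_(t in I) dot (ft t) (du t) - eta / (4 * lam + 2) <= \int[leb]_(t in J n) dot (ft t) (dq n t)].
  near \oo => n; exists n; split; first by near: n; exact: nbhs_infty_ge.
  split; near: n; first exact: energy_difference_ge.
  exact: (diff_quot_liminf oOm T0 ev mft ift e0).
have := r_le n; have [_ ->] := r_integral n.
have [_] := diff_quot_sq_le oOm T0 ev n; rewrite -/D.
rewrite (Rintegral_indicM _ (step_subset nn)); move: A1 A2; rewrite Efd EKT.
have := mulfVK (lt0r_neq0 M0) eta; move: (eta / _) => eta'.
move: (- (_^-1 * _)) (\int[leb]_(t in J n) dot (ft t) (dq n t)) => k y.
move: (\int[leb]_(t in J n) dot (dq n t) (dq n t)) (\int[leb]_(t in E) dot (du t) psi) => q z.
move: (\int[leb]_(t in I) dot (f t) (du t)) => fd.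
move: (\int[leb]_(t in E) (2 * eps * F psi t - eps ^+ 2 * dot psi psi)) G D lam0 => w G' D' l0.
by move=> <-; exact: competitor_arith.
Unshelve. all: by end_near.
Qed.

End competitor.

Let D0 : 0 <= D.
Proof. by apply: Rintegral_ge0 => t _; rewrite -L2norm_sqr sqr_ge0. Qed.

Lemma minorant_mass_ge : 2 * D <= G.
Proof.
have n0 : nonneg_test Om (cst 0) by split => //; exact: test0.
have H (lam : R) : 0 <= lam -> lam < 1 -> (1 + lam) * D <= G.
  move=> lam0 lam1.
  have := competitor_le (n0 := 0) lam0 (lexx 0) n0 measurable0 (sub0set _).
  rewrite Rintegral_set0 addr0 => h1; have l1 : 0 < 1 - lam by rewrite subr_gt0.
  rewrite -(ler_pM2l l1); move: h1; nra.
rewrite leNgt; apply/negP => GD.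
have D1 := H 0 (lexx 0) ltr01; rewrite addr0 mul1r in D1.
have D2 : 0 < 2 * D by apply: le_lt_trans GD; exact: le_trans D1.
(* If G < 2 D, no limit in lam is needed: lam = G / (2 D) < 1 turns (1 + lam) D <= G into D + G/2 <=
   G, a contradiction. *)
have l0 : 0 <= G / (2 * D) := (divr_ge0 (le_trans D0 D1) (ltW D2)).
have l1 : G / (2 * D) < 1 by rewrite ltr_pdivrMr// mul1r.
have := H _ l0 l1; have := divfK (lt0r_neq0 D2) G.
move: (G / _) GD => lam; move: G D => x z; lra.
Qed.

Lemma flow_force_le_test psi : nonneg_test Om psi ->
  {ae leb, forall t, I t -> F psi t <= dot (du t) psi}.
Proof.
move=> npsi; have Hpsi := nonneg_test_H10 oOm bOm npsi; have Lpsi := H10_L2 Hpsi.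
pose q t := F psi t - dot (du t) psi.
have iq : ae_integrable leb I q.
  by apply: (ae_integrableB mI (force_integrable Hpsi)); exact: (pairing_integrable oOm ev Lpsi).
have [k /integrableP[/measurable_EFinP mk _] qk] := iq.
have mI' n : measurable (J n : set (measurableTypeR R)) by exact: measurable_itv.
have step1 n0 E : measurable (E : set (measurableTypeR R)) -> E `<=` J n0 ->
    \int[leb]_(t in E) q t <= 0.
  move=> mE EJ; have EI_ : E `<=` I := subset_trans EJ (step_sub T0 (n := n0)).
  have iqE := ae_integrable_sub mI mE EI_ iq.
  apply/ler_addgt0Pr => eta eta0; rewrite add0r.
  have icE : ae_integrable leb E (cst (dot psi psi)).
    apply: (ae_integrable_sub mI mE EI_).
    by apply: ae_integrable_cst => //; exact: lebesgue_itv_fin.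
  pose c := \int[leb]_(t in E) cst (dot psi psi) t.
  have c0 : 0 <= c by apply: Rintegral_ge0 => t _; exact: (sip_ge0 sip Lpsi).
  (* At lam = 1 the competitor inequality is 2 x \int_E q <= x^2 c for the weight x; dividing by x,
     the value x = eta / (c + 1) leaves \int_E q <= eta. *)
  have e0 : 0 < eta / (c + 1) by rewrite divr_gt0// ltr_wpDl.
  have := competitor_le ler01 (ltW e0) npsi mE EJ.
  have -> : \int[leb]_(t in E) (2 * (eta / (c + 1)) * (F psi t - 1 * dot (du t) psi) -
      (eta / (c + 1)) ^+ 2 * dot psi psi) =
      2 * (eta / (c + 1)) * \int[leb]_(t in E) q t - (eta / (c + 1)) ^+ 2 * c.
    rewrite -(RintegralZ_ae mE _ iqE) -(RintegralZ_ae mE _ icE).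
    rewrite -(RintegralB_ae mE (ae_integrableZ mE _ iqE) (ae_integrableZ mE _ icE)).
    by apply: eq_Rintegral => t _; rewrite /q mul1r.
  have := divfK (lt0r_neq0 (ltr_wpDl c0 ltr01)) eta.
  move: (eta / _) e0 => x x0 <-.
  move: (\int[leb]_(t in E) q t) c c0 G D => y c' c0 G' D'.
  move=> h1; have : x * (2 * y - x * c') <= 0 by move: h1; nra.
  by rewrite pmulr_rle0// => h2; nra.
have step2 n0 : {ae leb, forall t, J n0 t -> q t <= 0}.
  pose E := J n0 `&` k @^-1` `]0, +oo[.
  have mE : measurable (E : set (measurableTypeR R)).
    have JI := step_sub T0 (n := n0).
    rewrite /E -(setIidr JI) -setIA (setIC (J n0)) setIA; apply: measurableI => //.
    by apply: mk => //; exact: measurable_itv.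
  have EJ : E `<=` J n0 by move=> t [].
  have EI_ : E `<=` I := subset_trans EJ (step_sub T0 (n := n0)).
  have q0 : {ae leb, forall t, E t -> 0 <= q t}.
    apply: filterS qk => t H Et; rewrite (H (EI_ _ Et)); case: Et => _ /=.
    by rewrite in_itv/= andbT => /ltW.
  have := Rintegral_eq0_ae mE (ae_integrable_sub mI mE EI_ iq) q0 (step1 _ _ mE EJ).
  apply: filterS2 qk => t H K Jt; have It := step_sub T0 Jt.
  rewrite (H It) leNgt; apply/negP => k0.
  have Et : E t by split => //=; rewrite in_itv/= andbT.
  by move: (K Et); rewrite (H It) => E0; rewrite E0 ltxx in k0.
have : {ae leb, forall t, forall n, J n t -> q t <= 0} by apply/ae_foralln.
apply: filterS => t H It; rewrite -subr_le0.
move: (It); rewrite /= in_itv/= => /andP[t0 tT].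
have [n nt] : exists n, step T n < T - t.
  have tT0 : 0 < T - t by rewrite subr_gt0.
  by near \oo => n; exists n; near: n; exact: step_cvg.
by apply: (H n); rewrite /= in_itv/= t0 ltrBrDl -ltrBrDr.
Unshelve. all: by end_near.
Qed.

(** One null set has to serve all psi. The triples (u, f, u') are approximated from countable sets;
    for each approximating triple and each n, one test function is fixed that violates the
    inequality by more than 1/(n+1), if there is any. At a time where the inequality holds for this
    countable family, any violation would make a nearby fixed function a violation too. *)
Lemma flow_force_le : {ae leb, forall t, I t -> forall psi, nonneg_test Om psi ->
  F psi t <= dot (du t) psi}.
Proof.
have [C Cge0 HC] := form_bound csc.
have mu_ : strongly_measurable (H10 Om) (H1norm Om) I u by case: ev => -[].
have [c [Hc cu]] := strongly_measurable_dense Hs mu_.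
have [df [Ldf cf]] := strongly_measurable_dense sip mf.
have [dd [Ldd cd]] := strongly_measurable_dense sip mdu.
pose X (q : nat * nat * nat * nat) psi := - a (c q.1.1.1) psi + dot (df q.1.1.2) psi - dot (dd q.1.2) psi.
pose bad q := [set psi | nonneg_test Om psi /\ H1norm Om psi <= 1 /\ q.2.+1%:R^-1 < X q psi].
pose psi_ q := xget (cst 0) (bad q).
(* If nothing is bad for q, the default 0 is still an admissible test function. *)
have npsi q : nonneg_test Om (psi_ q).
  by rewrite /psi_; case: xgetP => [_ _ []//|_]; split => //; exact: test0.
have [Lf_ _] := mf.
have H : {ae leb, forall t, forall m, if unpickle m is Some q then I t -> F (psi_ q) t <= dot (du t) (psi_ q) else True}.
  by apply/ae_foralln => m; case: unpickle => [q|]; [exact: flow_force_le_test|exact: aeW].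
have ae1 : {ae leb, forall t, I t -> L2 Om (f t) /\ L2 Om (du t)}.
  by apply: filterS2 Lf_ (derivative_L2 ev) => t h1 h2 It; split; [exact: h1|exact: h2].
have ae2 : {ae leb, forall t, I t -> forall e : R, 0 < e -> exists q1 q2 q3,
    [/\ H1norm Om (c q1 - u t) < e, N (df q2 - f t) < e & N (dd q3 - du t) < e]}.
  apply: filterS3 cu cf cd => t h1 h2 h3 It e' e'0.
  have [q1 ?] := h1 It _ e'0; have [q2 ?] := h2 It _ e'0; have [q3 ?] := h3 It _ e'0.
  by exists q1, q2, q3.
apply: filterS3 H ae1 ae2 => t H ae1 ae2 It psi npsi'; have [Lft Ldt] := ae1 It.
have Hu := flow_H10_oo It; have Hpsi := nonneg_test_H10 oOm bOm npsi'.
rewrite leNgt; apply/negP => lt0; pose s := (H1norm Om psi + 1)^-1.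
have Np0 := H1norm_ge0 Om psi.
have s0 : 0 < s by rewrite invr_gt0 ltr_wpDl.
pose del := s * (F psi t - dot (du t) psi).
have del0 : 0 < del by rewrite mulr_gt0// subr_gt0.
have nspsi := nonneg_testZ (ltW s0) npsi'.
have Ns1 : H1norm Om (s *: psi) <= 1.
  rewrite (H1normZ oOm bOm _ (H10_H1 Hpsi)) gtr0_norm// mulrC ler_pdivrMr ?mul1r ?lerDl//.
  by rewrite ltr_wpDl.
have [n nd] : exists n : nat, 2 * n.+1%:R^-1 < del.
  have d2 : 0 < del / 2 by rewrite divr_gt0.
  near \oo => n; exists n; rewrite mulrC -ltr_pdivlMr//; near: n.
  exact: (near_infty_natSinv_lt (PosNum d2)).
have C2 : 0 < C + 2 by rewrite ltr_wpDl.
(* C is the weight of the error in u, and 1 that of each of the errors in f and u'; their sum is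
   then at most 1/(n+1) for |phi| <= 1. *)
have e0 : 0 < n.+1%:R^-1 / (C + 2) :> R by rewrite divr_gt0// invr_gt0 ltr0n.
have [q1 [q2 [q3 [E1 E2 E3]]]] := ae2 It _ e0.
pose q := (q1, q2, q3, n).
have err phi : H10 Om phi -> H1norm Om phi <= 1 ->
    `|F phi t - dot (du t) phi - X q phi| <= n.+1%:R^-1.
  move=> Hphi phi1; have Lphi := H10_L2 Hphi.
  have -> : F phi t - dot (du t) phi - X q phi =
      a (c q1 - u t) phi - dot (df q2 - f t) phi + dot (dd q3 - du t) phi.
    rewrite (sipBl As (Hc q1) Hu Hphi) (sipBl sip (Ldf q2) Lft Lphi) (sipBl sip (Ldd q3) Ldt Lphi).
    by rewrite /F /X/=; ring.
  have b1 : `|a (c q1 - u t) phi| <= C * (n.+1%:R^-1 / (C + 2)).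
    apply: le_trans (HC _ _ (sipB Hs (Hc q1) Hu) Hphi) _; rewrite -mulrA ler_wpM2l//.
    by rewrite -[leRHS]mulr1 ler_pM ?H1norm_ge0// ltW.
  have b2 (v w : V) : L2 Om v -> L2 Om w -> N (v - w) < n.+1%:R^-1 / (C + 2) ->
      `|dot (v - w) phi| <= n.+1%:R^-1 / (C + 2).
    move=> Lv Lw vw; apply: le_trans (L2_CS oOm (sipB sip Lv Lw) Lphi) _.
    rewrite -[leRHS]mulr1 ler_pM ?L2norm_ge0//; first exact: ltW.
    exact: le_trans (L2norm_le_H1 _ _) phi1.
  have := b2 _ _ (Ldf q2) Lft E2; have := b2 _ _ (Ldd q3) Ldt E3; move: b1.
  rewrite !ler_norml; have := divfK (lt0r_neq0 C2) n.+1%:R^-1.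
  exact: perturbation_arith.
have bpsi : bad q (s *: psi).
  split => //; split => //=; have := err _ (sipZ Hs s Hpsi) Ns1; rewrite ler_norml => /andP[_].
  have -> : F (s *: psi) t - dot (du t) (s *: psi) = del.
    have Lpsi := H10_L2 Hpsi.
    by rewrite /F (sipZr As _ Hpsi Hu) (sipZr sip _ Lpsi Lft) (sipZr sip _ Lpsi Ldt) /del /F; ring.
  exact: gt_of_subr_le nd.
have [nq [Nq Xq]] : bad q (psi_ q) := xgetPex _ (ex_intro _ _ bpsi).
have := H (pickle q); rewrite pickleK => /(_ It).
have := err _ (nonneg_test_H10 oOm bOm nq) Nq; rewrite ler_norml => /andP[].
by move=> h1 _ h2; exact: (subr_le_contra Xq h1 h2).
Unshelve. all: by end_near.
Qed.

Lemma flow_pos_part_minorant : {ae leb, forall t, I t ->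
  nonneg_on Om (du t) /\ pos_part_eq Om (force t) (du t)}.
Proof.
have rad : {ae leb, forall t, I t -> is_radon Om (force t)} by case: flow.
have [Lf_ _] := mf.
have W : {ae leb, forall t, I t -> L2 Om (du t) /\ exists w, [/\ pos_part_eq Om (force t) w,
    (forall x, 0 <= w x) & {ae lebesgue_rV d, forall x, Om x -> w x <= du t x}]}.
  apply: filterS3 rad flow_force_le (filterI (derivative_L2 ev) flow_derivative_nonneg).
  move=> t rt ft [Lt nt] It; split; first exact: Lt.
  exact: (pos_part_exists oOm bOm (rt It) (Lt It) (nt It) (ft It)).
(* Equality of norms is enough for w = u': since 0 <= w <= u', the product <w, u' - w> is
   nonnegative, which is this bound. *)
have WL t w : L2 Om (du t) -> L2 Om w -> (forall x, 0 <= w x) ->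
    {ae lebesgue_rV d, forall x, Om x -> w x <= du t x} ->
    dot (du t - w) (du t - w) <= dot (du t) (du t) - dot w w.
  move=> Lt Lw w0 wdu; rewrite (sip_sqrB sip Lt Lw).
  have : 0 <= dot w (du t - w).
    apply: dotp_ge0; first exact: aeW.
    apply: filterS wdu => x H Omx.
    by rewrite (_ : (du t - w) x = du t x - w x)// subr_ge0 H.
  rewrite (sipBr sip Lt Lw Lw) (sipC sip Lw Lt); move: (dot _ _) (dot _ _) (dot _ _) => x y z; lra.
have h2 : {ae leb, forall t, I t -> h t <= 2 * dot (du t) (du t)}.
  apply: filterS W => t Wt It; have [Lt [w [lw w0 wdu]]] := Wt It.
  have Lw : L2 Om w by case: lw.
  have := hP It; rewrite /P (pos_part_normE oOm bOm lw) -EFin_expe.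
  rewrite /L2plus_norm asboolT; last first.
    by apply: filterS wdu => x H Omx; exact: le_trans (H Omx).
  rewrite -EFin_expe -EFinD lee_fin !L2norm_sqr => h1; apply: le_trans h1 _.
  have := WL _ _ Lt Lw w0 wdu; have := sip_ge0 sip (sipB sip Lt Lw).
  move: (dot _ _) (dot _ _) (dot _ _) => x y z; lra.
have id := derivative_integrable oOm ev.
have h2E : {ae leb, forall t, I t -> 2 * dot (du t) (du t) - h t = 0}.
  apply: (Rintegral_eq0_ae mI (ae_integrableB mI (ae_integrableZ mI 2 id) ih)).
    by apply: filterS h2 => t H It; rewrite subr_ge0 H.
  rewrite (RintegralB_ae mI (ae_integrableZ mI 2 id) ih) (RintegralZ_ae mI 2 id) subr_le0.
  exact: minorant_mass_ge.
apply: filterS3 W h2E flow_derivative_nonneg => t Wt h2E nt It; split; first exact: nt.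
have [Lt [w [lw w0 wdu]]] := Wt It; have Lw : L2 Om w by case: lw.
have Ldw := sipB sip Lt Lw.
(* The chain 2 ||u'||^2 = h <= P = ||u'||^2 + ||w||^2 gives ||u'||^2 <= ||w||^2. *)
have dw0 : dot (du t - w) (du t - w) = 0.
  apply/eqP; rewrite eq_le (sip_ge0 sip Ldw) andbT; apply: le_trans (WL _ _ Lt Lw w0 wdu) _.
  have := hP It; rewrite /P (pos_part_normE oOm bOm lw) -EFin_expe.
  rewrite /L2plus_norm (asboolT (nt It)) -EFin_expe -EFinD lee_fin !L2norm_sqr.
  have := h2E It; move: (dot _ _) (dot _ _) (h t) => x y z; lra.
have E0 := L2norm_eq0_ae mOm Ldw dw0.
apply: (pos_part_eq_ae lw Lt); apply: filterS E0 => x H Omx.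
by apply/eqP; rewrite -subr_eq0; apply/eqP; exact: H.
Qed.

End with_minorant.

Lemma flow_pos_part : {ae leb, forall t, I t ->
  nonneg_on Om (du t) /\ pos_part_eq Om (force t) (du t)}.
Proof.
have [h [ih h0 hP hmax EI]] := flow_minorant.
exact: (flow_pos_part_minorant ih h0 hP hmax EI).
Qed.

End gradient_flow.

Theorem proposition2p3 (R : realType) (d : nat) (Om : set 'rV[R]_d) (T : R)
    (B : 'rV[R]_d -> 'M[R]_d) (b : 'rV[R]_d -> R)
    (f : R -> 'rV[R]_d -> R) (u0 : 'rV[R]_d -> R) :
  open Om -> bounded_set Om -> 0 < T ->
  continuous_coercive_symmetric Om B b ->
  L2_0T_L2 Om T f -> H10 Om u0 ->
  (forall u du : R -> 'rV[R]_d -> R,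
     unilateral_gradient_flow Om T B b f u du ->
     ae_eq (lebesgue_rV d) Om (u 0) u0 ->
     solves_parabolic Om T B b f u0 u du /\
     {ae lebesgue_measure, forall t : R, t \in `]0, T[ ->
        (L2norm Om (du t))%:E = L2plus_norm Om (du t) /\
        L2plus_norm Om (du t) = pos_part_norm Om (Auf Om B b f u t)}) /\
  (forall u du : R -> 'rV[R]_d -> R,
     evolution Om T u du ->
     solves_parabolic Om T B b f u0 u du ->
     {ae lebesgue_measure, forall t : R, t \in `]0, T[ ->
        var_ineq Om B b f u du t /\ var_ineq_obstacle Om B b f u du t}) /\
  (forall u du : R -> 'rV[R]_d -> R,
     evolution Om T u du ->
     {ae lebesgue_measure, forall t : R, t \in `]0, T[ ->
        (var_ineq Om B b f u du t <-> var_ineq_obstacle Om B b f u du t)}).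
Proof.
move=> oOm bOm T0 csc Lf Hu0.
have ae_L2 u du : evolution Om T u du -> {ae lebesgue_measure, forall t : R, t \in `]0, T[ ->
    [/\ H10 Om (u t), L2 Om (f t) & L2 Om (du t)]}.
  move=> ev; have [Lf_ _] := L2_0T_L2_measurable Lf.
  have Hu : {ae lebesgue_measure, forall t : R, t \in `]0, T[ -> H10 Om (u t)} by case: ev => -[[]].
  by apply: filterS3 Lf_ (derivative_L2 ev) Hu => t h1 h2 h3 It; split; [exact: h3|exact: h1|exact: h2].
have equiv u du : evolution Om T u du -> {ae lebesgue_measure, forall t : R, t \in `]0, T[ ->
    (var_ineq Om B b f u du t <-> var_ineq_obstacle Om B b f u du t)}.
  move=> ev; apply: filterS (ae_L2 u du ev) => t H It; have [Hut Lft Ldt] := H It.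
  have [H1 H2] := obstacle_iff oOm bOm csc Hut Lft Ldt; split => K.
    by move=> z [Hz z0]; exact: H1.
  by apply: H2 => z Hz z0; apply: K.
split; [|split] => // u du.
  move=> flow u00.
  have ev : evolution Om T u du by case: flow.
  have Hu : H10 Om (u 0).
    (* u(0) agrees with u0 only almost everywhere, so its membership in H^1_0 has to be
       transferred. *)
    have Lu : L2 Om (u 0) by apply: (evolution_L2 ev); rewrite in_itv/= lexx ltW.
    exact: (H10_ae_eq Hu0 Lu u00).
  have H := flow_pos_part oOm bOm T0 csc Lf flow Hu.
  have rad : {ae lebesgue_measure, forall t : R, t \in `]0, T[ -> is_radon Om (Auf Om B b f u t)} by case: flow.
  split; first by split => //; apply: filterS2 rad H => t h1 h2 It; split; [exact: h1|case: (h2 It)].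
  apply: filterS H => t h It; have [nt pt] := h It.
  by rewrite (pos_part_normE oOm bOm pt) /L2plus_norm (asboolT nt).
move=> ev [sol _].
have V : {ae lebesgue_measure, forall t : R, t \in `]0, T[ -> var_ineq Om B b f u du t}.
  apply: filterS2 sol (ae_L2 u du ev) => t h1 h2 It phi Hphi phi0.
  have [_ pt] := h1 It; have [Hut Lft Ldt] := h2 It.
  apply: (nonneg_test_extend oOm bOm csc Hut Lft Ldt _ Hphi phi0) => psi npsi.
  exact: (pos_part_test_le oOm bOm pt npsi).
by apply: filterS2 V (equiv u du ev) => t h1 h2 It; split; [exact: h1|exact/(h2 It)/h1].
Qed.
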